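(* Let $D\subseteq\mathbb{C}$ be a domain, let $N,m\in\mathbb{N}$ with $m\geq 2$, and let $(f_n)_n\subseteq\mathcal{M}(D)$ be a sequence such that: (a) $\big(f_n^{(m+1)}/f_n^{(m)}\big)_n$ converges locally uniformly on $D$ to some $F_m\in\mathcal{M}(D)$; (b) for every $n$, the multiplicity of every zero of $f_n^{(m)}$ is at most $N$. Then $\big(f_n^{(m)}/f_n^{(m-1)}\big)_n$ and $\big(f_n^{(m-1)}/f_n^{(m-2)}\big)_n$ are both quasi-normal on $D$, and none of their subsequences converges to $\infty$.
   Context: $\mathbb{N}=\{1,2,\ldots\}$. For a domain (nonempty connected open set) $D\subseteq\mathbb{C}$, $\mathcal{M}(D)$ is the set of all meromorphic functions on $D$. $f^{(j)}$ is the $j$-th derivative, $f^{(0)}=f$. It is understood that $f_n^{(m)}\not\equiv0$ for all $n$, so that all the quotients are defined as meromorphic functions on $D$. Locally uniform convergence of meromorphic functions is with respect to the spherical metric on the Riemann sphere. For $E\subseteq D$, $E_D^{(1)}$ denotes the set of all accumulation points of $E$ in $D$. A family $\mathcal{F}\subseteq\mathcal{M}(D)$ is quasi-normal (also called $Q_1$-normal) on $D$ if for each sequence in $\mathcal{F}$ there exist a set $E\subseteq D$ with $E_D^{(1)}=\emptyset$ and a subsequence that converges locally uniformly with respect to the spherical metric on $D\setminus E$ (the limit $\infty$ is allowed). A sequence is called quasi-normal if the family of its members is. That a subsequence ''converges to $\infty$'' means that it converges locally uniformly to $\infty$ on $D\setminus E$ for some exceptional set $E\subseteq D$ with $E_D^{(1)}=\emptyset$.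 *)

(* Defs.v *)
From Stdlib Require Import Reals ClassicalEpsilon.
From Coquelicot Require Import Coquelicot.

Open Scope R_scope.

(** * The Riemann sphere *)

Inductive sphere : Type :=
  | Fin (z : C)
  | Inf.

(* The value 0 at [Inf] is a junk value. *)
Definition fin (p : sphere) : C :=
  match p with Fin z => z | Inf => RtoC 0 end.

(* Half of the Euclidean distance between the images of the two points under
   stereographic projection onto the unit sphere of R^3; it lies in [0, 1]. *)
Definition half_chord (p q : sphere) : R :=
  match p, q with
  | Fin z, Fin w =>
      Cmod (z - w)%C / (sqrt (1 + (Cmod z) ^ 2) * sqrt (1 + (Cmod w) ^ 2))
  | Fin z, Inf | Inf, Fin z => / sqrt (1 + (Cmod z) ^ 2)
  | Inf, Inf => 0
  end.

(* Great-circle distance on the unit sphere. *)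
Definition sph_dist (p q : sphere) : R := 2 * asin (half_chord p q).

(* Punctured limit in the sphere. *)
Definition is_sph_lim (f : C -> sphere) (z : C) (p : sphere) : Prop :=
  forall eps : R, 0 < eps -> locally' z (fun w => sph_dist (f w) p < eps).

(* Unspecified when the limit does not exist. *)
Definition sph_lim (f : C -> sphere) (z : C) : sphere :=
  epsilon (inhabits Inf) (is_sph_lim f z).

(** * Domains *)

Definition connected_set (D : C -> Prop) : Prop :=
  ~ exists U V : C -> Prop,
      open U /\ open V /\
      (forall z, D z -> U z \/ V z) /\
      (exists z, D z /\ U z) /\
      (exists z, D z /\ V z) /\
      (forall z, D z -> ~ (U z /\ V z)).

Definition planar_domain (D : C -> Prop) : Prop :=
  (exists z, D z) /\ open D /\ connected_set D.

(** * Meromorphic functions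

    They are represented by total maps to the sphere; only the values on the
    open set under consideration matter. *)

Definition C_differentiable (f : C -> C) (z : C) : Prop :=
  @ex_derive C_AbsRing C_NormedModule f z.

(* [f] is finite and complex differentiable at [z]. Differentiability at [z]
   only depends on [f] through [fin]; finiteness near [z] follows when the
   predicate holds near [z]. *)
Definition regular_pt (f : C -> sphere) (z : C) : Prop :=
  f z <> Inf /\ C_differentiable (fun w => fin (f w)) z.

Definition holomorphic_at (f : C -> sphere) (z : C) : Prop :=
  locally z (regular_pt f).

Definition pole_at (f : C -> sphere) (z : C) : Prop :=
  f z = Inf /\ locally' z (regular_pt f) /\ is_sph_lim f z Inf.

Definition meromorphic (D : C -> Prop) (f : C -> sphere) : Prop :=
  forall z, D z -> holomorphic_at f z \/ pole_at f z.

(* The derivative of a meromorphic function has the same poles. *)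
Definition mderiv (f : C -> sphere) : C -> sphere := fun z =>
  match f z with
  | Fin _ => Fin (C_derive (fun w => fin (f w)) z)
  | Inf => Inf
  end.

Definition mderiv_n (j : nat) (f : C -> sphere) : C -> sphere :=
  Nat.iter j mderiv f.

(* Quotient of meromorphic functions, [g] not identically zero: the pointwise
   quotient is defined off the isolated zeros and poles of [f] and [g], and its
   meromorphic extension is recovered by taking punctured limits. *)
Definition mquot (f g : C -> sphere) : C -> sphere :=
  sph_lim (fun w => Fin (fin (f w) / fin (g w))%C).

Definition not_identically_zero (D : C -> Prop) (f : C -> sphere) : Prop :=
  exists z, D z /\ f z <> Fin (RtoC 0).

Definition zero_of_mult (f : C -> sphere) (z : C) (k : nat) : Prop :=
  (1 <= k)%nat /\
  (forall j, (j < k)%nat -> mderiv_n j f z = Fin (RtoC 0)) /\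
  mderiv_n k f z <> Fin (RtoC 0).

(** * Convergence and quasi-normality *)

Definition cv_loc_unif (D : C -> Prop) (f : nat -> C -> sphere)
    (g : C -> sphere) : Prop :=
  forall z, D z -> exists r : R, 0 < r /\
    forall eps : R, 0 < eps -> exists n0 : nat, forall n, (n0 <= n)%nat ->
      forall w, D w -> Cmod (w - z)%C < r -> sph_dist (f n w) (g w) < eps.

(* The accumulation points of [E] in [D]. *)
Definition acc_pts (D E : C -> Prop) : C -> Prop := fun z =>
  D z /\ forall r : R, 0 < r ->
    exists w, E w /\ w <> z /\ Cmod (w - z)%C < r.

Definition exceptional (D E : C -> Prop) : Prop :=
  (forall z, E z -> D z) /\ (forall z, ~ acc_pts D E z).

Definition setminus (D E : C -> Prop) : C -> Prop := fun z => D z /\ ~ E z.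

Definition extraction (phi : nat -> nat) : Prop :=
  forall i j, (i < j)%nat -> (phi i < phi j)%nat.

(* No condition is put on the limit [g]: being a locally uniform limit of
   meromorphic functions, it is meromorphic or identically [Inf]. *)
Definition quasi_normal (D : C -> Prop) (F : (C -> sphere) -> Prop) : Prop :=
  (forall f, F f -> meromorphic D f) /\
  forall f : nat -> C -> sphere, (forall n, F (f n)) ->
    exists (E : C -> Prop) (phi : nat -> nat) (g : C -> sphere),
      exceptional D E /\ extraction phi /\
      cv_loc_unif (setminus D E) (fun n => f (phi n)) g.

Definition quasi_normal_seq (D : C -> Prop) (f : nat -> C -> sphere) : Prop :=
  quasi_normal D (fun h => exists n, h = f n).

Definition converges_to_Inf (D : C -> Prop) (f : nat -> C -> sphere) : Prop :=
  exists E : C -> Prop,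
    exceptional D E /\ cv_loc_unif (setminus D E) f (fun _ => Inf).

Definition no_subseq_to_Inf (D : C -> Prop) (f : nat -> C -> sphere) : Prop :=
  forall phi, extraction phi -> ~ converges_to_Inf D (fun n => f (phi n)).

(* Main.v *)
(* Write g = f^(m).  Near a point where phi_n = g_n'/g_n converges to a finite limit,
   the vectors (f_n^(m-2), f_n^(m-1), g_n) solve the linear system
   x' = y, y' = z, z' = phi_n z.  After normalising them at one point of a punctured
   disc and passing to a subsequence, Gronwall's inequality makes them converge on the
   whole punctured disc to a nowhere vanishing solution of the limit system, so the
   quotients y/x and z/y converge away from the zeros of the limit denominator, which
   is not identically zero.

   At a pole p of F_m these zeros must not accumulate.  This holds once F_m has at most
   a simple pole at p: Gronwall then gives a polynomial bound |z - p|^(-L) for the limit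
   solution, whose singularity at p is thus a pole.  The bound on multiplicities is what
   makes poles of F_m simple.  If p were a multiple pole, the residues of phi_n at its
   poles near p would tend to infinity in absolute value, so these points are not zeros
   of g_n (multiplicity at most N) but poles of order tending to infinity.  Then 1/g_n is
   holomorphic near p with a zero of unbounded order, while Gronwall keeps its modulus
   comparable on two fixed circles around p; the maximum principle is contradicted. *)

Require Import Defs.
From Stdlib Require Import Reals Lra Lia Psatz ClassicalEpsilon Classical ZArith.
From Stdlib Require Cantor.
From Coquelicot Require Import Coquelicot.

Open Scope R_scope.

(** * Complex differentiability *)

(** Poles of [f_n] may crowd at a pole [p] of [F_m], so uniform control exists only on annuli around
    [p]. Each [f_n] is single-valued, hence so is the limit solution, and only its growth at [p]
    decides whether zeros of a component accumulate there.

    Residues blow up at a multiple pole because [1 / F_m] is O(|z - p|^2). On a disc of radius rho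
    about [p] the reciprocals of phi_n are O(rho^2), so their derivatives at the poles of phi_n,
    which are the reciprocal residues, are O(rho). Such poles exist, since otherwise phi_n(p) would
    stay bounded.

    The two quotients cannot be read off one normalised limit: a normalised triple may converge to
    the constant (1, 0, 0), which says nothing about z/y. That quotient is obtained by normalising
    the pair (y, z) alone.

    Every subsequence has a further one along which the quotients converge to finite limits off
    isolated points. Diagonal extraction turns this into quasi-normality, and finiteness excludes
    the limit infinity. *)

Lemma Cmod_minus_sym (x y : C) : Cmod (x - y) = Cmod (y - x).
Proof. rewrite <- Cmod_opp. f_equal. ring. Qed.

Lemma Cmod_dist_triangle (x y z : C) :
  Cmod (x - z) <= Cmod (x - y) + Cmod (y - z).
Proof.
  replace (x - z)%C with ((x - y) + (y - z))%C by ring. apply Cmod_triangle.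
Qed.

Lemma Cmod_minus_ge (x y : C) : Cmod x - Cmod y <= Cmod (x - y).
Proof.
  assert (H := Cmod_triangle (x - y) y).
  replace (x - y + y)%C with x in H by ring. lra.
Qed.

Lemma Cmod_minus_le (x y : C) : Cmod (x - y) <= Cmod x + Cmod y.
Proof.
  assert (H := Cmod_triangle x (- y)). rewrite Cmod_opp in H.
  exact H.
Qed.

Lemma Cmod_minus_diag (x : C) : Cmod (x - x) = 0.
Proof. replace (x - x)%C with (RtoC 0) by ring. apply Cmod_0. Qed.

Lemma im_le_Cmod (c : C) : Rabs (Im c) <= Cmod c.
Proof.
  eapply Rle_trans; [ | apply Rmax_Cmod ]. apply Rmax_r.
Qed.

Lemma Cmod_le_Re_Im (c : C) : Cmod c <= Rabs (Re c) + Rabs (Im c).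
Proof.
  apply Rsqr_incr_0_var.
  - unfold Rsqr. assert (H := Cmod2_alt c).
    assert (H1 := Rabs_pos (Re c)). assert (H2 := Rabs_pos (Im c)).
    assert (H3 : Rabs (Re c) * Rabs (Re c) = Re c ^ 2).
    { rewrite <- Rabs_mult, Rabs_right; nra. }
    assert (H4 : Rabs (Im c) * Rabs (Im c) = Im c ^ 2).
    { rewrite <- Rabs_mult, Rabs_right; nra. }
    nra.
  - assert (H1 := Rabs_pos (Re c)). assert (H2 := Rabs_pos (Im c)). lra.
Qed.

Lemma Cmod_neq_0 (z : C) : 0 < Cmod z -> z <> RtoC 0.
Proof. intros H. apply Cmod_gt_0, H. Qed.

Lemma Cminus_neq_0 (x y : C) : x <> y -> (x - y)%C <> RtoC 0.
Proof.
  intros H E. apply H. replace x with ((x - y) + y)%C by ring. rewrite E. ring.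
Qed.

Lemma Cmod_minus_gt_0 (x y : C) : x <> y -> 0 < Cmod (x - y).
Proof. intros H. apply Cmod_gt_0. now apply Cminus_neq_0. Qed.

Lemma Cmod_le_0 (z : C) : Cmod z <= 0 -> z = RtoC 0.
Proof. intros H. apply Cmod_eq_0. assert (H1 := Cmod_ge_0 z). lra. Qed.

(** Division-free form of the complex derivative: the inequality is trivial at [w = z], so neither
    punctured neighbourhoods nor difference quotients enter the estimates. *)
Definition is_cd (f : C -> C) (z l : C) : Prop :=
  forall eps, 0 < eps -> exists del, 0 < del /\
    forall w, Cmod (w - z) < del ->
      Cmod (f w - f z - l * (w - z)) <= eps * Cmod (w - z).

Lemma locally_Cmod (z : C) (P : C -> Prop) :
  @locally C_UniformSpace z P <->
  exists r, 0 < r /\ forall w, Cmod (w - z) < r -> P w.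
Proof.
  rewrite locally_C. split.
  - intros [e He]. exists e. split; [apply cond_pos|].
    intros w Hw. apply He. exact Hw.
  - intros [r [Hr H]]. exists (mkposreal r Hr). intros w Hw. apply H. exact Hw.
Qed.

Lemma is_cd_is_derive (f : C -> C) (z l : C) :
  is_cd f z l <-> @is_derive C_AbsRing C_NormedModule f z l.
Proof.
  split.
  - intros H. split.
    + apply is_linear_scal_l.
    + intros x Hx.
      assert (Hx' : z = x).
      { apply (is_filter_lim_locally_unique (K := C_AbsRing) (V := AbsRing_NormedModule C_AbsRing) z x) in Hx. exact Hx. }
      subst x. intros eps.
      destruct (H eps (cond_pos eps)) as [d [Hd H1]].
      exists (mkposreal d Hd). intros w Hw.
      specialize (H1 w Hw).
      change (Cmod (f w - f z - (w - z) * l) <= eps * Cmod (w - z)).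
      now rewrite (Cmult_comm (w - z)).
  - intros [_ H] eps Heps.
    specialize (H z (fun P H => H) (mkposreal eps Heps)).
    destruct H as [d H].
    exists d. split; [apply cond_pos|]. intros w Hw.
    specialize (H w Hw).
    change (Cmod (f w - f z - (w - z) * l) <= eps * Cmod (w - z)) in H.
    now rewrite (Cmult_comm (w - z)) in H.
Qed.

Lemma C_derive_is_cd (f : C -> C) (z l : C) : is_cd f z l -> C_derive f z = l.
Proof. intros H. apply is_C_derive_unique. now apply is_cd_is_derive. Qed.

Lemma C_differentiable_iff (f : C -> C) (z : C) :
  C_differentiable f z <-> exists l, is_cd f z l.
Proof.
  split; intros [l H]; exists l; now apply is_cd_is_derive.
Qed.

Lemma C_differentiable_derive (f : C -> C) (z : C) :
  C_differentiable f z -> is_cd f z (C_derive f z).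
Proof.
  intros H. apply C_differentiable_iff in H. destruct H as [l H].
  rewrite (C_derive_is_cd f z l H). exact H.
Qed.

Lemma is_cd_unique (f : C -> C) (z l l' : C) : is_cd f z l -> is_cd f z l' -> l = l'.
Proof.
  intros H1 H2. rewrite <- (C_derive_is_cd _ _ _ H1). now apply C_derive_is_cd.
Qed.

Lemma is_cd_ext_loc (f g : C -> C) (z l : C) (r : R) :
  0 < r -> (forall w, Cmod (w - z) < r -> f w = g w) -> is_cd f z l -> is_cd g z l.
Proof.
  intros Hr E H eps Heps. destruct (H eps Heps) as [d [Hd H1]].
  exists (Rmin r d). split; [now apply Rmin_glb_lt|].
  intros w Hw. assert (A := Rmin_l r d). assert (B := Rmin_r r d).
  rewrite <- (E w), <- (E z).
  - apply H1. lra.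
  - rewrite Cmod_minus_diag. lra.
  - lra.
Qed.

Definition ccont (f : C -> C) (z : C) : Prop :=
  forall eps, 0 < eps -> exists del, 0 < del /\
    forall w, Cmod (w - z) < del -> Cmod (f w - f z) < eps.

Lemma is_cd_ccont (f : C -> C) (z l : C) : is_cd f z l -> ccont f z.
Proof.
  intros H eps Heps. destruct (H 1 Rlt_0_1) as [d [Hd H1]].
  assert (Hl := Cmod_ge_0 l).
  exists (Rmin d (eps / (2 + Cmod l))). split.
  - apply Rmin_glb_lt; [lra|]. apply Rdiv_lt_0_compat; lra.
  - intros w Hw. assert (A := Rmin_l d (eps / (2 + Cmod l))).
    assert (B := Rmin_r d (eps / (2 + Cmod l))).
    specialize (H1 w ltac:(lra)).
    assert (H2 : Cmod (f w - f z) <= Cmod (f w - f z - l * (w - z)) + Cmod (l * (w - z))).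
    { replace (f w - f z)%C with ((f w - f z - l * (w - z)) + l * (w - z))%C at 1 by ring.
      apply Cmod_triangle. }
    rewrite Cmod_mult in H2.
    assert (H3 : Cmod (w - z) * (2 + Cmod l) < eps).
    { assert (H4 : Cmod (w - z) < eps / (2 + Cmod l)) by lra.
      apply Rmult_lt_compat_r with (r := 2 + Cmod l) in H4; [|lra].
      unfold Rdiv in H4. rewrite Rmult_assoc, Rinv_l, Rmult_1_r in H4; lra. }
    assert (H4 := Cmod_ge_0 (w - z)%C). nra.
Qed.

Lemma is_cd_const (c z : C) : is_cd (fun _ => c) z (RtoC 0).
Proof.
  intros eps Heps. exists 1. split; [lra|]. intros w _.
  replace (c - c - 0 * (w - z))%C with (RtoC 0) by ring. rewrite Cmod_0.
  assert (H := Cmod_ge_0 (w - z)%C). nra.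
Qed.

Lemma is_cd_id (z : C) : is_cd (fun w => w) z (RtoC 1).
Proof.
  intros eps Heps. exists 1. split; [lra|]. intros w _.
  replace (w - z - 1 * (w - z))%C with (RtoC 0) by ring. rewrite Cmod_0.
  assert (H := Cmod_ge_0 (w - z)%C). nra.
Qed.

Lemma is_cd_plus (f g : C -> C) (z l k : C) :
  is_cd f z l -> is_cd g z k -> is_cd (fun w => f w + g w)%C z (l + k)%C.
Proof.
  intros Hf Hg eps Heps.
  destruct (Hf (eps / 2)) as [d1 [Hd1 H1]]; [lra|].
  destruct (Hg (eps / 2)) as [d2 [Hd2 H2]]; [lra|].
  exists (Rmin d1 d2). split; [now apply Rmin_glb_lt|]. intros w Hw.
  assert (A := Rmin_l d1 d2). assert (B := Rmin_r d1 d2).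
  specialize (H1 w ltac:(lra)). specialize (H2 w ltac:(lra)).
  replace (f w + g w - (f z + g z) - (l + k) * (w - z))%C with
    ((f w - f z - l * (w - z)) + (g w - g z - k * (w - z)))%C by ring.
  eapply Rle_trans; [apply Cmod_triangle|]. lra.
Qed.

Lemma is_cd_mult (f g : C -> C) (z l k : C) :
  is_cd f z l -> is_cd g z k ->
  is_cd (fun w => f w * g w)%C z (l * g z + f z * k)%C.
Proof.
  intros Hf Hg eps Heps.
  set (M := 1 + Cmod (f z) + Cmod (g z) + Cmod l).
  assert (HM : 1 <= M).
  { unfold M. assert (A := Cmod_ge_0 (f z)). assert (B := Cmod_ge_0 (g z)).
    assert (D := Cmod_ge_0 l). lra. }
  assert (Hgc := is_cd_ccont _ _ _ Hg).
  set (e := Rmin 1 (eps / (4 * M))).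
  assert (He : 0 < e). { apply Rmin_glb_lt; [lra|]. apply Rdiv_lt_0_compat; lra. }
  assert (HeM : e * (4 * M) <= eps).
  { assert (A := Rmin_r 1 (eps / (4 * M))). fold e in A.
    apply Rmult_le_compat_r with (r := 4 * M) in A; [|lra].
    unfold Rdiv in A. rewrite Rmult_assoc, Rinv_l, Rmult_1_r in A; lra. }
  assert (He1 : e <= 1) by apply Rmin_l.
  destruct (Hf e He) as [d1 [Hd1 H1]].
  destruct (Hg e He) as [d2 [Hd2 H2]].
  destruct (Hgc e He) as [d3 [Hd3 H3]].
  exists (Rmin d1 (Rmin d2 d3)). split; [repeat apply Rmin_glb_lt; lra|]. intros w Hw.
  assert (A := Rmin_l d1 (Rmin d2 d3)). assert (B := Rmin_r d1 (Rmin d2 d3)).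
  assert (A1 := Rmin_l d2 d3). assert (B1 := Rmin_r d2 d3).
  specialize (H1 w ltac:(lra)). specialize (H2 w ltac:(lra)). specialize (H3 w ltac:(lra)).
  set (t := Cmod (w - z)) in *. assert (Ht := Cmod_ge_0 (w - z)%C). fold t in Ht.
  replace (f w * g w - f z * g z - (l * g z + f z * k) * (w - z))%C with
    ((f w - f z - l * (w - z)) * g w + (l * (w - z) * (g w - g z)
     + f z * (g w - g z - k * (w - z))))%C by ring.
  eapply Rle_trans; [apply Cmod_triangle|].
  eapply Rle_trans; [apply Rplus_le_compat_l, Cmod_triangle|].
  rewrite !Cmod_mult. fold t.
  assert (Hgw : Cmod (g w) <= Cmod (g z) + 1).
  { assert (E := Cmod_triangle (g w - g z) (g z)).
    replace (g w - g z + g z)%C with (g w) in E by ring. lra. }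
  assert (P1 := Cmod_ge_0 (f w - f z - l * (w - z))).
  assert (P2 := Cmod_ge_0 (g w)). assert (P3 := Cmod_ge_0 (f z)).
  assert (P4 := Cmod_ge_0 l). assert (P5 := Cmod_ge_0 (g z)).
  assert (P6 := Cmod_ge_0 (g w - g z)). assert (P7 := Cmod_ge_0 (g w - g z - k * (w - z))).
  assert (Q1 : Cmod (f w - f z - l * (w - z)) * Cmod (g w) <= (e * t) * M).
  { apply Rmult_le_compat; try lra. unfold M. lra. }
  assert (Q2 : Cmod l * t * Cmod (g w - g z) <= M * t * e).
  { apply Rmult_le_compat; try lra; [nra|]. apply Rmult_le_compat_r; [lra|]. unfold M; lra. }
  assert (Q3 : Cmod (f z) * Cmod (g w - g z - k * (w - z)) <= M * (e * t)).
  { apply Rmult_le_compat; try lra. unfold M; lra. }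
  assert (0 <= e * t * M) by (repeat apply Rmult_le_pos; lra).
  assert (t * (e * (4 * M)) <= t * eps) by (apply Rmult_le_compat_l; lra).
  nra.
Qed.

Lemma is_cd_val (f : C -> C) (z l l' : C) : is_cd f z l -> l = l' -> is_cd f z l'.
Proof. intros H E. now subst. Qed.

Lemma is_cd_scal (c : C) (f : C -> C) (z l : C) :
  is_cd f z l -> is_cd (fun w => c * f w)%C z (c * l)%C.
Proof.
  intros H. eapply is_cd_val; [apply (is_cd_mult _ _ _ _ _ (is_cd_const c z) H)|].
  ring.
Qed.

Lemma is_cd_minus (f g : C -> C) (z l k : C) :
  is_cd f z l -> is_cd g z k -> is_cd (fun w => f w - g w)%C z (l - k)%C.
Proof.
  intros Hf Hg. assert (H := is_cd_plus _ _ _ _ _ Hf (is_cd_scal (- (1))%C _ _ _ Hg)).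
  eapply is_cd_val.
  - eapply is_cd_ext_loc; [apply Rlt_0_1| |exact H]. intros w _. cbv beta. ring.
  - ring.
Qed.

Lemma is_cd_inv (f : C -> C) (z l : C) :
  is_cd f z l -> f z <> RtoC 0 -> is_cd (fun w => / f w)%C z (- l / (f z * f z))%C.
Proof.
  intros Hf Hz eps Heps.
  assert (Hm : 0 < Cmod (f z)) by now apply Cmod_gt_0.
  set (m := Cmod (f z)) in *.
  set (e := Rmin (eps * (m * m) / 4) (eps * (m * m * m) / (4 * (Cmod l + 1)))).
  assert (Hl := Cmod_ge_0 l).
  assert (Hmm : 0 < m * m) by nra.
  assert (Hmmm : 0 < m * m * m) by nra.
  assert (He : 0 < e).
  { apply Rmin_glb_lt. nra. apply Rdiv_lt_0_compat; nra. }
  destruct (Hf e He) as [d1 [Hd1 H1]].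
  destruct (is_cd_ccont _ _ _ Hf (Rmin (m / 2) e)) as [d2 [Hd2 H2]].
  { apply Rmin_glb_lt; lra. }
  exists (Rmin d1 d2). split; [now apply Rmin_glb_lt|]. intros w Hw.
  assert (A := Rmin_l d1 d2). assert (B := Rmin_r d1 d2).
  specialize (H1 w ltac:(lra)). specialize (H2 w ltac:(lra)).
  assert (A1 := Rmin_l (m / 2) e). assert (B1 := Rmin_r (m / 2) e).
  assert (Hw2 : m / 2 <= Cmod (f w)).
  { assert (E := Cmod_minus_ge (f z) (f w)). rewrite Cmod_minus_sym in E.
    fold m in E. lra. }
  assert (Hfw : f w <> RtoC 0) by (apply Cmod_gt_0; lra).
  replace (/ f w - / f z - - l / (f z * f z) * (w - z))%C with
   ((- (f w - f z - l * (w - z)) / (f w * f z))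
     + l * (w - z) * (f w - f z) / (f w * (f z * f z)))%C by (field; auto).
  eapply Rle_trans; [apply Cmod_triangle|].
  rewrite !Cmod_div, Cmod_opp, !Cmod_mult by (repeat apply Cmult_neq_0; auto).
  fold m. set (t := Cmod (w - z)) in *.
  assert (Ht := Cmod_ge_0 (w - z)%C). fold t in Ht.
  assert (Q1 : Cmod (f w - f z - l * (w - z)) / (Cmod (f w) * m) <= eps / 2 * t).
  { apply Rle_div_l; [nra|].
    assert (e <= eps * (m * m) / 4) by apply Rmin_l.
    apply Rle_trans with (e * t); [lra|].
    apply Rle_trans with (eps * (m * m) / 4 * t); [nra|].
    assert (0 <= eps * t * m) by (repeat apply Rmult_le_pos; lra).
    nra. }
  assert (Q2 : Cmod l * t * Cmod (f w - f z) / (Cmod (f w) * (m * m)) <= eps / 2 * t).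
  { apply Rle_div_l; [nra|].
    assert (e <= eps * (m * m * m) / (4 * (Cmod l + 1))) by apply Rmin_r.
    assert (Hc : (Cmod l + 1) * e <= eps * (m * m * m) / 4).
    { apply Rle_trans with ((Cmod l + 1) * (eps * (m * m * m) / (4 * (Cmod l + 1)))).
      - apply Rmult_le_compat_l; lra.
      - right. field. lra. }
    assert (P := Cmod_ge_0 (f w - f z)).
    apply Rle_trans with (t * ((Cmod l + 1) * e)).
    - replace (Cmod l * t * Cmod (f w - f z)) with (t * (Cmod l * Cmod (f w - f z))) by ring.
      apply Rmult_le_compat_l; [lra|]. apply Rmult_le_compat; lra.
    - apply Rle_trans with (t * (eps * (m * m * m) / 4)).
      + apply Rmult_le_compat_l; lra.
      + assert (0 <= eps * t * (m * m)) by (repeat apply Rmult_le_pos; lra).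
        nra. }
  lra.
Qed.

Lemma is_cd_div (f g : C -> C) (z l k : C) :
  is_cd f z l -> is_cd g z k -> g z <> RtoC 0 ->
  is_cd (fun w => f w / g w)%C z ((l * g z - f z * k) / (g z * g z))%C.
Proof.
  intros Hf Hg Hz.
  eapply is_cd_val; [apply (is_cd_mult _ _ _ _ _ Hf (is_cd_inv _ _ _ Hg Hz))|].
  field. exact Hz.
Qed.

Lemma is_cd_pow (z p : C) (n : nat) :
  is_cd (fun w => (w - p) ^ S n)%C z (INR (S n) * (z - p) ^ n)%C.
Proof.
  assert (H0 : is_cd (fun w => (w - p)%C) z (RtoC 1)).
  { eapply is_cd_val; [apply (is_cd_minus _ _ _ _ _ (is_cd_id z) (is_cd_const p z))|]. ring. }
  induction n.
  - eapply is_cd_ext_loc; [apply Rlt_0_1| |eapply is_cd_val; [exact H0|]].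
    + intros w _. simpl. ring.
    + simpl. ring.
  - eapply is_cd_ext_loc; [apply Rlt_0_1| |eapply is_cd_val; [apply (is_cd_mult _ _ _ _ _ H0 IHn)|]].
    + intros w _. simpl. ring.
    + rewrite (S_INR (S n)), RtoC_plus. simpl (Cpow _ (S n)). ring.
Qed.

Lemma is_cd_pow_n (z p : C) (n : nat) : exists l, is_cd (fun w => (w - p) ^ n)%C z l.
Proof.
  destruct n as [|n].
  - eexists. eapply is_cd_ext_loc; [apply Rlt_0_1| |apply (is_cd_const (RtoC 1) z)].
    intros w _. reflexivity.
  - eexists. apply is_cd_pow.
Qed.

(** * Paths and their integrals *)

(** Componentwise, so that real continuity, differentiation and [RInt] apply directly; the forms
    with [Cmod] are recovered in [pcont_eps] and [pder_eps]. *)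
Definition pcont (p : R -> C) (t : R) : Prop :=
  continuous (fun s => fst (p s)) t /\ continuous (fun s => snd (p s)) t.

Definition pder (p : R -> C) (t : R) (l : C) : Prop :=
  is_derive (fun s => fst (p s)) t (fst l) /\ is_derive (fun s => snd (p s)) t (snd l).

Lemma locally_R (x : R) (P : R -> Prop) :
  locally x P <-> exists d, 0 < d /\ forall y, Rabs (y - x) < d -> P y.
Proof.
  split.
  - intros [d H]. exists d. split; [apply cond_pos|]. intros y Hy. now apply H.
  - intros [d [Hd H]]. exists (mkposreal d Hd). intros y Hy. now apply H.
Qed.

Lemma is_derive_eps (f : R -> R) (x l : R) :
  is_derive f x l <-> forall eps, 0 < eps -> exists d, 0 < d /\
    forall y, Rabs (y - x) < d -> Rabs (f y - f x - l * (y - x)) <= eps * Rabs (y - x).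
Proof.
  rewrite is_derive_Reals. split.
  - intros H eps Heps. destruct (H eps Heps) as [d Hd]. exists d. split; [apply cond_pos|].
    intros y Hy. destruct (Req_dec y x) as [->|Hyx].
    + replace (f x - f x - l * (x - x)) with 0 by ring. rewrite Rminus_diag, Rabs_R0. lra.
    + specialize (Hd (y - x) ltac:(lra) Hy). replace (x + (y - x)) with y in Hd by ring.
      replace (f y - f x - l * (y - x)) with (((f y - f x) / (y - x) - l) * (y - x)) by (field; lra).
      rewrite Rabs_mult. apply Rmult_le_compat_r; [apply Rabs_pos|lra].
  - intros H eps Heps. destruct (H (eps / 2)) as [d [Hd H1]]; [lra|].
    exists (mkposreal d Hd). intros h Hh Hd'. simpl in Hd'.
    specialize (H1 (x + h)). replace (x + h - x) with h in H1 by ring. specialize (H1 Hd').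
    replace ((f (x + h) - f x) / h - l) with ((f (x + h) - f x - l * h) / h) by (field; lra).
    unfold Rdiv. rewrite Rabs_mult, Rabs_inv.
    assert (H2 : 0 < Rabs h) by now apply Rabs_pos_lt.
    assert (H3 : 0 < eps * Rabs h) by now apply Rmult_lt_0_compat.
    apply (Rlt_div_l (Rabs (f (x + h) - f x - l * h))); lra.
Qed.

Lemma continuous_eps (f : R -> R) (x : R) :
  continuous f x <-> forall eps, 0 < eps -> exists d, 0 < d /\
    forall y, Rabs (y - x) < d -> Rabs (f y - f x) < eps.
Proof.
  split.
  - intros H eps Heps.
    specialize (H (fun y => Rabs (y - f x) < eps)).
    assert (H0 : locally (f x) (fun y => Rabs (y - f x) < eps)).
    { exists (mkposreal eps Heps). intros y Hy. exact Hy. }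
    specialize (H H0). apply locally_R in H. exact H.
  - intros H P [e He]. destruct (H e (cond_pos e)) as [d [Hd H1]].
    apply locally_R. exists d. split; [exact Hd|]. intros y Hy. apply He. now apply H1.
Qed.

Lemma fst_le_Cmod (c : C) : Rabs (fst c) <= Cmod c.
Proof. apply re_le_Cmod. Qed.
Lemma snd_le_Cmod (c : C) : Rabs (snd c) <= Cmod c.
Proof. apply im_le_Cmod. Qed.
Lemma Cmod_le_fst_snd (c : C) : Cmod c <= Rabs (fst c) + Rabs (snd c).
Proof. apply Cmod_le_Re_Im. Qed.

Lemma pcont_eps (p : R -> C) (t : R) :
  pcont p t <-> forall eps, 0 < eps -> exists d, 0 < d /\
    forall s, Rabs (s - t) < d -> Cmod (p s - p t) < eps.
Proof.
  unfold pcont. rewrite !continuous_eps. split.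
  - intros [H1 H2] eps Heps.
    destruct (H1 (eps / 2)) as [d1 [Hd1 K1]]; [lra|].
    destruct (H2 (eps / 2)) as [d2 [Hd2 K2]]; [lra|].
    exists (Rmin d1 d2). split; [now apply Rmin_glb_lt|]. intros s Hs.
    assert (A := Rmin_l d1 d2). assert (B := Rmin_r d1 d2).
    specialize (K1 s ltac:(lra)). specialize (K2 s ltac:(lra)).
    eapply Rle_lt_trans; [apply Cmod_le_fst_snd|]. simpl. unfold Rminus in *. lra.
  - intros H. split; intros eps Heps; destruct (H eps Heps) as [d [Hd K]];
    exists d; (split; [exact Hd|]); intros s Hs; (eapply Rle_lt_trans; [|apply (K s Hs)]).
    + apply (fst_le_Cmod (p s - p t)).
    + apply (snd_le_Cmod (p s - p t)).
Qed.

Lemma pder_eps (p : R -> C) (t : R) (l : C) :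
  pder p t l <-> forall eps, 0 < eps -> exists d, 0 < d /\
    forall s, Rabs (s - t) < d ->
      Cmod (p s - p t - l * RtoC (s - t)) <= eps * Rabs (s - t).
Proof.
  unfold pder. rewrite !is_derive_eps.
  assert (E1 : forall s, fst (p s - p t - l * RtoC (s - t))%C = fst (p s) - fst (p t) - fst l * (s - t)).
  { intros s. simpl. ring. }
  assert (E2 : forall s, snd (p s - p t - l * RtoC (s - t))%C = snd (p s) - snd (p t) - snd l * (s - t)).
  { intros s. simpl. ring. }
  split.
  - intros [H1 H2] eps Heps.
    destruct (H1 (eps / 2)) as [d1 [Hd1 K1]]; [lra|].
    destruct (H2 (eps / 2)) as [d2 [Hd2 K2]]; [lra|].
    exists (Rmin d1 d2). split; [now apply Rmin_glb_lt|]. intros s Hs.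
    assert (A := Rmin_l d1 d2). assert (B := Rmin_r d1 d2).
    specialize (K1 s ltac:(lra)). specialize (K2 s ltac:(lra)).
    eapply Rle_trans; [apply Cmod_le_fst_snd|]. rewrite E1, E2. lra.
  - intros H. split; intros eps Heps; destruct (H eps Heps) as [d [Hd K]];
    exists d; (split; [exact Hd|]); intros s Hs; (eapply Rle_trans; [|apply (K s Hs)]).
    + rewrite <- E1. apply fst_le_Cmod.
    + rewrite <- E2. apply snd_le_Cmod.
Qed.

Lemma pder_pcont (p : R -> C) (t : R) (l : C) : pder p t l -> pcont p t.
Proof.
  intros [H1 H2]. split.
  - apply (ex_derive_continuous (fun s => fst (p s))). now exists (fst l).
  - apply (ex_derive_continuous (fun s => snd (p s))). now exists (snd l).
Qed.

Lemma pcont_comp (f : C -> C) (p : R -> C) (t : R) :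
  ccont f (p t) -> pcont p t -> pcont (fun s => f (p s)) t.
Proof.
  rewrite !pcont_eps. intros Hf Hp eps Heps.
  destruct (Hf eps Heps) as [e [He H]]. destruct (Hp e He) as [d [Hd H']].
  exists d. split; [exact Hd|]. intros s Hs. auto.
Qed.

Lemma pder_comp (f : C -> C) (p : R -> C) (t : R) (l k : C) :
  is_cd f (p t) l -> pder p t k -> pder (fun s => f (p s)) t (l * k)%C.
Proof.
  intros Hf Hp. assert (Hc := pder_pcont _ _ _ Hp). rewrite pcont_eps in Hc.
  rewrite pder_eps in *. intros eps Heps.
  assert (Hl := Cmod_ge_0 l). assert (Hk := Cmod_ge_0 k).
  set (e1 := eps / (2 * (Cmod k + 1))).
  set (e2 := Rmin 1 (eps / (2 * (Cmod l + 1)))).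
  assert (He1 : 0 < e1) by (apply Rdiv_lt_0_compat; lra).
  assert (He2 : 0 < e2).
  { apply Rmin_glb_lt; [lra|]. apply Rdiv_lt_0_compat; lra. }
  assert (E1 : e1 * (Cmod k + 1) = eps / 2) by (unfold e1; field; lra).
  assert (E2 : e2 * (Cmod l + 1) <= eps / 2).
  { apply Rle_trans with (eps / (2 * (Cmod l + 1)) * (Cmod l + 1)).
    - apply Rmult_le_compat_r; [lra|]. apply Rmin_r.
    - right. field. lra. }
  assert (E3 : e2 <= 1) by apply Rmin_l.
  destruct (Hf e1 He1) as [d1 [Hd1 K1]].
  destruct (Hp e2 He2) as [d2 [Hd2 K2]].
  destruct (Hc d1 Hd1) as [d3 [Hd3 K3]].
  exists (Rmin d2 d3). split; [now apply Rmin_glb_lt|]. intros s Hs.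
  assert (A := Rmin_l d2 d3). assert (B := Rmin_r d2 d3).
  specialize (K3 s ltac:(lra)). specialize (K1 _ K3). specialize (K2 s ltac:(lra)).
  set (h := Rabs (s - t)) in *. assert (Hh : 0 <= h) by apply Rabs_pos.
  assert (Hst : Cmod (RtoC (s - t)) = h) by apply Cmod_R.
  assert (K4 : Cmod (p s - p t) <= (Cmod k + 1) * h).
  { replace (p s - p t)%C with ((p s - p t - k * RtoC (s - t)) + k * RtoC (s - t))%C by ring.
    eapply Rle_trans; [apply Cmod_triangle|]. rewrite Cmod_mult, Hst. nra. }
  replace (f (p s) - f (p t) - l * k * RtoC (s - t))%C with
   ((f (p s) - f (p t) - l * (p s - p t)) + l * (p s - p t - k * RtoC (s - t)))%C by ring.
  eapply Rle_trans; [apply Cmod_triangle|]. rewrite Cmod_mult.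
  assert (Q1 : e1 * Cmod (p s - p t) <= e1 * ((Cmod k + 1) * h)) by (apply Rmult_le_compat_l; lra).
  assert (Q2 : Cmod l * Cmod (p s - p t - k * RtoC (s - t)) <= (Cmod l + 1) * (e2 * h)).
  { apply Rmult_le_compat; try lra. apply Cmod_ge_0. }
  assert (h * (e2 * (Cmod l + 1)) <= h * (eps / 2)) by (apply Rmult_le_compat_l; lra).
  nra.
Qed.

Lemma pcont_const (c : C) (t : R) : pcont (fun _ => c) t.
Proof. split; apply continuous_const. Qed.

Lemma pcont_plus (p q : R -> C) (t : R) :
  pcont p t -> pcont q t -> pcont (fun s => p s + q s)%C t.
Proof.
  intros [A B] [D E]. split; simpl.
  - now apply (continuous_plus (fun s => fst (p s)) (fun s => fst (q s))).
  - now apply (continuous_plus (fun s => snd (p s)) (fun s => snd (q s))).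
Qed.

Lemma pcont_mult (p q : R -> C) (t : R) :
  pcont p t -> pcont q t -> pcont (fun s => p s * q s)%C t.
Proof.
  intros [A B] [D E]. split; simpl.
  - apply (continuous_minus (fun s => fst (p s) * fst (q s)) (fun s => snd (p s) * snd (q s)));
    now apply (continuous_mult (K := R_AbsRing)).
  - apply (continuous_plus (fun s => fst (p s) * snd (q s)) (fun s => snd (p s) * fst (q s)));
    now apply (continuous_mult (K := R_AbsRing)).
Qed.

Lemma pcont_minus (p q : R -> C) (t : R) :
  pcont p t -> pcont q t -> pcont (fun s => p s - q s)%C t.
Proof.
  intros [A B] [D E]. split; simpl.
  - now apply (continuous_minus (fun s => fst (p s)) (fun s => fst (q s))).
  - now apply (continuous_minus (fun s => snd (p s)) (fun s => snd (q s))).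
Qed.

Lemma pcont_inv (p : R -> C) (t : R) :
  pcont p t -> p t <> RtoC 0 -> pcont (fun s => / p s)%C t.
Proof.
  intros Hp Hz. apply (pcont_comp (fun w => / w)%C p t); [|exact Hp].
  eapply is_cd_ccont. apply (is_cd_inv (fun w => w) (p t) _ (is_cd_id _) Hz).
Qed.

Lemma pcont_div (p q : R -> C) (t : R) :
  pcont p t -> pcont q t -> q t <> RtoC 0 -> pcont (fun s => p s / q s)%C t.
Proof. intros. apply pcont_mult; [assumption|now apply pcont_inv]. Qed.

Definition CInt (p : R -> C) (a b : R) : C :=
  (RInt (fun t => fst (p t)) a b, RInt (fun t => snd (p t)) a b).

Definition pcont_on (p : R -> C) (a b : R) : Prop := forall t, a <= t <= b -> pcont p t.

Lemma pcont_on_ex1 p a b : a <= b -> pcont_on p a b -> ex_RInt (fun t => fst (p t)) a b.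
Proof.
  intros Hab H. apply (ex_RInt_continuous (V := R_CompleteNormedModule)).
  rewrite Rmin_left, Rmax_right by lra. intros t Ht. apply (H t Ht).
Qed.
Lemma pcont_on_ex2 p a b : a <= b -> pcont_on p a b -> ex_RInt (fun t => snd (p t)) a b.
Proof.
  intros Hab H. apply (ex_RInt_continuous (V := R_CompleteNormedModule)).
  rewrite Rmin_left, Rmax_right by lra. intros t Ht. apply (H t Ht).
Qed.

(** The factor 2 comes from estimating real and imaginary parts separately. It reappears in all
    Cauchy estimates below, which only matter up to constants. *)
Lemma CInt_bound (p : R -> C) (a b M : R) :
  a <= b -> pcont_on p a b -> (forall t, a <= t <= b -> Cmod (p t) <= M) ->
  Cmod (CInt p a b) <= 2 * M * (b - a).
Proof.
  intros Hab Hp HM. eapply Rle_trans; [apply Cmod_le_fst_snd|]. simpl.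
  assert (H1 : Rabs (RInt (fun t => fst (p t)) a b) <= (b - a) * M).
  { apply abs_RInt_le_const; [exact Hab|now apply pcont_on_ex1|].
    intros t Ht. eapply Rle_trans; [apply fst_le_Cmod|auto]. }
  assert (H2 : Rabs (RInt (fun t => snd (p t)) a b) <= (b - a) * M).
  { apply abs_RInt_le_const; [exact Hab|now apply pcont_on_ex2|].
    intros t Ht. eapply Rle_trans; [apply snd_le_Cmod|auto]. }
  lra.
Qed.

Lemma CInt_ext (p q : R -> C) (a b : R) :
  a <= b -> (forall t, a <= t <= b -> p t = q t) -> CInt p a b = CInt q a b.
Proof.
  intros Hab E. unfold CInt. f_equal; apply RInt_ext;
  rewrite Rmin_left, Rmax_right by lra; intros t Ht; rewrite E; auto; lra.
Qed.

Lemma CInt_scal (c : C) (p : R -> C) (a b : R) :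
  a <= b -> pcont_on p a b ->
  CInt (fun t => c * p t)%C a b = (c * CInt p a b)%C.
Proof.
  intros Hab Hp.
  assert (H1 := pcont_on_ex1 _ _ _ Hab Hp). assert (H2 := pcont_on_ex2 _ _ _ Hab Hp).
  unfold CInt, Cmult. cbn [fst snd]. f_equal.
  - rewrite (RInt_minus (V := R_CompleteNormedModule) (fun t => fst c * fst (p t)) (fun t => snd c * snd (p t))).
    + rewrite (RInt_scal (V := R_CompleteNormedModule) (fun t => fst (p t))) by exact H1.
      rewrite (RInt_scal (V := R_CompleteNormedModule) (fun t => snd (p t))) by exact H2. reflexivity.
    + now apply (ex_RInt_scal (V := R_NormedModule) (fun t => fst (p t))).
    + now apply (ex_RInt_scal (V := R_NormedModule) (fun t => snd (p t))).
  - rewrite (RInt_plus (V := R_CompleteNormedModule) (fun t => fst c * snd (p t)) (fun t => snd c * fst (p t))).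
    + rewrite (RInt_scal (V := R_CompleteNormedModule) (fun t => fst (p t))) by exact H1.
      rewrite (RInt_scal (V := R_CompleteNormedModule) (fun t => snd (p t))) by exact H2. reflexivity.
    + now apply (ex_RInt_scal (V := R_NormedModule) (fun t => snd (p t))).
    + now apply (ex_RInt_scal (V := R_NormedModule) (fun t => fst (p t))).
Qed.

Lemma CInt_minus (p q : R -> C) (a b : R) :
  a <= b -> pcont_on p a b -> pcont_on q a b ->
  CInt (fun t => p t - q t)%C a b = (CInt p a b - CInt q a b)%C.
Proof.
  intros Hab Hp Hq. unfold CInt, Cminus, Cplus, Copp. simpl. f_equal.
  - apply (RInt_minus (V := R_CompleteNormedModule) (fun t => fst (p t)) (fun t => fst (q t))); now apply pcont_on_ex1.
  - apply (RInt_minus (V := R_CompleteNormedModule) (fun t => snd (p t)) (fun t => snd (q t))); now apply pcont_on_ex2.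
Qed.

Lemma CInt_const (c : C) (a b : R) : CInt (fun _ => c) a b = (RtoC (b - a) * c)%C.
Proof.
  unfold CInt. rewrite !(RInt_const (V := R_CompleteNormedModule)).
  unfold Cmult, scal; simpl; unfold mult; simpl. f_equal; ring.
Qed.

Lemma CInt_Chasles (p : R -> C) (a m b : R) :
  a <= m <= b -> pcont_on p a b -> CInt p a b = (CInt p a m + CInt p m b)%C.
Proof.
  intros Hm Hp.
  assert (P1 : pcont_on p a m) by (intros t Ht; apply Hp; lra).
  assert (P2 : pcont_on p m b) by (intros t Ht; apply Hp; lra).
  unfold CInt, Cplus. simpl. f_equal; symmetry.
  - apply (RInt_Chasles (V := R_CompleteNormedModule)); apply pcont_on_ex1; auto; lra.
  - apply (RInt_Chasles (V := R_CompleteNormedModule)); apply pcont_on_ex2; auto; lra.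
Qed.

Lemma CInt_FTC (q p : R -> C) (a b : R) :
  a <= b -> (forall t, a <= t <= b -> pder q t (p t)) -> pcont_on p a b ->
  CInt p a b = (q b - q a)%C.
Proof.
  intros Hab Hd Hp. unfold CInt, Cminus, Cplus, Copp. simpl. f_equal.
  - apply is_RInt_unique.
    apply (is_RInt_derive (V := R_CompleteNormedModule) (fun t => fst (q t)) (fun t => fst (p t)));
    rewrite Rmin_left, Rmax_right by lra; intros t Ht; [apply (Hd t Ht)|apply (Hp t Ht)].
  - apply is_RInt_unique.
    apply (is_RInt_derive (V := R_CompleteNormedModule) (fun t => snd (q t)) (fun t => snd (p t)));
    rewrite Rmin_left, Rmax_right by lra; intros t Ht; [apply (Hd t Ht)|apply (Hp t Ht)].
Qed.

(** * Goursat's theorem *)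

Lemma nested_intervals (a b : nat -> R) :
  (forall n, a n <= a (S n)) -> (forall n, b (S n) <= b n) -> (forall n, a n <= b n) ->
  exists x, forall n, a n <= x <= b n.
Proof.
  intros Ha Hb Hab.
  assert (Ham : forall n k, a n <= a (n + k)%nat).
  { intros n k. induction k; [rewrite Nat.add_0_r; lra|].
    rewrite Nat.add_succ_r. specialize (Ha (n + k)%nat). lra. }
  assert (Hbm : forall n k, b (n + k)%nat <= b n).
  { intros n k. induction k; [rewrite Nat.add_0_r; lra|].
    rewrite Nat.add_succ_r. specialize (Hb (n + k)%nat). lra. }
  assert (Hc : forall i j, a i <= b j).
  { intros i j. specialize (Ham i j). specialize (Hbm j i). specialize (Hab (i + j)%nat).
    rewrite Nat.add_comm in Hbm. lra. }
  destruct (completeness (fun x => exists n, x = a n)) as [x [H1 H2]].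
  - exists (b 0%nat). intros y [n ->]. apply Hc.
  - exists (a 0%nat). now exists 0%nat.
  - exists x. intros n. split.
    + apply H1. now exists n.
    + apply H2. intros y [k ->]. apply Hc.
Qed.

Lemma half_pow_small (L d : R) : 0 < d -> exists n, L / 2 ^ n < d.
Proof.
  intros Hd.
  destruct (Rle_lt_dec L 0) as [HL|HL].
  - exists 0%nat. simpl. lra.
  - destruct (pow_lt_1_zero (/ 2)) with (y := d / L) as [n Hn].
    + rewrite Rabs_right; lra.
    + now apply Rdiv_lt_0_compat.
    + exists n. specialize (Hn n (le_n n)).
      rewrite Rabs_right in Hn by (apply Rle_ge, pow_le; lra).
      rewrite pow_inv in Hn. apply Rmult_lt_compat_l with (r := L) in Hn; [|lra].
      replace (L * (d / L)) with d in Hn by (field; lra). exact Hn.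
Qed.

(** Goursat's subdivision, separated from integration: [W] is any additive function of rectangles.
    If it is nonzero on the whole, one of four quarters always keeps at least a quarter of its
    modulus, and at the common point of the nested rectangles this contradicts the local bound. *)
Lemma bisection_zero (W : R -> R -> R -> R -> C) (s0 s1 t0 t1 : R) :
  s0 <= s1 -> t0 <= t1 ->
  (forall a m b c d, s0 <= a -> a <= m -> m <= b -> b <= s1 -> t0 <= c -> c <= d -> d <= t1 ->
     W a b c d = (W a m c d + W m b c d)%C) ->
  (forall a b c m d, s0 <= a -> a <= b -> b <= s1 -> t0 <= c -> c <= m -> m <= d -> d <= t1 ->
     W a b c d = (W a b c m + W a b m d)%C) ->
  (forall s t, s0 <= s <= s1 -> t0 <= t <= t1 -> forall eps, 0 < eps -> exists del, 0 < del /\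
     forall a b c d, s0 <= a -> a <= s -> s <= b -> b <= s1 -> t0 <= c -> c <= t -> t <= d -> d <= t1 ->
       b - a < del -> d - c < del -> Cmod (W a b c d) <= eps * ((b - a) + (d - c)) ^ 2) ->
  W s0 s1 t0 t1 = RtoC 0.
Proof.
  intros Hs Ht Adds Addt Loc.
  set (L0 := (s1 - s0) + (t1 - t0)).
  destruct (Rle_lt_dec L0 0) as [HL|HL].
  { unfold L0 in HL. destruct (Loc s0 t0 ltac:(lra) ltac:(lra) 1 Rlt_0_1) as [d [Hd H]].
    apply Cmod_le_0. eapply Rle_trans; [apply H; lra|].
    replace (s1 - s0 + (t1 - t0)) with 0 by lra. lra. }
  destruct (Req_dec (Cmod (W s0 s1 t0 t1)) 0) as [E|E]; [now apply Cmod_eq_0|exfalso].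
  assert (HW : 0 < Cmod (W s0 s1 t0 t1)) by (assert (X := Cmod_ge_0 (W s0 s1 t0 t1)); lra).
  set (k := Cmod (W s0 s1 t0 t1) / L0 ^ 2).
  assert (HL2 : 0 < L0 ^ 2) by now apply pow_lt.
  assert (Hk : 0 < k) by now apply Rdiv_lt_0_compat.
  (* The invariant: the ratio of [Cmod W] to the squared half perimeter stays at least its initial
     value [k]. *)
  set (inv := fun q : R * R * R * R => let '(a, b, c, d) := q in
    s0 <= a /\ a <= b /\ b <= s1 /\ t0 <= c /\ c <= d /\ d <= t1 /\
    k * ((b - a) + (d - c)) ^ 2 <= Cmod (W a b c d)).
  set (sub := fun q' q : R * R * R * R => let '(a, b, c, d) := q in let '(a', b', c', d') := q' in
    a <= a' /\ b' <= b /\ c <= c' /\ d' <= d /\ b' - a' = (b - a) / 2 /\ d' - c' = (d - c) / 2).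
  assert (step : forall q, inv q -> exists q', inv q' /\ sub q' q).
  { intros [[[a b] c] d] (Ha & Hab & Hb & Hc & Hcd & Hd & HB).
    set (m := (a + b) / 2). set (n := (c + d) / 2).
    assert (Hm1 : m - a = (b - a) / 2) by (unfold m; lra).
    assert (Hm2 : b - m = (b - a) / 2) by (unfold m; lra).
    assert (Hn1 : n - c = (d - c) / 2) by (unfold n; lra).
    assert (Hn2 : d - n = (d - c) / 2) by (unfold n; lra).
    assert (E1 : W a b c d = ((W a m c n + W a m n d) + (W m b c n + W m b n d))%C).
    { rewrite (Adds a m b c d), (Addt a m c n d), (Addt m b c n d) by lra. reflexivity. }
    set (l := (b - a) + (d - c)) in *.
    assert (T : Cmod (W a b c d) <= Cmod (W a m c n) + Cmod (W a m n d) + (Cmod (W m b c n) + Cmod (W m b n d))).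
    { rewrite E1. eapply Rle_trans; [apply Cmod_triangle|].
      apply Rplus_le_compat; apply Cmod_triangle. }
    assert (El : k * l ^ 2 = 4 * (k * (l / 2) ^ 2)) by field.
    destruct (Rle_lt_dec (k * (l / 2) ^ 2) (Cmod (W a m c n))) as [C1|C1].
    { exists (a, m, c, n). unfold inv, sub.
      replace (m - a + (n - c)) with (l / 2) by (unfold l; lra). repeat split; lra. }
    destruct (Rle_lt_dec (k * (l / 2) ^ 2) (Cmod (W a m n d))) as [C2|C2].
    { exists (a, m, n, d). unfold inv, sub.
      replace (m - a + (d - n)) with (l / 2) by (unfold l; lra). repeat split; lra. }
    destruct (Rle_lt_dec (k * (l / 2) ^ 2) (Cmod (W m b c n))) as [C3|C3].
    { exists (m, b, c, n). unfold inv, sub.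
      replace (b - m + (n - c)) with (l / 2) by (unfold l; lra). repeat split; lra. }
    destruct (Rle_lt_dec (k * (l / 2) ^ 2) (Cmod (W m b n d))) as [C4|C4].
    { exists (m, b, n, d). unfold inv, sub.
      replace (b - m + (d - n)) with (l / 2) by (unfold l; lra). repeat split; lra. }
    lra. }
  set (stepT := fun q : {q | inv q} =>
    let (q', H) := constructive_indefinite_description _ (step (proj1_sig q) (proj2_sig q)) in
    exist inv q' (proj1 H)).
  assert (HstepT : forall q, sub (proj1_sig (stepT q)) (proj1_sig q)).
  { intros q. unfold stepT.
    destruct (constructive_indefinite_description _ _) as [q' [H1 H2]]. exact H2. }
  assert (H0 : inv (s0, s1, t0, t1)).
  { unfold inv. repeat split; try lra. fold L0. unfold k. right. field. lra. }
  set (Q := fun n => nat_rect (fun _ => {q | inv q}) (exist inv _ H0) (fun _ => stepT) n).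
  set (qa := fun n => fst (fst (fst (proj1_sig (Q n))))).
  set (qb := fun n => snd (fst (fst (proj1_sig (Q n))))).
  set (qc := fun n => snd (fst (proj1_sig (Q n)))).
  set (qd := fun n => snd (proj1_sig (Q n))).
  assert (Hinv : forall n, s0 <= qa n /\ qa n <= qb n /\ qb n <= s1 /\ t0 <= qc n /\ qc n <= qd n /\ qd n <= t1 /\
    k * ((qb n - qa n) + (qd n - qc n)) ^ 2 <= Cmod (W (qa n) (qb n) (qc n) (qd n))).
  { intros n. unfold qa, qb, qc, qd. destruct (Q n) as [[[[a b] c] d] H]. exact H. }
  assert (Hsub : forall n, qa n <= qa (S n) /\ qb (S n) <= qb n /\ qc n <= qc (S n) /\ qd (S n) <= qd n /\
    qb (S n) - qa (S n) = (qb n - qa n) / 2 /\ qd (S n) - qc (S n) = (qd n - qc n) / 2).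
  { intros n. assert (H := HstepT (Q n)). unfold qa, qb, qc, qd.
    change (Q (S n)) with (stepT (Q n)).
    destruct (proj1_sig (Q n)) as [[[a b] c] d].
    destruct (proj1_sig (stepT (Q n))) as [[[a' b'] c'] d']. exact H. }
  destruct (nested_intervals qa qb) as [s Hs']; try (intros n; destruct (Hsub n), (Hinv n); tauto).
  destruct (nested_intervals qc qd) as [t Ht']; try (intros n; destruct (Hsub n), (Hinv n); tauto).
  assert (Hlen : forall n, qb n - qa n = (s1 - s0) / 2 ^ n /\ qd n - qc n = (t1 - t0) / 2 ^ n).
  { induction n.
    - unfold qa, qb, qc, qd; simpl. split; field.
    - destruct (Hsub n) as (_ & _ & _ & _ & E1 & E2). destruct IHn as [E3 E4].
      rewrite E1, E2, E3, E4. simpl. split; field; apply pow_nonzero; lra. }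
  destruct (Loc s t) with (eps := k / 2) as [del [Hdel HLoc]]; try lra.
  { specialize (Hs' 0%nat). exact Hs'. }
  { specialize (Ht' 0%nat). exact Ht'. }
  destruct (half_pow_small L0 del Hdel) as [n Hn].
  destruct (Hinv n) as (I1 & I2 & I3 & I4 & I5 & I6 & I7).
  destruct (Hlen n) as [E1 E2].
  assert (Hp : 0 < 2 ^ n) by (apply pow_lt; lra).
  assert (Hsum : (qb n - qa n) + (qd n - qc n) = L0 / 2 ^ n).
  { rewrite E1, E2. unfold L0. field. lra. }
  specialize (HLoc (qa n) (qb n) (qc n) (qd n)).
  specialize (Hs' n). specialize (Ht' n).
  specialize (HLoc ltac:(lra) ltac:(lra) ltac:(lra) ltac:(lra) ltac:(lra) ltac:(lra) ltac:(lra) ltac:(lra) ltac:(lra) ltac:(lra)).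
  rewrite Hsum in *.
  assert (0 < (L0 / 2 ^ n) ^ 2) by (apply pow_lt; now apply Rdiv_lt_0_compat).
  nra.
Qed.

(** The integral of [f dz] along the image under [G] of the boundary of a parameter rectangle; [X]
    and [Y] stand for the partial derivatives of [G]. *)
Definition rect_int (f : C -> C) (G X Y : R -> R -> C) (a b c d : R) : C :=
  (CInt (fun s => f (G s c) * X s c) a b + CInt (fun t => f (G b t) * Y b t) c d
   - CInt (fun s => f (G s d) * X s d) a b - CInt (fun t => f (G a t) * Y a t) c d)%C.

(* Over a small rectangle the linear part of [f] has the primitive
   [f z0 * z + l / 2 * (z - z0) ^ 2]; only the differentiability error remains. *)
Lemma side_error (f : C -> C) (p v : R -> C) (z0 l : C) (a b eps M L : R) :
  a <= b -> 0 <= eps -> 0 <= L ->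
  (forall t, a <= t <= b -> pder p t (v t)) -> pcont_on v a b ->
  (forall t, a <= t <= b -> Cmod (v t) <= L) ->
  (forall t, a <= t <= b -> ccont f (p t)) ->
  (forall t, a <= t <= b -> Cmod (p t - z0) <= M) ->
  (forall t, a <= t <= b -> Cmod (f (p t) - f z0 - l * (p t - z0)) <= eps * Cmod (p t - z0)) ->
  let P := fun z => (f z0 * z + l / 2 * ((z - z0) * (z - z0)))%C in
  Cmod (CInt (fun t => f (p t) * v t) a b - (P (p b) - P (p a)))%C <= 2 * (eps * M * L) * (b - a).
Proof.
  intros Hab Heps HL Hp Hv HvL Hf HM Hd P.
  assert (HP : forall z, is_cd P z (f z0 + l * (z - z0))%C).
  { intros z. eapply is_cd_val.
    - apply is_cd_plus; [apply is_cd_scal, is_cd_id|].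
      apply is_cd_scal. apply is_cd_mult; apply is_cd_minus; try apply is_cd_id; apply is_cd_const.
    - assert (E : l = (l / 2 + l / 2)%C).
      { unfold Cdiv. rewrite <- Cmult_plus_distr_l.
        replace (/ 2 + / 2)%C with (RtoC 1); [ring|].
        rewrite <- RtoC_inv by lra. rewrite <- RtoC_plus. f_equal. field. }
      rewrite E at 2. ring. }
  assert (Hpc : forall t, a <= t <= b -> pcont p t).
  { intros t Ht. eapply pder_pcont. now apply Hp. }
  assert (Hlin : pcont_on (fun t => (f z0 + l * (p t - z0)) * v t)%C a b).
  { intros t Ht. apply pcont_mult; [|now apply Hv].
    apply pcont_plus; [apply pcont_const|]. apply pcont_mult; [apply pcont_const|].
    apply pcont_minus; [now apply Hpc|apply pcont_const]. }
  assert (Hfp : pcont_on (fun t => f (p t) * v t)%C a b).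
  { intros t Ht. apply pcont_mult; [|now apply Hv]. apply pcont_comp; auto. }
  rewrite <- (CInt_FTC (fun t => P (p t)) (fun t => (f z0 + l * (p t - z0)) * v t)%C a b Hab).
  - rewrite <- CInt_minus by assumption.
    apply CInt_bound; [exact Hab| |].
    + intros t Ht. apply pcont_minus; auto.
    + intros t Ht.
      replace (f (p t) * v t - (f z0 + l * (p t - z0)) * v t)%C with
        ((f (p t) - f z0 - l * (p t - z0)) * v t)%C by ring.
      rewrite Cmod_mult. apply Rmult_le_compat; try apply Cmod_ge_0; auto.
      eapply Rle_trans; [now apply Hd|]. apply Rmult_le_compat_l; auto.
  - intros t Ht. apply pder_comp; auto.
  - exact Hlin.
Qed.

Lemma path_lipschitz (p v : R -> C) (a b L : R) :
  a <= b -> (forall t, a <= t <= b -> pder p t (v t)) -> pcont_on v a b ->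
  (forall t, a <= t <= b -> Cmod (v t) <= L) ->
  forall t t', a <= t <= b -> a <= t' <= b -> Cmod (p t - p t') <= 2 * L * (b - a).
Proof.
  intros Hab Hp Hv HL.
  assert (HL0 : 0 <= L) by (apply Rle_trans with (Cmod (v a)); [apply Cmod_ge_0|apply HL; lra]).
  assert (W : forall t t', a <= t' <= t -> t <= b -> Cmod (p t - p t') <= 2 * L * (b - a)).
  { intros t t' H1 H2. rewrite <- (CInt_FTC p v t' t).
    - eapply Rle_trans; [apply (CInt_bound _ _ _ L)|]; try lra.
      + intros u Hu. apply Hv. lra.
      + intros u Hu. apply HL. lra.
      + apply Rmult_le_compat_l; lra.
    - lra.
    - intros u Hu. apply Hp. lra.
    - intros u Hu. apply Hv. lra. }
  intros t t' H1 H2. destruct (Rle_lt_dec t' t).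
  - apply W; lra.
  - rewrite Cmod_minus_sym. apply W; lra.
Qed.

(** Formulated for a map of a parameter rectangle rather than for a rectangle in the plane, so that
    a single application covers the homotopy between two circles. Sides of a small rectangle have
    image length proportional to the side, hence the boundary error is of second order. *)
Lemma goursat (f : C -> C) (G X Y : R -> R -> C) (s0 s1 t0 t1 L : R) :
  s0 <= s1 -> t0 <= t1 ->
  (forall s t, pder (fun s => G s t) s (X s t)) ->
  (forall s t, pder (fun t => G s t) t (Y s t)) ->
  (forall s t, pcont (fun s => X s t) s) ->
  (forall s t, pcont (fun t => Y s t) t) ->
  (forall s t, s0 <= s <= s1 -> t0 <= t <= t1 -> Cmod (X s t) <= L) ->
  (forall s t, s0 <= s <= s1 -> t0 <= t <= t1 -> Cmod (Y s t) <= L) ->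
  (forall s t, s0 <= s <= s1 -> t0 <= t <= t1 -> exists l, is_cd f (G s t) l) ->
  rect_int f G X Y s0 s1 t0 t1 = RtoC 0.
Proof.
  intros Hs Ht GX GY CX CY BX BY Hf.
  assert (HL : 0 <= L).
  { apply Rle_trans with (Cmod (X s0 t0)); [apply Cmod_ge_0|]. apply BX; lra. }
  assert (Hfc : forall s t, s0 <= s <= s1 -> t0 <= t <= t1 -> ccont f (G s t)).
  { intros s t H1 H2. destruct (Hf s t H1 H2) as [l Hl]. eapply is_cd_ccont, Hl. }
  assert (Cs : forall a b t, s0 <= a -> b <= s1 -> t0 <= t <= t1 -> pcont_on (fun s => f (G s t) * X s t)%C a b).
  { intros a b t H1 H2 H3 s H4. apply pcont_mult; [|apply CX].
    apply (pcont_comp f (fun s => G s t)); [apply Hfc; lra|]. eapply pder_pcont, GX. }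
  assert (Ct : forall c d s, t0 <= c -> d <= t1 -> s0 <= s <= s1 -> pcont_on (fun t => f (G s t) * Y s t)%C c d).
  { intros a b s H1 H2 H3 t H4. apply pcont_mult; [|apply CY].
    apply (pcont_comp f (fun t => G s t)); [apply Hfc; lra|]. eapply pder_pcont, GY. }
  apply bisection_zero; try assumption.
  - intros a m b c d H1 H2 H3 H4 H5 H6 H7. unfold rect_int.
    rewrite (CInt_Chasles (fun s => f (G s c) * X s c)%C a m b) by (try apply Cs; lra).
    rewrite (CInt_Chasles (fun s => f (G s d) * X s d)%C a m b) by (try apply Cs; lra).
    ring.
  - intros a b c m d H1 H2 H3 H4 H5 H6 H7. unfold rect_int.
    rewrite (CInt_Chasles (fun t => f (G b t) * Y b t)%C c m d) by (try apply Ct; lra).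
    rewrite (CInt_Chasles (fun t => f (G a t) * Y a t)%C c m d) by (try apply Ct; lra).
    ring.
  - intros s t Hs' Ht' eps Heps.
    destruct (Hf s t Hs' Ht') as [l Hl].
    (* With [M = 2 L D], where [D] is half the perimeter, the side errors add up to [8 e L^2 D^2],
       below [eps D^2]. *)
    set (e := eps / (16 * (L + 1) ^ 2)).
    assert (HL1 : 0 < (L + 1) ^ 2) by (apply pow_lt; lra).
    assert (He : 0 < e) by (apply Rdiv_lt_0_compat; lra).
    destruct (Hl e He) as [r [Hr Hloc]].
    exists (r / (8 * (L + 1))). split; [apply Rdiv_lt_0_compat; lra|].
    intros a b c d H1 H2 H3 H4 H5 H6 H7 H8 H9 H10.
    set (z0 := G s t) in *. set (M := 2 * L * ((b - a) + (d - c))).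
    assert (HM0 : 0 <= M) by (unfold M; apply Rmult_le_pos; lra).
    assert (HM : M < r).
    { apply Rmult_lt_compat_r with (r := 8 * (L + 1)) in H9; [|lra].
      apply Rmult_lt_compat_r with (r := 8 * (L + 1)) in H10; [|lra].
      replace (r / (8 * (L + 1)) * (8 * (L + 1))) with r in * by (field; lra).
      unfold M. nra. }
    assert (Hdist : forall s' t', a <= s' <= b -> c <= t' <= d -> Cmod (G s' t' - z0) <= M).
    { intros s' t' K1 K2. unfold z0.
      eapply Rle_trans; [apply (Cmod_dist_triangle _ (G s t'))|].
      assert (A1 : Cmod (G s' t' - G s t') <= 2 * L * (b - a)).
      { apply (path_lipschitz (fun s => G s t') (fun s => X s t')); try lra; intros u Hu; auto.
        apply BX; lra. }
      assert (A2 : Cmod (G s t' - G s t) <= 2 * L * (d - c)).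
      { apply (path_lipschitz (fun t => G s t) (fun t => Y s t)); try lra; intros u Hu; auto.
        apply BY; lra. }
      unfold M. lra. }
    assert (Herr : forall s' t', a <= s' <= b -> c <= t' <= d ->
      Cmod (f (G s' t') - f z0 - l * (G s' t' - z0)) <= e * Cmod (G s' t' - z0)).
    { intros s' t' K1 K2. apply Hloc. eapply Rle_lt_trans; [now apply Hdist|exact HM]. }
    set (P := fun z => (f z0 * z + l / 2 * ((z - z0) * (z - z0)))%C).
    assert (Es : forall t', c <= t' <= d ->
      Cmod (CInt (fun s => f (G s t') * X s t') a b - (P (G b t') - P (G a t')))%C <= 2 * (e * M * L) * (b - a)).
    { intros t' K. apply (side_error f (fun s => G s t') (fun s => X s t')); try lra; intros u Hu; auto.
      - apply BX; lra.
      - apply Hfc; lra. }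
    assert (Et : forall s', a <= s' <= b ->
      Cmod (CInt (fun t => f (G s' t) * Y s' t) c d - (P (G s' d) - P (G s' c)))%C <= 2 * (e * M * L) * (d - c)).
    { intros s' K. apply (side_error f (fun t => G s' t) (fun t => Y s' t)); try lra; intros u Hu; auto.
      - apply BY; lra.
      - apply Hfc; lra. }
    assert (F1 := Es c ltac:(lra)). assert (F2 := Es d ltac:(lra)).
    assert (F3 := Et a ltac:(lra)). assert (F4 := Et b ltac:(lra)).
    unfold rect_int.
    set (I1 := CInt (fun s => f (G s c) * X s c)%C a b) in *.
    set (I2 := CInt (fun s => f (G s d) * X s d)%C a b) in *.
    set (I3 := CInt (fun t => f (G a t) * Y a t)%C c d) in *.
    set (I4 := CInt (fun t => f (G b t) * Y b t)%C c d) in *.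
    (* The increments of the primitive [P] cancel around the boundary, so only the four side errors
       remain. *)
    replace (I1 + I4 - I2 - I3)%C with
      (((I1 - (P (G b c) - P (G a c))) + (I4 - (P (G b d) - P (G b c))))
       - ((I2 - (P (G b d) - P (G a d))) + (I3 - (P (G a d) - P (G a c)))))%C by ring.
    eapply Rle_trans; [apply Cmod_minus_le|].
    eapply Rle_trans; [apply Rplus_le_compat; apply Cmod_triangle|].
    set (D := b - a + (d - c)) in *.
    assert (HD : 0 <= D) by (unfold D; lra).
    apply Rle_trans with (4 * (e * M * L) * D).
    { unfold D. lra. }
    unfold M. fold D.
    replace (4 * (e * (2 * L * D) * L) * D) with (8 * e * L ^ 2 * D ^ 2) by ring.
    apply Rmult_le_compat_r; [apply pow_le; lra|].
    apply Rle_trans with (16 * e * (L + 1) ^ 2).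
    + assert (L ^ 2 <= (L + 1) ^ 2) by (simpl; nra). assert (0 <= L ^ 2) by (apply pow_le; lra). nra.
    + right. unfold e. field. lra.
Qed.

(** * Cauchy's formula *)

Lemma RtoC_neq (x y : R) : x <> y -> RtoC x <> RtoC y.
Proof. intros H E. apply H. now injection E. Qed.

Definition cis (t : R) : C := (cos t, sin t).

Lemma Cmod_cis t : Cmod (cis t) = 1.
Proof.
  unfold Cmod, cis. simpl. replace (cos t * (cos t * 1) + sin t * (sin t * 1)) with 1.
  - apply sqrt_1.
  - assert (H := sin2_cos2 t). unfold Rsqr in H. lra.
Qed.

Lemma cis_neq_0 t : cis t <> RtoC 0.
Proof. apply Cmod_gt_0. rewrite Cmod_cis. lra. Qed.

Lemma pder_cis t : pder cis t (Ci * cis t)%C.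
Proof.
  unfold pder, cis, Ci. simpl. split.
  - auto_derive; [trivial|ring].
  - auto_derive; [trivial|ring].
Qed.

Lemma pcont_cis t : pcont cis t.
Proof. eapply pder_pcont, pder_cis. Qed.

Lemma cis_2PI : cis (2 * PI) = cis 0.
Proof. unfold cis. now rewrite cos_2PI, sin_2PI, cos_0, sin_0. Qed.

Lemma pder_RtoC t : pder RtoC t (RtoC 1).
Proof. unfold pder. simpl. split; auto_derive; trivial. Qed.

Lemma is_cd_affine (A B z : C) : is_cd (fun w => A + B * w)%C z B.
Proof.
  eapply is_cd_val; [apply (is_cd_plus _ _ _ _ _ (is_cd_const A z) (is_cd_scal B _ _ _ (is_cd_id z)))|].
  ring.
Qed.

Lemma pder_affine (A B l : C) p t : pder p t l -> pder (fun t => A + B * p t)%C t (B * l)%C.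
Proof. intros H. apply (pder_comp (fun w => A + B * w)%C); [apply is_cd_affine|exact H]. Qed.

Lemma pder_ext (p q : R -> C) t l l' :
  (forall s, p s = q s) -> l = l' -> pder p t l -> pder q t l'.
Proof.
  intros E <- [H1 H2]. split.
  - eapply is_derive_ext; [|exact H1]. intros s. cbv beta. now rewrite E.
  - eapply is_derive_ext; [|exact H2]. intros s. cbv beta. now rewrite E.
Qed.

Definition circ (a : C) (r t : R) : C := (a + RtoC r * cis t)%C.

Lemma pder_circ a r t : pder (circ a r) t (RtoC r * (Ci * cis t))%C.
Proof. apply pder_affine, pder_cis. Qed.

Lemma pcont_circ a r t : pcont (circ a r) t.
Proof. eapply pder_pcont, pder_circ. Qed.

Lemma Cmod_circ a r t : 0 <= r -> Cmod (circ a r t - a) = r.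
Proof.
  intros Hr. unfold circ. replace (a + r * cis t - a)%C with (r * cis t)%C by ring.
  rewrite Cmod_mult, Cmod_cis, Cmod_R, Rabs_right; lra.
Qed.

Lemma Cmod_circ_ge a r t z : 0 <= r -> r - Cmod (z - a) <= Cmod (circ a r t - z).
Proof.
  intros Hr. assert (H := Cmod_dist_triangle (circ a r t) z a).
  rewrite Cmod_circ in H by exact Hr. lra.
Qed.

Lemma circ_neq a r t z : Cmod (z - a) < r -> (circ a r t - z)%C <> RtoC 0.
Proof.
  intros H. apply Cmod_neq_0. assert (H0 := Cmod_ge_0 (z - a)%C).
  assert (H1 := Cmod_circ_ge a r t z ltac:(lra)). lra.
Qed.

Definition holB (a : C) (r : R) (f : C -> C) : Prop :=
  forall w, Cmod (w - a) < r -> exists l, is_cd f w l.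

(* Goursat along the homotopy G(s, t) = (1 - s) z + s a + ((1 - s) sg + s r) cis t. *)
Lemma cauchy_shrink (f : C -> C) (a z : C) (r sg : R) :
  0 < sg -> Cmod (z - a) + sg < r ->
  (forall w, Cmod (w - a) <= r -> exists l, is_cd f w l) ->
  CInt (fun t => f (circ a r t) * (r * cis t) / (circ a r t - z))%C 0 (2 * PI)
  = CInt (fun t => f (circ z sg t)) 0 (2 * PI).
Proof.
  intros Hsg Hr Hf.
  assert (Hpi := PI_RGT_0).
  assert (Hza := Cmod_ge_0 (z - a)%C).
  set (g := fun w => (f w / (w - z))%C).
  set (G := fun s t : R => (z + s * (a - z) + RtoC (sg + s * (r - sg)) * cis t)%C).
  set (X := fun s t : R => ((a - z) + RtoC (r - sg) * cis t)%C).
  set (Y := fun s t : R => (RtoC (sg + s * (r - sg)) * (Ci * cis t))%C).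
  assert (HG : forall s t, 0 <= s <= 1 -> Cmod (G s t - a) <= r /\ 0 < Cmod (G s t - z)).
  { intros s t Hs. unfold G.
    assert (Hc : Cmod (RtoC (sg + s * (r - sg)) * cis t) = sg + s * (r - sg)).
    { rewrite Cmod_mult, Cmod_cis, Cmod_R, Rabs_right; nra. }
    split.
    - replace (z + s * (a - z) + RtoC (sg + s * (r - sg)) * cis t - a)%C with
       (RtoC (1 - s) * (z - a) + RtoC (sg + s * (r - sg)) * cis t)%C by (rewrite RtoC_minus; ring).
      eapply Rle_trans; [apply Cmod_triangle|]. rewrite Hc, Cmod_mult, Cmod_R, Rabs_right by lra.
      nra.
    - replace (z + s * (a - z) + RtoC (sg + s * (r - sg)) * cis t - z)%C with
       (RtoC (sg + s * (r - sg)) * cis t - RtoC s * (z - a))%C by ring.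
      eapply Rlt_le_trans; [|apply Cmod_minus_ge]. rewrite Hc, Cmod_mult, Cmod_R, Rabs_right by lra.
      nra. }
  assert (HW : rect_int g G X Y 0 1 0 (2 * PI) = RtoC 0).
  { apply goursat with (L := Cmod (a - z) + r + sg); try lra.
    - intros s t. apply (pder_ext (fun s => (z + sg * cis t) + X s t * RtoC s)%C _ _ (X s t * 1)%C).
      + intros u. unfold G, X. rewrite RtoC_plus, RtoC_mult. ring.
      + ring.
      + apply (pder_affine (z + sg * cis t)%C (X s t) (RtoC 1) RtoC s). apply pder_RtoC.
    - intros s t. apply pder_affine, pder_cis.
    - intros s t. apply pcont_const.
    - intros s t. apply pcont_mult; [apply pcont_const|]. apply pcont_mult; [apply pcont_const|apply pcont_cis].
    - intros s t _ _. unfold X. eapply Rle_trans; [apply Cmod_triangle|].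
      rewrite Cmod_mult, Cmod_cis, Cmod_R, Rabs_right by lra. lra.
    - intros s t Hs _. unfold Y. rewrite !Cmod_mult, Cmod_cis, Cmod_Ci, Cmod_R, Rabs_right by nra.
      assert (Haz := Cmod_ge_0 (a - z)%C). nra.
    - intros s t Hs _. destruct (HG s t Hs) as [H1 H2].
      destruct (Hf _ H1) as [l Hl]. eexists. unfold g.
      apply is_cd_div; [exact Hl| |].
      + apply is_cd_minus; [apply is_cd_id|apply is_cd_const].
      + now apply Cmod_neq_0. }
  unfold rect_int in HW.
  (* The two sides [t = 0] and [t = 2 PI] have the same image by periodicity and cancel, leaving the
     outer and the inner circle. *)
  assert (E : CInt (fun s => g (G s (2 * PI)%R) * X s (2 * PI)%R)%C 0 1 = CInt (fun s => g (G s 0) * X s 0)%C 0 1).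
  { apply CInt_ext; [lra|]. intros s _. unfold G, X. now rewrite cis_2PI. }
  rewrite E in HW.
  set (J := CInt (fun t => f (circ a r t) * (r * cis t) / (circ a r t - z))%C 0 (2 * PI)).
  set (J' := CInt (fun t => f (circ z sg t)) 0 (2 * PI)).
  assert (P1 : pcont_on (fun t => f (circ a r t) * (r * cis t) / (circ a r t - z))%C 0 (2 * PI)).
  { intros t _. apply pcont_div.
    - apply pcont_mult.
      + apply pcont_comp; [|apply pcont_circ].
        destruct (Hf (circ a r t)) as [l Hl]; [rewrite Cmod_circ; lra|]. eapply is_cd_ccont, Hl.
      + apply pcont_mult; [apply pcont_const|apply pcont_cis].
    - apply pcont_minus; [apply pcont_circ|apply pcont_const].
    - apply circ_neq. lra. }
  assert (P2 : pcont_on (fun t => f (circ z sg t)) 0 (2 * PI)).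
  { intros t _. apply pcont_comp; [|apply pcont_circ].
    destruct (Hf (circ z sg t)) as [l Hl].
    - assert (H := Cmod_dist_triangle (circ z sg t) z a). rewrite Cmod_circ in H by lra. lra.
    - eapply is_cd_ccont, Hl. }
  assert (E1 : CInt (fun t => g (G 1 t) * Y 1 t)%C 0 (2 * PI) = (Ci * J)%C).
  { unfold J. rewrite <- CInt_scal by (try exact P1; lra).
    apply CInt_ext; [lra|]. intros t _. unfold g, Y.
    replace (sg + 1 * (r - sg)) with r by ring.
    assert (EG : G 1 t = circ a r t).
    { unfold G, circ. replace (sg + 1 * (r - sg)) with r by ring. ring. }
    rewrite EG. unfold Cdiv. ring. }
  assert (E0 : CInt (fun t => g (G 0 t) * Y 0 t)%C 0 (2 * PI) = (Ci * J')%C).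
  { unfold J'. rewrite <- CInt_scal by (try exact P2; lra).
    apply CInt_ext; [lra|]. intros t _. unfold g, Y.
    replace (sg + 0 * (r - sg)) with sg by ring.
    assert (EG : G 0 t = circ z sg t).
    { unfold G, circ. replace (sg + 0 * (r - sg)) with sg by ring. ring. }
    rewrite EG. unfold circ. field.
    replace (z + sg * cis t - z)%C with (sg * cis t)%C by ring.
    apply Cmult_neq_0; [|apply cis_neq_0]. apply RtoC_neq. lra. }
  rewrite E1, E0 in HW.
  assert (E2 : (Ci * (J - J'))%C = RtoC 0).
  { rewrite <- HW. ring. }
  apply (f_equal (fun x => Cmod x)) in E2. rewrite Cmod_mult, Cmod_Ci, Cmod_0, Rmult_1_l in E2.
  apply Cmod_eq_0 in E2. replace J with ((J - J') + J')%C by ring. rewrite E2. ring.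
Qed.

(** [cauchy_shrink] replaces the integral by one over an arbitrarily small circle around [z], where
    [f] is within [eps] of [f z]. *)
Theorem cauchy_formula (f : C -> C) (a z : C) (r : R) :
  Cmod (z - a) < r -> (forall w, Cmod (w - a) <= r -> exists l, is_cd f w l) ->
  (RtoC (2 * PI) * f z)%C
   = CInt (fun t => f (circ a r t) * (r * cis t) / (circ a r t - z))%C 0 (2 * PI).
Proof.
  intros Hz Hf. assert (Hpi := PI_RGT_0).
  set (J := CInt _ _ _).
  destruct (Hf z ltac:(lra)) as [l Hl]. apply is_cd_ccont in Hl.
  assert (H : forall eps, 0 < eps -> Cmod (J - RtoC (2 * PI) * f z) <= 4 * PI * eps).
  { intros eps Heps. destruct (Hl eps Heps) as [d [Hd H]].
    set (sg := Rmin (d / 2) ((r - Cmod (z - a)) / 2)).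
    assert (Hsg : 0 < sg) by (apply Rmin_glb_lt; lra).
    assert (A := Rmin_l (d / 2) ((r - Cmod (z - a)) / 2)).
    assert (B := Rmin_r (d / 2) ((r - Cmod (z - a)) / 2)). fold sg in A, B.
    unfold J. rewrite (cauchy_shrink f a z r sg Hsg ltac:(lra) Hf).
    replace (RtoC (2 * PI) * f z)%C with (CInt (fun _ => f z) 0 (2 * PI)).
    2: { rewrite CInt_const. do 2 f_equal. ring. }
    assert (P2 : pcont_on (fun t => f (circ z sg t)) 0 (2 * PI)).
    { intros t _. apply pcont_comp; [|apply pcont_circ].
      destruct (Hf (circ z sg t)) as [k Hk].
      - assert (K := Cmod_dist_triangle (circ z sg t) z a). rewrite Cmod_circ in K by lra. lra.
      - eapply is_cd_ccont, Hk. }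
    rewrite <- CInt_minus; [|lra|exact P2|intros t _; apply pcont_const].
    eapply Rle_trans; [apply (CInt_bound _ _ _ eps)|]; try lra.
    - intros t Ht. apply pcont_minus; [now apply P2|apply pcont_const].
    - intros t _. apply Rlt_le, H. rewrite Cmod_circ by lra. lra. }
  assert (E : Cmod (J - RtoC (2 * PI) * f z) <= 0).
  { apply Rnot_lt_le. intros K.
    specialize (H (Cmod (J - RtoC (2 * PI) * f z) / (8 * PI))).
    assert (0 < Cmod (J - RtoC (2 * PI) * f z) / (8 * PI)) by (apply Rdiv_lt_0_compat; lra).
    specialize (H H0).
    replace (4 * PI * (Cmod (J - RtoC (2 * PI) * f z) / (8 * PI))) with (Cmod (J - RtoC (2 * PI) * f z) / 2) in H by (field; lra).
    lra. }
  apply Cmod_le_0 in E. replace J with ((J - RtoC (2 * PI) * f z) + RtoC (2 * PI) * f z)%C by ring.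
  rewrite E. ring.
Qed.

(** A lossy maximum principle: at points away from the circle it bounds [f] by a constant multiple
    of its bound on the circle, which is all that its uses require. *)
Lemma cauchy_estimate (f : C -> C) (a z : C) (r M : R) :
  Cmod (z - a) < r -> (forall w, Cmod (w - a) <= r -> exists l, is_cd f w l) ->
  (forall t, 0 <= t <= 2 * PI -> Cmod (f (circ a r t)) <= M) ->
  Cmod (f z) <= 2 * M * r / (r - Cmod (z - a)).
Proof.
  intros Hz Hf HM. assert (Hpi := PI_RGT_0). assert (H0 := Cmod_ge_0 (z - a)%C).
  assert (HM0 : 0 <= M).
  { eapply Rle_trans; [apply Cmod_ge_0|apply (HM 0); lra]. }
  assert (E := cauchy_formula f a z r Hz Hf).
  apply (f_equal Cmod) in E. rewrite Cmod_mult, Cmod_R, Rabs_right in E by lra.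
  assert (K : 2 * PI * Cmod (f z) <= 2 * (M * r / (r - Cmod (z - a))) * (2 * PI - 0)).
  { rewrite E. apply CInt_bound; [lra| |].
    - intros t _. apply pcont_div.
      + apply pcont_mult.
        * apply pcont_comp; [|apply pcont_circ].
          destruct (Hf (circ a r t)) as [l Hl]; [rewrite Cmod_circ; lra|]. eapply is_cd_ccont, Hl.
        * apply pcont_mult; [apply pcont_const|apply pcont_cis].
      + apply pcont_minus; [apply pcont_circ|apply pcont_const].
      + now apply circ_neq.
    - intros t Ht. rewrite Cmod_div by now apply circ_neq.
      rewrite !Cmod_mult, Cmod_cis, Cmod_R, Rabs_right, Rmult_1_r by lra.
      apply Rmult_le_compat.
      + apply Rmult_le_pos; [apply Cmod_ge_0|lra].
      + apply Rlt_le, Rinv_0_lt_compat. apply Cmod_gt_0. now apply circ_neq.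
      + apply Rmult_le_compat_r; [lra|]. now apply HM.
      + apply Rinv_le_contravar; [lra|]. apply Cmod_circ_ge. lra. }
  apply Rmult_le_reg_l with (2 * PI); [lra|]. eapply Rle_trans; [exact K|]. right. field. lra.
Qed.

Lemma pcont_on_bounded (p : R -> C) (a b : R) :
  a <= b -> pcont_on p a b -> exists M, 0 <= M /\ forall t, a <= t <= b -> Cmod (p t) <= M.
Proof.
  intros Hab Hp.
  destruct (continuity_ab_maj (fun t => Rabs (fst (p t)) + Rabs (snd (p t))) a b Hab) as [x [Hx _]].
  - intros t Ht. destruct (Hp t Ht) as [H1 H2].
    apply continuity_pt_filterlim.
    apply (continuous_plus (fun t => Rabs (fst (p t))) (fun t => Rabs (snd (p t)))).
    + apply (continuous_comp (fun t => fst (p t)) Rabs); [exact H1|apply continuous_Rabs].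
    + apply (continuous_comp (fun t => snd (p t)) Rabs); [exact H2|apply continuous_Rabs].
  - exists (Rabs (fst (p x)) + Rabs (snd (p x))). split.
    + assert (A := Rabs_pos (fst (p x))). assert (B := Rabs_pos (snd (p x))). lra.
    + intros t Ht. eapply Rle_trans; [apply Cmod_le_fst_snd|]. now apply Hx.
Qed.

(** Differentiation under the integral sign: a quadratic remainder uniform in the parameter
    integrates to a quadratic remainder. *)
Lemma param_CInt_cd (K : R -> C -> C) (K1 : R -> C) (z : C) (a b r M : R) :
  a <= b -> 0 < r -> 0 <= M ->
  (forall w, Cmod (w - z) < r -> pcont_on (fun t => K t w) a b) -> pcont_on K1 a b ->
  (forall w t, Cmod (w - z) < r -> a <= t <= b ->
     Cmod (K t w - K t z - K1 t * (w - z)) <= M * (Cmod (w - z) * Cmod (w - z))) ->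
  is_cd (fun w => CInt (fun t => K t w) a b) z (CInt K1 a b).
Proof.
  intros Hab Hr HM Hc Hc1 HK eps Heps.
  set (D := 2 * M * (b - a) + 1).
  assert (HD : 0 < D).
  { assert (0 <= M * (b - a)) by (apply Rmult_le_pos; lra). unfold D. lra. }
  exists (Rmin r (eps / D)). split.
  { apply Rmin_glb_lt; [lra|]. now apply Rdiv_lt_0_compat. }
  intros w Hw. assert (A := Rmin_l r (eps / D)). assert (B := Rmin_r r (eps / D)).
  assert (Hzz : Cmod (z - z) < r) by (rewrite Cmod_minus_diag; lra).
  assert (Hwr : Cmod (w - z) < r) by lra.
  rewrite <- CInt_minus by auto.
  rewrite (Cmult_comm (CInt K1 a b)). rewrite <- CInt_scal by auto.
  assert (C1 : pcont_on (fun t => K t w - K t z)%C a b).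
  { intros t Ht. apply pcont_minus; [apply (Hc w Hwr t Ht)|apply (Hc z Hzz t Ht)]. }
  assert (C2 : pcont_on (fun t => (w - z) * K1 t)%C a b).
  { intros t Ht. apply pcont_mult; [apply pcont_const|now apply Hc1]. }
  rewrite <- CInt_minus by auto.
  set (h := Cmod (w - z)) in *. assert (Hh := Cmod_ge_0 (w - z)%C). fold h in Hh.
  eapply Rle_trans.
  - apply (CInt_bound _ _ _ (M * (h * h))); [exact Hab| |].
    + intros t Ht. apply pcont_minus; [apply (C1 t Ht)|apply (C2 t Ht)].
    + intros t Ht. rewrite (Cmult_comm (w - z)). now apply HK.
  - assert (h * D <= eps).
    { assert (H1 : h < eps / D) by lra. apply Rmult_lt_compat_r with (r := D) in H1; [|lra].
      unfold Rdiv in H1. rewrite Rmult_assoc, Rinv_l, Rmult_1_r in H1; lra. }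
    assert (h * (h * D) <= h * eps) by (apply Rmult_le_compat_l; lra).
    unfold D in *. nra.
Qed.

(** Cauchy transform of an arbitrary density [p], followed by its formal derivative. The density is
    kept general because two are used: [f] times [r cis t] for Cauchy's formula, and [f] itself for
    dividing out a root. *)
Definition cauchy1 (p : R -> C) (a : C) (r : R) (z : C) : C :=
  CInt (fun t => p t / (circ a r t - z))%C 0 (2 * PI).
Definition cauchy2 (p : R -> C) (a : C) (r : R) (z : C) : C :=
  CInt (fun t => p t / ((circ a r t - z) * (circ a r t - z)))%C 0 (2 * PI).

Lemma cauchy1_cd (p : R -> C) (a : C) (r : R) (z : C) :
  pcont_on p 0 (2 * PI) -> Cmod (z - a) < r -> is_cd (cauchy1 p a r) z (cauchy2 p a r z).
Proof.
  intros Hp Hz. assert (Hpi := PI_RGT_0). assert (H0 := Cmod_ge_0 (z - a)%C).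
  destruct (pcont_on_bounded p 0 (2 * PI)) as [B [HB HpB]]; [lra|exact Hp|].
  set (d := (r - Cmod (z - a)) / 2). assert (Hd : 0 < d) by (unfold d; lra).
  assert (Hd3 : 0 < d * d * d) by (repeat apply Rmult_lt_0_compat; lra).
  assert (Hw : forall w, Cmod (w - z) < d -> Cmod (w - a) < r /\ forall t, d <= Cmod (circ a r t - w)).
  { intros w Hw. assert (H1 := Cmod_dist_triangle w z a). split.
    - unfold d in Hw. lra.
    - intros t. assert (H2 := Cmod_circ_ge a r t w). unfold d in *. lra. }
  assert (Hzz : Cmod (z - z) < d) by (rewrite Cmod_minus_diag; lra).
  apply (param_CInt_cd _ _ _ _ _ d (B / (d * d * d))); try lra.
  - apply Rmult_le_pos; [exact HB|]. apply Rlt_le, Rinv_0_lt_compat. exact Hd3.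
  - intros w Hwd t Ht. destruct (Hw w Hwd) as [H1 H2]. apply pcont_div; [now apply Hp| |now apply circ_neq].
    apply pcont_minus; [apply pcont_circ|apply pcont_const].
  - intros t Ht. apply pcont_div; [now apply Hp| |].
    + apply pcont_mult; apply pcont_minus; try apply pcont_circ; apply pcont_const.
    + apply Cmult_neq_0; now apply circ_neq.
  - intros w t Hwd Ht. destruct (Hw w Hwd) as [H1 H2]. destruct (Hw z Hzz) as [H3 H4].
    specialize (H2 t). specialize (H4 t).
    assert (N1 := circ_neq a r t w H1). assert (N2 := circ_neq a r t z H3).
    replace (p t / (circ a r t - w) - p t / (circ a r t - z)
             - p t / ((circ a r t - z) * (circ a r t - z)) * (w - z))%C with
      (p t / ((circ a r t - z) * (circ a r t - z) * (circ a r t - w)) * ((w - z) * (w - z)))%C.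
    2: { field. split; assumption. }
    rewrite Cmod_mult, Cmod_div by (repeat apply Cmult_neq_0; assumption).
    rewrite !Cmod_mult. apply Rmult_le_compat_r; [apply Rmult_le_pos; apply Cmod_ge_0|].
    apply Rmult_le_compat; [apply Cmod_ge_0| |now apply HpB|].
    + apply Rlt_le, Rinv_0_lt_compat. repeat apply Rmult_lt_0_compat; lra.
    + apply Rinv_le_contravar; [exact Hd3|].
      apply Rmult_le_compat; [nra|lra|nra|lra].
Qed.

Lemma cauchy2_cd (p : R -> C) (a : C) (r : R) (z : C) :
  pcont_on p 0 (2 * PI) -> Cmod (z - a) < r -> exists l, is_cd (cauchy2 p a r) z l.
Proof.
  intros Hp Hz. assert (Hpi := PI_RGT_0). assert (H0 := Cmod_ge_0 (z - a)%C).
  destruct (pcont_on_bounded p 0 (2 * PI)) as [B [HB HpB]]; [lra|exact Hp|].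
  set (d := (r - Cmod (z - a)) / 2). assert (Hd : 0 < d) by (unfold d; lra).
  assert (Hr : 0 < r) by lra.
  assert (Hd5 : 0 < d * d * d * d * d) by (repeat apply Rmult_lt_0_compat; lra).
  assert (Hw : forall w, Cmod (w - z) < d -> Cmod (w - a) < r /\ forall t, d <= Cmod (circ a r t - w)).
  { intros w Hw. assert (H1 := Cmod_dist_triangle w z a). split.
    - unfold d in Hw. lra.
    - intros t. assert (H2 := Cmod_circ_ge a r t w). unfold d in *. lra. }
  assert (Hzz : Cmod (z - z) < d) by (rewrite Cmod_minus_diag; lra).
  eexists.
  apply (param_CInt_cd _ (fun t => p t * (1 + 1) / ((circ a r t - z) * (circ a r t - z) * (circ a r t - z)))%C
           _ _ _ d (B * (8 * r) / (d * d * d * d * d))); try lra.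
  - apply Rmult_le_pos; [apply Rmult_le_pos; lra|]. apply Rlt_le, Rinv_0_lt_compat. exact Hd5.
  - intros w Hwd t Ht. destruct (Hw w Hwd) as [H1 H2]. apply pcont_div; [now apply Hp| |].
    + apply pcont_mult; apply pcont_minus; try apply pcont_circ; apply pcont_const.
    + apply Cmult_neq_0; now apply circ_neq.
  - intros t Ht. apply pcont_div.
    + apply pcont_mult; [now apply Hp|apply pcont_const].
    + repeat apply pcont_mult; apply pcont_minus; try apply pcont_circ; apply pcont_const.
    + repeat apply Cmult_neq_0; now apply circ_neq.
  - intros w t Hwd Ht. destruct (Hw w Hwd) as [H1 H2]. destruct (Hw z Hzz) as [H3 H4].
    specialize (H2 t). specialize (H4 t).
    assert (N1 := circ_neq a r t w H1). assert (N2 := circ_neq a r t z H3).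
    set (u := (circ a r t - z)%C) in *. set (v := (circ a r t - w)%C) in *.
    assert (Euv : (w - z = u - v)%C) by (unfold u, v; ring).
    rewrite !Euv.
    replace (p t / (v * v) - p t / (u * u) - p t * (1 + 1) / (u * u * u) * (u - v))%C with
      (p t * (u + v + v) / (u * u * u * v * v) * ((u - v) * (u - v)))%C by (field; auto).
    rewrite Cmod_mult, Cmod_div by (repeat apply Cmult_neq_0; assumption).
    rewrite !Cmod_mult. apply Rmult_le_compat_r; [apply Rmult_le_pos; apply Cmod_ge_0|].
    assert (Hu : Cmod u <= 2 * r).
    { unfold u. assert (T := Cmod_dist_triangle (circ a r t) a z). rewrite Cmod_circ in T by lra.
      rewrite (Cmod_minus_sym a z) in T. lra. }
    assert (Hv : Cmod v <= 2 * r).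
    { unfold v. assert (T := Cmod_dist_triangle (circ a r t) a w). rewrite Cmod_circ in T by lra.
      rewrite (Cmod_minus_sym a w) in T. lra. }
    apply Rmult_le_compat.
    + apply Rmult_le_pos; apply Cmod_ge_0.
    + apply Rlt_le, Rinv_0_lt_compat. repeat apply Rmult_lt_0_compat; lra.
    + apply Rmult_le_compat; try apply Cmod_ge_0; [now apply HpB|].
      assert (T1 := Cmod_triangle (u + v) v). assert (T2 := Cmod_triangle u v). lra.
    + apply Rinv_le_contravar; [exact Hd5|].
      repeat (apply Rmult_le_compat; try (repeat apply Rmult_le_pos; lra)).
Qed.

Lemma circle_between (a z : C) (R0 : R) : Cmod (z - a) < R0 ->
  exists r, Cmod (z - a) < r /\ r < R0 /\ 0 < r.
Proof.
  intros H. exists ((Cmod (z - a) + R0) / 2). assert (A := Cmod_ge_0 (z - a)%C). lra.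
Qed.

Lemma pcont_on_circ (f : C -> C) (a : C) (r R0 : R) :
  0 < r -> r < R0 -> holB a R0 f -> pcont_on (fun t => f (circ a r t)) 0 (2 * PI).
Proof.
  intros Hr HR Hf t _. apply pcont_comp; [|apply pcont_circ].
  destruct (Hf (circ a r t)) as [l Hl]; [rewrite Cmod_circ; lra|]. eapply is_cd_ccont, Hl.
Qed.

(** Cauchy's formula writes [f] as a transform [cauchy1], so by uniqueness of derivatives [f'] is
    the matching [cauchy2], which is itself differentiable. *)
Theorem deriv_holB (f f' : C -> C) (a : C) (R0 : R) :
  (forall w, Cmod (w - a) < R0 -> is_cd f w (f' w)) -> holB a R0 f'.
Proof.
  intros Hf z Hz. assert (Hpi := PI_RGT_0).
  destruct (circle_between a z R0 Hz) as [r [H1 [H2 H3]]].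
  assert (Hol : holB a R0 f) by (intros w Hw; exists (f' w); auto).
  set (p := fun t => (f (circ a r t) * (r * cis t))%C).
  assert (Hp : pcont_on p 0 (2 * PI)).
  { intros t Ht. apply pcont_mult.
    - apply (pcont_on_circ f a r R0 H3 H2 Hol t Ht).
    - apply pcont_mult; [apply pcont_const|apply pcont_cis]. }
  assert (N : RtoC (2 * PI) <> RtoC 0) by (apply RtoC_neq; lra).
  assert (E : forall w, Cmod (w - a) < r -> f w = (/ RtoC (2 * PI) * cauchy1 p a r w)%C).
  { intros w Hw. unfold cauchy1, p. rewrite <- (cauchy_formula f a w r Hw).
    - field. exact N.
    - intros v Hv. apply Hol. lra. }
  assert (E' : forall w, Cmod (w - a) < r -> f' w = (/ RtoC (2 * PI) * cauchy2 p a r w)%C).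
  { intros w Hw. apply (is_cd_unique f w); [apply Hf; lra|].
    eapply (is_cd_ext_loc (fun w => / RtoC (2 * PI) * cauchy1 p a r w)%C f w _ (r - Cmod (w - a))).
    - lra.
    - intros v Hv. symmetry. apply E. assert (T := Cmod_dist_triangle v w a). lra.
    - apply is_cd_scal. now apply cauchy1_cd. }
  destruct (cauchy2_cd p a r z Hp H1) as [l Hl].
  exists (/ RtoC (2 * PI) * l)%C.
  eapply (is_cd_ext_loc (fun w => / RtoC (2 * PI) * cauchy2 p a r w)%C f' z _ (r - Cmod (z - a))).
  - lra.
  - intros v Hv. symmetry. apply E'. assert (T := Cmod_dist_triangle v z a). lra.
  - now apply is_cd_scal.
Qed.

(** Subtracting Cauchy's formula at [a] from that at [w] leaves [w - a] times the Cauchy transform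
    of [f], because the weight [r cis t] is [circ a r t - a] and cancels one denominator. This
    transform supplies the value of the quotient at [a] and its differentiability there. *)
Lemma divide_root (f : C -> C) (a : C) (R0 : R) :
  0 < R0 -> holB a R0 f -> f a = RtoC 0 ->
  exists g, holB a R0 g /\ forall w, Cmod (w - a) < R0 -> f w = ((w - a) * g w)%C.
Proof.
  intros HR Hf Ha. assert (Hpi := PI_RGT_0).
  set (r := R0 / 2). assert (H3 : 0 < r) by (unfold r; lra). assert (H2 : r < R0) by (unfold r; lra).
  set (q := fun t => f (circ a r t)).
  assert (Hq : pcont_on q 0 (2 * PI)) by now apply (pcont_on_circ f a r R0).
  assert (N : RtoC (2 * PI) <> RtoC 0) by (apply RtoC_neq; lra).
  set (T := fun w => (/ RtoC (2 * PI) * cauchy1 q a r w)%C).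
  assert (E : forall w, Cmod (w - a) < r -> f w = ((w - a) * T w)%C).
  { intros w Hw.
    assert (F1 := cauchy_formula f a w r Hw ltac:(intros v Hv; apply Hf; lra)).
    assert (F2 := cauchy_formula f a a r ltac:(rewrite Cmod_minus_diag; lra) ltac:(intros v Hv; apply Hf; lra)).
    assert (P1 : forall v, Cmod (v - a) < r -> pcont_on (fun t => f (circ a r t) * (r * cis t) / (circ a r t - v))%C 0 (2 * PI)).
    { intros v Hv t Ht. apply pcont_div.
      - apply pcont_mult; [now apply Hq|]. apply pcont_mult; [apply pcont_const|apply pcont_cis].
      - apply pcont_minus; [apply pcont_circ|apply pcont_const].
      - now apply circ_neq. }
    assert (F3 : (RtoC (2 * PI) * f w - RtoC (2 * PI) * f a)%C = ((w - a) * cauchy1 q a r w)%C).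
    { assert (Haa : Cmod (a - a) < r) by (rewrite Cmod_minus_diag; lra).
      rewrite F1, F2. rewrite <- CInt_minus; [|lra|apply (P1 w Hw)|apply (P1 a Haa)].
      unfold cauchy1. rewrite <- CInt_scal.
      - apply CInt_ext; [lra|]. intros t _. unfold q.
        assert (N1 := circ_neq a r t w Hw). assert (N2 := circ_neq a r t a Haa).
        replace (r * cis t)%C with (circ a r t - a)%C by (unfold circ; ring).
        field. split; assumption.
      - lra.
      - intros t Ht. apply pcont_div; [now apply Hq| |now apply circ_neq].
        apply pcont_minus; [apply pcont_circ|apply pcont_const]. }
    rewrite Ha in F3. unfold T.
    replace (f w) with (/ RtoC (2 * PI) * (RtoC (2 * PI) * f w - RtoC (2 * PI) * 0))%C by (field; exact N).
    rewrite F3. ring. }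
  exists (fun w => if excluded_middle_informative (w = a) then T a else (f w / (w - a))%C).
  split.
  - intros w Hw. destruct (excluded_middle_informative (w = a)) as [->|Hwa].
    + assert (Haa : Cmod (a - a) < r) by (rewrite Cmod_minus_diag; lra).
      exists (/ RtoC (2 * PI) * cauchy2 q a r a)%C.
      apply (is_cd_ext_loc T _ a _ r H3).
      * intros v Hv. destruct (excluded_middle_informative (v = a)) as [->|Hva]; [reflexivity|].
        rewrite (E v Hv). field. now apply Cminus_neq_0.
      * apply is_cd_scal. now apply cauchy1_cd.
    + destruct (Hf w Hw) as [l Hl]. eexists.
      eapply (is_cd_ext_loc (fun w => f w / (w - a))%C _ w _ (Cmod (w - a))).
      * now apply Cmod_minus_gt_0.
      * intros v Hv. destruct (excluded_middle_informative (v = a)) as [->|Hva]; [|reflexivity].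
        rewrite Cmod_minus_sym in Hv. lra.
      * apply is_cd_div; [exact Hl| |now apply Cminus_neq_0].
        apply is_cd_minus; [apply is_cd_id|apply is_cd_const].
  - intros w Hw. destruct (excluded_middle_informative (w = a)) as [->|Hwa].
    + rewrite Ha. ring.
    + field. now apply Cminus_neq_0.
Qed.

(** * Removable singularities, order of zeros, Gronwall *)

Lemma holB_const (c a : C) (r : R) : holB a r (fun _ => c).
Proof. intros w _. eexists. apply is_cd_const. Qed.

Lemma holB_mult (a : C) (r : R) (f g : C -> C) :
  holB a r f -> holB a r g -> holB a r (fun w => f w * g w)%C.
Proof.
  intros Hf Hg w Hw. destruct (Hf w Hw) as [l Hl]. destruct (Hg w Hw) as [k Hk].
  eexists. apply is_cd_mult; eassumption.
Qed.

Lemma holB_plus (a : C) (r : R) (f g : C -> C) :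
  holB a r f -> holB a r g -> holB a r (fun w => f w + g w)%C.
Proof.
  intros Hf Hg w Hw. destruct (Hf w Hw) as [l Hl]. destruct (Hg w Hw) as [k Hk].
  eexists. apply is_cd_plus; eassumption.
Qed.

Lemma holB_pow (a p : C) (r : R) (n : nat) : holB a r (fun w => (w - p) ^ n)%C.
Proof. intros w _. apply is_cd_pow_n. Qed.

Lemma holB_div (a : C) (r : R) (f g : C -> C) :
  holB a r f -> holB a r g -> (forall w, Cmod (w - a) < r -> g w <> RtoC 0) ->
  holB a r (fun w => f w / g w)%C.
Proof.
  intros Hf Hg Hz w Hw. destruct (Hf w Hw) as [l Hl]. destruct (Hg w Hw) as [k Hk].
  eexists. apply is_cd_div; eauto.
Qed.

Lemma holB_ext (a : C) (r : R) (f g : C -> C) :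
  (forall w, Cmod (w - a) < r -> f w = g w) -> holB a r f -> holB a r g.
Proof.
  intros E Hf w Hw. destruct (Hf w Hw) as [l Hl]. exists l.
  apply (is_cd_ext_loc f g w l (r - Cmod (w - a))); [lra| |exact Hl].
  intros v Hv. apply E. assert (T := Cmod_dist_triangle v w a). lra.
Qed.

Lemma holB_ccont (a : C) (r : R) (f : C -> C) (z : C) : holB a r f -> Cmod (z - a) < r -> ccont f z.
Proof. intros Hf Hz. destruct (Hf z Hz) as [l Hl]. eapply is_cd_ccont, Hl. Qed.

(** Riemann's argument: [(w - a)^2 f] is differentiable at [a] with derivative 0, whatever the value
    [f a], so the root [a] can be divided out twice. *)
Lemma removable_singularity (f : C -> C) (a : C) (R0 M : R) :
  0 < R0 ->
  (forall w, w <> a -> Cmod (w - a) < R0 -> exists l, is_cd f w l) ->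
  (forall w, w <> a -> Cmod (w - a) < R0 -> Cmod (f w) <= M) ->
  exists g, holB a R0 g /\ forall w, w <> a -> Cmod (w - a) < R0 -> f w = g w.
Proof.
  intros HR Hf HM.
  set (h := fun w => ((w - a) * (w - a) * f w)%C).
  assert (Hha : h a = RtoC 0) by (unfold h; ring).
  assert (Hda : is_cd h a (RtoC 0)).
  { intros eps Heps. set (M' := Rabs M + 1). assert (HM' : 0 < M') by (unfold M'; assert (X := Rabs_pos M); lra).
    exists (Rmin R0 (eps / M')). split; [apply Rmin_glb_lt; [lra|now apply Rdiv_lt_0_compat]|].
    intros w Hw. assert (A := Rmin_l R0 (eps / M')). assert (B := Rmin_r R0 (eps / M')).
    rewrite Hha. unfold h.
    destruct (excluded_middle_informative (w = a)) as [->|Hwa].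
    - replace ((a - a) * (a - a) * f a - 0 - 0 * (a - a))%C with (RtoC 0) by ring.
      rewrite Cmod_0, Cmod_minus_diag. lra.
    - replace ((w - a) * (w - a) * f w - 0 - 0 * (w - a))%C with ((w - a) * (w - a) * f w)%C by ring.
      rewrite !Cmod_mult. specialize (HM w Hwa ltac:(lra)).
      set (t := Cmod (w - a)) in *. assert (Ht := Cmod_ge_0 (w - a)%C). fold t in Ht.
      assert (HMM : M <= M') by (unfold M'; assert (X := Rle_abs M); lra).
      assert (Ht2 : t * M' <= eps).
      { assert (H1 : t < eps / M') by lra. apply Rmult_lt_compat_r with (r := M') in H1; [|lra].
        unfold Rdiv in H1. rewrite Rmult_assoc, Rinv_l, Rmult_1_r in H1; lra. }
      assert (Hf0 := Cmod_ge_0 (f w)).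
      rewrite Rmult_assoc, Rmult_comm. apply Rmult_le_compat_r; [lra|].
      apply Rle_trans with (t * M'); [apply Rmult_le_compat_l; lra|exact Ht2]. }
  assert (Hh : holB a R0 h).
  { intros w Hw. destruct (excluded_middle_informative (w = a)) as [->|Hwa]; [eexists; exact Hda|].
    destruct (Hf w Hwa Hw) as [l Hl]. eexists. apply is_cd_mult; [|exact Hl].
    apply is_cd_mult; (apply is_cd_minus; [apply is_cd_id|apply is_cd_const]). }
  destruct (divide_root h a R0 HR Hh Hha) as [h1 [Hh1 E1]].
  assert (H1a : h1 a = RtoC 0).
  { symmetry. apply (is_cd_unique h a); [exact Hda|].
    destruct (Hh1 a) as [l Hl]; [rewrite Cmod_minus_diag; lra|].
    eapply is_cd_val.
    - eapply (is_cd_ext_loc (fun w => (w - a) * h1 w)%C _ a _ R0 HR).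
      + intros w Hw. symmetry. now apply E1.
      + apply is_cd_mult; [|exact Hl]. apply is_cd_minus; [apply is_cd_id|apply is_cd_const].
    - cbv beta. ring. }
  destruct (divide_root h1 a R0 HR Hh1 H1a) as [h2 [Hh2 E2]].
  exists h2. split; [exact Hh2|]. intros w Hwa Hw.
  assert (N := Cminus_neq_0 _ _ Hwa).
  assert (E : ((w - a) * (w - a) * f w = (w - a) * (w - a) * h2 w)%C).
  { change (h w = (w - a) * (w - a) * h2 w)%C. rewrite E1, E2 by exact Hw. ring. }
  apply (f_equal (fun x => x / ((w - a) * (w - a)))%C) in E.
  replace (f w) with ((w - a) * (w - a) * f w / ((w - a) * (w - a)))%C by (field; exact N).
  rewrite E. field. exact N.
Qed.

Lemma geometric_zero (x K q : R) : 0 <= q < 1 -> (forall n, x <= K * q ^ n) -> x <= 0.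
Proof.
  intros Hq H. apply Rnot_lt_le. intros Hx.
  assert (HK : 0 < K) by (specialize (H 0%nat); simpl in H; lra).
  destruct (pow_lt_1_zero q) with (y := x / K) as [n Hn].
  - rewrite Rabs_right; lra.
  - now apply Rdiv_lt_0_compat.
  - specialize (Hn n (le_n n)). specialize (H n).
    rewrite Rabs_right in Hn by (apply Rle_ge, pow_le; lra).
    apply Rmult_lt_compat_l with (r := K) in Hn; [|lra].
    replace (K * (x / K)) with x in Hn by (field; lra). lra.
Qed.

(** If the root can be divided out forever, Cauchy's estimate on a circle of radius [r] bounds the
    n-th cofactor by [4 B / r^n]. On the disc of radius [r / 2] this gives [|f| <= 4 B / 2^n] for
    all [n]. *)
Theorem zero_order (f : C -> C) (a : C) (R0 : R) :
  0 < R0 -> holB a R0 f ->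
  (exists r, 0 < r /\ forall w, Cmod (w - a) < r -> f w = RtoC 0) \/
  (exists k u, holB a R0 u /\ u a <> RtoC 0 /\
     forall w, Cmod (w - a) < R0 -> f w = ((w - a) ^ k * u w)%C).
Proof.
  intros HR Hf.
  destruct (classic (exists k u, holB a R0 u /\ u a <> RtoC 0 /\
     forall w, Cmod (w - a) < R0 -> f w = ((w - a) ^ k * u w)%C)) as [H|H]; [now right|left].
  assert (Hk : forall k, exists u, holB a R0 u /\
     forall w, Cmod (w - a) < R0 -> f w = ((w - a) ^ k * u w)%C).
  { induction k as [|k [u [Hu E]]].
    - exists f. split; [exact Hf|]. intros w _. simpl. ring.
    - assert (Ha : u a = RtoC 0).
      { apply NNPP. intros Ha. apply H. now exists k, u. }
      destruct (divide_root u a R0 HR Hu Ha) as [g [Hg E']].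
      exists g. split; [exact Hg|]. intros w Hw. rewrite E, E' by exact Hw. simpl. ring. }
  destruct (is_cd_ccont f a (proj1_sig (constructive_indefinite_description _ (Hf a ltac:(rewrite Cmod_minus_diag; lra))))) with (eps := 1) as [d [Hd Hc]].
  { destruct (constructive_indefinite_description _ _) as [l Hl]. exact Hl. }
  { lra. }
  set (B := Cmod (f a) + 1).
  set (r := Rmin (R0 / 2) (d / 2)).
  assert (Hr : 0 < r) by (apply Rmin_glb_lt; lra).
  assert (Hr1 : r <= R0 / 2) by apply Rmin_l. assert (Hr2 : r <= d / 2) by apply Rmin_r.
  exists (r / 2). split; [lra|]. intros w Hw.
  apply Cmod_le_0. apply (geometric_zero _ (4 * B) (/ 2)); [lra|].
  intros n. destruct (Hk n) as [u [Hu E]].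
  assert (Hrn : 0 < r ^ n) by now apply pow_lt.
  assert (Hub : Cmod (u w) <= 2 * (B / r ^ n) * r / (r - Cmod (w - a))).
  { apply cauchy_estimate.
    - lra.
    - intros v Hv. apply Hu. lra.
    - intros t _. set (v := circ a r t).
      assert (Hv : Cmod (v - a) = r) by (apply Cmod_circ; lra).
      assert (Ev := E v ltac:(lra)). apply (f_equal Cmod) in Ev.
      rewrite Cmod_mult, Cmod_pow, Hv in Ev.
      assert (HfB : Cmod (f v) <= B).
      { assert (X := Hc v ltac:(lra)). assert (Y := Cmod_minus_ge (f v) (f a)). unfold B. lra. }
      apply Rle_div_r; [lra|]. lra. }
  assert (HB : 0 < B) by (unfold B; assert (X := Cmod_ge_0 (f a)); lra).
  assert (Hub2 : Cmod (u w) <= 4 * B / r ^ n).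
  { eapply Rle_trans; [exact Hub|].
    apply Rle_trans with (2 * (B / r ^ n) * r / (r / 2)).
    - apply Rmult_le_compat_l.
      + apply Rmult_le_pos; [|lra]. apply Rmult_le_pos; [lra|]. apply Rlt_le. now apply Rdiv_lt_0_compat.
      + apply Rinv_le_contravar; lra.
    - right. field. split; lra. }
  rewrite (E w) by lra. rewrite Cmod_mult, Cmod_pow.
  assert (Hp : Cmod (w - a) ^ n <= (r / 2) ^ n).
  { apply pow_incr. split; [apply Cmod_ge_0|lra]. }
  apply Rle_trans with ((r / 2) ^ n * (4 * B / r ^ n)).
  - apply Rmult_le_compat; [apply pow_le, Cmod_ge_0|apply Cmod_ge_0|exact Hp|exact Hub2].
  - right. unfold Rdiv. rewrite Rpow_mult_distr. field. lra.
Qed.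

(** The function [(E + b) exp (- c t)] is nonincreasing, since [c >= 1] gives
    [c E + b <= c (E + b)]. *)
Lemma gronwall (E E' : R -> R) (T c b : R) :
  0 <= T -> 1 <= c -> 0 <= b ->
  (forall t, 0 <= t <= T -> is_derive E t (E' t)) ->
  (forall t, 0 <= t <= T -> E' t <= c * E t + b) ->
  E T <= (E 0 + b) * exp (c * T).
Proof.
  intros HT Hc Hb HE H.
  set (h := fun t => (E t + b) * exp (- (c * t))).
  set (h' := fun t => (E' t - c * (E t + b)) * exp (- (c * t))).
  assert (Hd : forall t, 0 <= t <= T -> is_derive h t (h' t)).
  { intros t Ht. specialize (HE t Ht). unfold h, h'.
    auto_derive; [now exists (E' t)|]. rewrite (is_derive_unique (fun x : R => E x) t (E' t) HE). ring. }
  assert (Hh : h T <= h 0).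
  { destruct (MVT_gen h 0 T h') as [x [Hx Ex]].
    - rewrite Rmin_left, Rmax_right by lra. intros t Ht. apply Hd. lra.
    - rewrite Rmin_left, Rmax_right by lra. intros t Ht.
      apply continuity_pt_filterlim. apply (ex_derive_continuous h). exists (h' t). now apply Hd.
    - rewrite Rmin_left, Rmax_right in Hx by lra.
      assert (h' x <= 0).
      { unfold h'. assert (He := exp_pos (- (c * x))). assert (Hx' := H x Hx).
        assert (E' x - c * (E x + b) <= 0) by nra. nra. }
      nra. }
  unfold h in Hh. rewrite Rmult_0_r, Ropp_0, exp_0, Rmult_1_r in Hh.
  apply Rmult_le_compat_r with (r := exp (c * T)) in Hh; [|left; apply exp_pos].
  rewrite Rmult_assoc, <- exp_plus in Hh.
  replace (- (c * T) + c * T) with 0 in Hh by ring. rewrite exp_0 in Hh. lra.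
Qed.

Lemma pder_Cmod2 (x : R -> C) (t : R) (y : C) :
  pder x t y -> is_derive (fun t => Cmod (x t) ^ 2) t (2 * (fst (x t) * fst y + snd (x t) * snd y)).
Proof.
  intros [H1 H2].
  apply (is_derive_ext (fun t => fst (x t) ^ 2 + snd (x t) ^ 2)).
  { intros s. symmetry. apply Cmod2_alt. }
  assert (G : forall (u v : R -> R) a b, is_derive u t a -> is_derive v t b ->
    is_derive (fun s => u s ^ 2 + v s ^ 2) t (2 * (u t * a + v t * b))).
  { intros u v a b Hu Hv. auto_derive.
    - repeat split; eexists; eassumption.
    - rewrite (is_derive_unique (fun x : R => u x) t a Hu), (is_derive_unique (fun x : R => v x) t b Hv). ring. }
  exact (G _ _ _ _ H1 H2).
Qed.

Lemma dot_le (x y : C) : fst x * fst y + snd x * snd y <= Cmod x * Cmod y.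
Proof.
  replace (fst x * fst y + snd x * snd y) with (Re (x * Cconj y)%C) by (simpl; ring).
  eapply Rle_trans; [apply Rle_abs|]. eapply Rle_trans; [apply re_le_Cmod|].
  rewrite Cmod_mult, Cmod_conj. lra.
Qed.

(** Squared norm rather than norm, because it stays differentiable where the vector vanishes. *)
Definition sq3 (x y z : C) : R := Cmod x ^ 2 + Cmod y ^ 2 + Cmod z ^ 2.

(** With [s] the sum of the three moduli, the derivative of [sq3] is at most [2 k s^2 + 2 eta s].
    The constants come from [s^2 <= 3 sq3] and [2 eta s <= sq3 + 3 eta^2]. *)
Lemma gronwall3 (x1 x2 x3 y1 y2 y3 : R -> C) (T k eta : R) :
  0 <= T -> 0 <= k -> 0 <= eta ->
  (forall t, 0 <= t <= T -> pder x1 t (y1 t)) ->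
  (forall t, 0 <= t <= T -> pder x2 t (y2 t)) ->
  (forall t, 0 <= t <= T -> pder x3 t (y3 t)) ->
  (forall t, 0 <= t <= T -> Cmod (y1 t) <= k * (Cmod (x1 t) + Cmod (x2 t) + Cmod (x3 t)) + eta) ->
  (forall t, 0 <= t <= T -> Cmod (y2 t) <= k * (Cmod (x1 t) + Cmod (x2 t) + Cmod (x3 t)) + eta) ->
  (forall t, 0 <= t <= T -> Cmod (y3 t) <= k * (Cmod (x1 t) + Cmod (x2 t) + Cmod (x3 t)) + eta) ->
  sq3 (x1 T) (x2 T) (x3 T) <= (sq3 (x1 0) (x2 0) (x3 0) + 3 * eta ^ 2) * exp ((6 * k + 1) * T).
Proof.
  intros HT Hk He D1 D2 D3 B1 B2 B3.
  apply (gronwall (fun t => sq3 (x1 t) (x2 t) (x3 t))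
    (fun t => 2 * (fst (x1 t) * fst (y1 t) + snd (x1 t) * snd (y1 t))
      + 2 * (fst (x2 t) * fst (y2 t) + snd (x2 t) * snd (y2 t))
      + 2 * (fst (x3 t) * fst (y3 t) + snd (x3 t) * snd (y3 t)))); try lra.
  - assert (0 <= eta ^ 2) by (simpl; nra). lra.
  - intros t Ht. unfold sq3.
    apply (is_derive_plus (fun t => Cmod (x1 t) ^ 2 + Cmod (x2 t) ^ 2) (fun t => Cmod (x3 t) ^ 2)).
    + apply (is_derive_plus (fun t => Cmod (x1 t) ^ 2) (fun t => Cmod (x2 t) ^ 2)); apply pder_Cmod2; auto.
    + apply pder_Cmod2; auto.
  - intros t Ht. specialize (B1 t Ht). specialize (B2 t Ht). specialize (B3 t Ht).
    assert (C1 := dot_le (x1 t) (y1 t)). assert (C2 := dot_le (x2 t) (y2 t)). assert (C3 := dot_le (x3 t) (y3 t)).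
    unfold sq3.
    set (a := Cmod (x1 t)) in *. set (b := Cmod (x2 t)) in *. set (c := Cmod (x3 t)) in *.
    assert (Ha : 0 <= a) by apply Cmod_ge_0. assert (Hb : 0 <= b) by apply Cmod_ge_0.
    assert (Hc : 0 <= c) by apply Cmod_ge_0.
    set (s := a + b + c) in *.
    assert (Q1 : a * Cmod (y1 t) <= a * (k * s + eta)) by (apply Rmult_le_compat_l; lra).
    assert (Q2 : b * Cmod (y2 t) <= b * (k * s + eta)) by (apply Rmult_le_compat_l; lra).
    assert (Q3 : c * Cmod (y3 t) <= c * (k * s + eta)) by (apply Rmult_le_compat_l; lra).
    assert (Hs : s * s <= 3 * (a ^ 2 + b ^ 2 + c ^ 2)).
    { unfold s. assert (U1 := pow2_ge_0 (a - b)). assert (U2 := pow2_ge_0 (b - c)). assert (U3 := pow2_ge_0 (a - c)). nra. }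
    assert (Hs2 : k * (s * s) <= k * (3 * (a ^ 2 + b ^ 2 + c ^ 2))) by (apply Rmult_le_compat_l; lra).
    assert (V1 := pow2_ge_0 (a - eta)). assert (V2 := pow2_ge_0 (b - eta)). assert (V3 := pow2_ge_0 (c - eta)).
    apply Rle_trans with (2 * (k * (s * s)) + 2 * eta * s).
    + assert (a * (k * s + eta) + b * (k * s + eta) + c * (k * s + eta) = k * (s * s) + eta * s) by (unfold s; ring). lra.
    + assert (2 * eta * s <= a ^ 2 + b ^ 2 + c ^ 2 + 3 * eta ^ 2) by (unfold s; nra). lra.
Qed.

Lemma gronwall1 (x y : R -> C) (T k eta : R) :
  0 <= T -> 0 <= k -> 0 <= eta ->
  (forall t, 0 <= t <= T -> pder x t (y t)) ->
  (forall t, 0 <= t <= T -> Cmod (y t) <= k * Cmod (x t) + eta) ->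
  Cmod (x T) ^ 2 <= (Cmod (x 0) ^ 2 + 3 * eta ^ 2) * exp ((6 * k + 1) * T).
Proof.
  intros HT Hk He D B.
  assert (H := gronwall3 x (fun _ => RtoC 0) (fun _ => RtoC 0) y (fun _ => RtoC 0) (fun _ => RtoC 0) T k eta HT Hk He).
  assert (P0 : forall t : R, pder (fun _ => RtoC 0) t (RtoC 0)).
  { intros t. split; simpl; apply (is_derive_const (V := R_NormedModule)). }
  unfold sq3 in H. rewrite Cmod_0 in H.
  replace (Cmod (x T) ^ 2 + 0 ^ 2 + 0 ^ 2) with (Cmod (x T) ^ 2) in H by ring.
  replace (Cmod (x 0) ^ 2 + 0 ^ 2 + 0 ^ 2) with (Cmod (x 0) ^ 2) in H by ring.
  apply H; auto.
  - intros t Ht. rewrite !Rplus_0_r. auto.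
  - intros t Ht. assert (A := Cmod_ge_0 (x t)). nra.
  - intros t Ht. assert (A := Cmod_ge_0 (x t)). nra.
Qed.

Definition seg (a z : C) (t : R) : C := (a + (z - a) * RtoC t)%C.

Lemma pder_seg a z t : pder (seg a z) t (z - a)%C.
Proof.
  apply (pder_ext (seg a z) _ t ((z - a) * 1)%C); [reflexivity|ring|].
  unfold seg. apply pder_affine, pder_RtoC.
Qed.

Lemma seg_0 a z : seg a z 0 = a.
Proof. unfold seg. ring. Qed.
Lemma seg_1 a z : seg a z 1 = z.
Proof. unfold seg. ring. Qed.

Lemma seg_ball (a z p : C) (r : R) (t : R) : 0 <= t <= 1 ->
  Cmod (a - p) < r -> Cmod (z - p) < r -> Cmod (seg a z t - p) < r.
Proof.
  intros Ht Ha Hz. unfold seg.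
  replace (a + (z - a) * t - p)%C with (RtoC (1 - t) * (a - p) + RtoC t * (z - p))%C.
  2: { rewrite RtoC_minus. ring. }
  eapply Rle_lt_trans; [apply Cmod_triangle|].
  rewrite !Cmod_mult, !Cmod_R, !Rabs_right by lra.
  destruct (Req_dec t 0) as [->|H]; [nra|]. nra.
Qed.

(** Gronwall with [k = 0] for the linearisation error along the segment; the constant 3 absorbs
    [exp 1 <= 3] together with the factor in front of [eta^2]. *)
Lemma mean_value (f f' : C -> C) (a z l : C) (s : R) :
  0 <= s ->
  (forall t, 0 <= t <= 1 -> is_cd f (seg a z t) (f' (seg a z t))) ->
  (forall t, 0 <= t <= 1 -> Cmod (f' (seg a z t) - l) <= s) ->
  Cmod (f z - f a - l * (z - a)) <= 3 * s * Cmod (z - a).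
Proof.
  intros Hs Hd Hb.
  set (h := Cmod (z - a)). assert (Hh : 0 <= h) by apply Cmod_ge_0.
  assert (H := gronwall1 (fun t => f (seg a z t) - f a - l * (seg a z t - a))%C
     (fun t => (f' (seg a z t) - l) * (z - a))%C 1 0 (s * h)).
  cbv beta in H. rewrite seg_0, seg_1 in H.
  assert (K : Cmod (f z - f a - l * (z - a)) ^ 2 <= (3 * s * h) ^ 2).
  { eapply Rle_trans; [apply H|]; try lra.
    - apply Rmult_le_pos; lra.
    - intros t Ht.
      apply (pder_comp (fun w => f w - f a - l * (w - a))%C (seg a z)); [|apply pder_seg].
      eapply is_cd_val.
      + apply is_cd_minus.
        * apply is_cd_minus; [now apply Hd|apply is_cd_const].
        * apply is_cd_scal. apply is_cd_minus; [apply is_cd_id|apply is_cd_const].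
      + ring.
    - intros t Ht. rewrite Cmod_mult. rewrite Rmult_0_l, Rplus_0_l.
      apply Rmult_le_compat_r; [exact Hh|auto].
    - replace (f a - f a - l * (a - a))%C with (RtoC 0) by ring. rewrite Cmod_0.
      replace ((6 * 0 + 1) * 1) with 1 by ring.
      assert (exp 1 <= 3) by apply exp_le_3.
      assert (0 <= (s * h) ^ 2) by apply pow2_ge_0.
      replace ((3 * s * h) ^ 2) with (3 * (s * h) ^ 2 * 3) by ring.
      replace (0 ^ 2 + 3 * (s * h) ^ 2) with (3 * (s * h) ^ 2) by ring.
      apply Rmult_le_compat_l; lra. }
  apply Rsqr_incr_0_var.
  - unfold Rsqr. simpl in K. lra.
  - apply Rmult_le_pos; [lra|exact Hh].
Qed.

(** * The spherical metric *)

Lemma sqrt_1_sq_bounds (x : R) : 0 <= x ->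
  1 <= sqrt (1 + x ^ 2) /\ x <= sqrt (1 + x ^ 2) /\ sqrt (1 + x ^ 2) <= 1 + x.
Proof.
  intros Hx. assert (H := pow2_ge_0 x). repeat split.
  - rewrite <- sqrt_1 at 1. apply sqrt_le_1; lra.
  - rewrite <- (sqrt_pow2 x Hx) at 1. apply sqrt_le_1; lra.
  - rewrite <- (sqrt_pow2 (1 + x)) by lra. apply sqrt_le_1; nra.
Qed.

Lemma half_chord_ge_0 (p q : sphere) : 0 <= half_chord p q.
Proof.
  destruct p as [z|], q as [w|]; simpl; try lra.
  - destruct (sqrt_1_sq_bounds _ (Cmod_ge_0 z)) as [A _]. destruct (sqrt_1_sq_bounds _ (Cmod_ge_0 w)) as [B _].
    simpl in A, B. apply Rmult_le_pos; [apply Cmod_ge_0|]. apply Rlt_le, Rinv_0_lt_compat. nra.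
  - destruct (sqrt_1_sq_bounds _ (Cmod_ge_0 z)) as [A _]. simpl in A. apply Rlt_le, Rinv_0_lt_compat. lra.
  - destruct (sqrt_1_sq_bounds _ (Cmod_ge_0 w)) as [A _]. simpl in A. apply Rlt_le, Rinv_0_lt_compat. lra.
Qed.

Lemma half_chord_diag (p : sphere) : half_chord p p = 0.
Proof.
  destruct p as [z|]; simpl; [|reflexivity]. rewrite Cmod_minus_diag. unfold Rdiv. ring.
Qed.

Lemma sph_dist_diag (p : sphere) : sph_dist p p = 0.
Proof. unfold sph_dist. rewrite half_chord_diag, asin_0. ring. Qed.

Lemma half_chord_le_Cmod (z w : C) : half_chord (Fin z) (Fin w) <= Cmod (z - w).
Proof.
  unfold half_chord.
  destruct (sqrt_1_sq_bounds _ (Cmod_ge_0 z)) as [A _]. destruct (sqrt_1_sq_bounds _ (Cmod_ge_0 w)) as [B _].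
  apply Rle_div_l; [nra|]. assert (H := Cmod_ge_0 (z - w)%C).
  rewrite <- (Rmult_1_r (Cmod (z - w))) at 1. apply Rmult_le_compat_l; nra.
Qed.

Lemma asin_sin_lt (x y : R) : 0 <= x -> 0 < y -> y < 1 -> x < sin y -> asin x <= y.
Proof.
  intros Hx Hy Hy1 H. assert (P2 := PI2_1). assert (S := SIN_bound y).
  apply Rnot_lt_le. intros K.
  assert (B := asin_bound x).
  assert (E : sin (asin x) = x) by (apply sin_asin; lra).
  assert (L : sin y < sin (asin x)) by (apply sin_increasing_1; lra).
  lra.
Qed.

Lemma sph_dist_small (eps : R) : 0 < eps -> exists d, 0 < d /\
  forall p q, half_chord p q < d -> sph_dist p q < eps.
Proof.
  intros He. set (y := Rmin (1 / 2) (eps / 4)).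
  assert (Hy : 0 < y) by (apply Rmin_glb_lt; lra).
  assert (Hy1 : y <= 1 / 2) by apply Rmin_l. assert (Hy2 : y <= eps / 4) by apply Rmin_r.
  assert (P2 := PI2_1).
  exists (sin y). split; [apply sin_gt_0; lra|]. intros p q H.
  unfold sph_dist. assert (asin (half_chord p q) <= y).
  { apply asin_sin_lt; try lra. apply half_chord_ge_0. }
  lra.
Qed.

Lemma half_chord_small (d : R) : 0 < d -> exists eps, 0 < eps /\
  forall p q, sph_dist p q < eps -> half_chord p q < d.
Proof.
  intros Hd. set (y := Rmin 1 d).
  assert (Hy : 0 < y) by (apply Rmin_glb_lt; lra).
  assert (Hy1 : y <= 1) by apply Rmin_l. assert (Hy2 : y <= d) by apply Rmin_r.
  assert (P2 := PI2_1).
  exists y. split; [exact Hy|]. intros p q H. unfold sph_dist in H.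
  apply Rnot_le_lt. intros K.
  destruct (Rle_lt_dec (half_chord p q) 1) as [C1|C1].
  - assert (B := asin_bound (half_chord p q)). assert (E : sin (asin (half_chord p q)) = half_chord p q).
    { apply sin_asin. assert (X := half_chord_ge_0 p q). lra. }
    assert (half_chord p q <= asin (half_chord p q)).
    { rewrite <- E at 1. destruct (Rle_lt_dec (asin (half_chord p q)) 0) as [N|N].
      - assert (sin (asin (half_chord p q)) <= sin 0).
        { apply sin_incr_1; lra. }
        rewrite sin_0 in H0. rewrite E in H0. lra.
      - apply Rlt_le, sin_lt_x. exact N. }
    lra.
  (* Beyond 1, [asin] takes the default value [PI / 2], already too large for [H]. *)
  - unfold asin in H. destruct (Rle_dec (half_chord p q) (-1)); [lra|].
    destruct (Rle_dec 1 (half_chord p q)); lra.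
Qed.

(** Near a bounded set the chordal metric controls the Euclidean one. With [t = |z - w|] one has
    [t <= d (1 + M + t) (1 + M)], and [d (1 + M) <= 1/2] absorbs the [t] on the right. *)
Lemma half_chord_Fin_close (x : sphere) (w : C) (M d : R) :
  Cmod w <= M -> 0 < d -> d * (1 + M) <= / 2 -> half_chord x (Fin w) < d ->
  exists z, x = Fin z /\ Cmod (z - w) <= 2 * d * (1 + M) ^ 2.
Proof.
  intros HM Hd HdM H. assert (Hw := Cmod_ge_0 w).
  destruct (sqrt_1_sq_bounds _ Hw) as [B1 [B2 B3]].
  destruct x as [z|].
  - exists z. split; [reflexivity|]. unfold half_chord in H.
    destruct (sqrt_1_sq_bounds _ (Cmod_ge_0 z)) as [A1 [A2 A3]].
    apply Rlt_div_l in H; [|nra].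
    set (t := Cmod (z - w)) in *. assert (Ht : 0 <= t) by apply Cmod_ge_0.
    assert (Hz : Cmod z <= M + t).
    { assert (X := Cmod_triangle (z - w) w). replace (z - w + w)%C with z in X by ring. unfold t. lra. }
    assert (K : sqrt (1 + Cmod z ^ 2) * sqrt (1 + Cmod w ^ 2) <= (1 + M + t) * (1 + M)).
    { apply Rmult_le_compat; lra. }
    assert (K2 : t <= d * ((1 + M + t) * (1 + M))).
    { apply Rlt_le. eapply Rlt_le_trans; [exact H|]. apply Rmult_le_compat_l; lra. }
    assert (K3 : d * (1 + M) * t <= / 2 * t) by (apply Rmult_le_compat_r; lra).
    nra.
  - exfalso. unfold half_chord in H.
    assert (H1 : / (1 + M) <= / sqrt (1 + Cmod w ^ 2)) by (apply Rinv_le_contravar; lra).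
    assert (H2 : / (1 + M) < d) by lra.
    apply Rmult_lt_compat_r with (r := 1 + M) in H2; [|lra]. rewrite Rinv_l in H2; lra.
Qed.

(** Inversion, an isometry of the sphere. It turns convergence near [Inf] into convergence of
    reciprocals near 0, where Euclidean estimates apply. *)
Definition sinv (p : sphere) : sphere :=
  match p with
  | Inf => Fin (RtoC 0)
  | Fin z => if excluded_middle_informative (z = RtoC 0) then Inf else Fin (/ z)%C
  end.

Lemma sqrt_inv_sq (x : R) : 0 < x -> sqrt (1 + (/ x) ^ 2) = sqrt (1 + x ^ 2) / x.
Proof.
  intros Hx. rewrite <- (sqrt_pow2 x) at 3 by lra. rewrite <- sqrt_div_alt by (apply pow_lt; lra).
  f_equal. field. lra.
Qed.

Lemma sinv_half_chord (p q : sphere) : half_chord (sinv p) (sinv q) = half_chord p q.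
Proof.
  assert (S1 : forall z, 0 < sqrt (1 + Cmod z ^ 2)).
  { intros z. destruct (sqrt_1_sq_bounds _ (Cmod_ge_0 z)) as [A _]. lra. }
  assert (H1 : forall z, half_chord (sinv (Fin z)) (sinv Inf) = half_chord (Fin z) Inf).
  { intros z. unfold sinv. destruct (excluded_middle_informative (z = RtoC 0)) as [->|Hz]; unfold half_chord.
    - reflexivity.
    - assert (Hz' := proj1 (Cmod_gt_0 z) Hz).
      replace (/ z - 0)%C with (/ z)%C by ring. rewrite Cmod_inv by exact Hz. rewrite Cmod_0.
      rewrite sqrt_inv_sq by exact Hz'. replace (1 + 0 ^ 2) with 1 by ring. rewrite sqrt_1.
      specialize (S1 z). field. lra. }
  assert (Sym : forall a b, half_chord a b = half_chord b a).
  { intros [a|] [b|]; unfold half_chord; try reflexivity. rewrite Cmod_minus_sym. f_equal. ring. }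
  destruct p as [z|], q as [w|].
  - unfold sinv. destruct (excluded_middle_informative (z = RtoC 0)) as [->|Hz];
    destruct (excluded_middle_informative (w = RtoC 0)) as [->|Hw].
    + now rewrite !half_chord_diag.
    + rewrite Sym, (Sym (Fin 0)). assert (Hw' := proj1 (Cmod_gt_0 w) Hw). unfold half_chord.
      rewrite Cmod_inv, sqrt_inv_sq by assumption. replace (w - 0)%C with w by ring. rewrite Cmod_0.
      replace (1 + 0 ^ 2) with 1 by ring. rewrite sqrt_1. specialize (S1 w). field. lra.
    + assert (Hz' := proj1 (Cmod_gt_0 z) Hz). unfold half_chord.
      rewrite Cmod_inv, sqrt_inv_sq by assumption. replace (z - 0)%C with z by ring. rewrite Cmod_0.
      replace (1 + 0 ^ 2) with 1 by ring. rewrite sqrt_1. specialize (S1 z). field. lra.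
    + assert (Hz' := proj1 (Cmod_gt_0 z) Hz). assert (Hw' := proj1 (Cmod_gt_0 w) Hw). unfold half_chord.
      rewrite !Cmod_inv, !sqrt_inv_sq by assumption.
      replace (/ z - / w)%C with ((w - z) / (z * w))%C by (field; auto).
      rewrite Cmod_div by now apply Cmult_neq_0. rewrite Cmod_mult, (Cmod_minus_sym w z).
      assert (A := S1 z). assert (B := S1 w). field. repeat split; lra.
  - apply H1.
  - rewrite Sym, H1. apply Sym.
  - now rewrite !half_chord_diag.
Qed.

Lemma locally'_Cmod (z : C) (P : C -> Prop) :
  @locally' C_UniformSpace z P <->
  exists r, 0 < r /\ forall w, w <> z -> Cmod (w - z) < r -> P w.
Proof.
  unfold locally', within. rewrite locally_Cmod. split; intros [r [Hr H]]; exists r; split; auto.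
Qed.

Lemma is_sph_lim_half_chord (f : C -> sphere) (z : C) (p : sphere) :
  is_sph_lim f z p <-> forall d, 0 < d -> exists r, 0 < r /\
    forall w, w <> z -> Cmod (w - z) < r -> half_chord (f w) p < d.
Proof.
  split.
  - intros H d Hd. destruct (half_chord_small d Hd) as [e [He K]].
    specialize (H e He). apply locally'_Cmod in H. destruct H as [r [Hr H]].
    exists r. split; auto.
  - intros H e He. apply locally'_Cmod. destruct (sph_dist_small e He) as [d [Hd K]].
    destruct (H d Hd) as [r [Hr H']]. exists r. split; auto.
Qed.

Lemma punctured_point (z : C) (r : R) : 0 < r -> exists w, w <> z /\ Cmod (w - z) < r.
Proof.
  intros Hr. exists (z + RtoC (r / 2))%C.
  replace (z + RtoC (r / 2) - z)%C with (RtoC (r / 2)) by ring.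
  rewrite Cmod_R, Rabs_right by lra. split; [|lra].
  intros E. assert (E' : RtoC (r / 2) = RtoC 0).
  { replace (RtoC (r / 2)) with (z + RtoC (r / 2) - z)%C by ring. rewrite E. ring. }
  injection E'. lra.
Qed.

Lemma half_chord_Inf_large (z : C) (K : R) : 0 <= K -> half_chord (Fin z) Inf < / (1 + K) -> K < Cmod z.
Proof.
  intros HK H. unfold half_chord in H.
  destruct (sqrt_1_sq_bounds _ (Cmod_ge_0 z)) as [A1 [A2 A3]].
  apply Rnot_le_lt. intros L.
  assert (/ (1 + K) <= / sqrt (1 + Cmod z ^ 2)) by (apply Rinv_le_contravar; lra). lra.
Qed.

Lemma half_chord_Inf_small (z : C) (d : R) : 0 < d -> / d < Cmod z -> half_chord (Fin z) Inf < d.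
Proof.
  intros Hd H. unfold half_chord.
  destruct (sqrt_1_sq_bounds _ (Cmod_ge_0 z)) as [A1 [A2 A3]].
  assert (0 < / d) by now apply Rinv_0_lt_compat.
  rewrite <- (Rinv_inv d). apply Rinv_lt_contravar; [|lra]. apply Rmult_lt_0_compat; lra.
Qed.

(** Takes the place of the triangle inequality for the chordal metric: this separation is what
    uniqueness of spherical limits rests on. *)
Lemma sph_points_separated (p q : sphere) :
  (forall d, 0 < d -> exists x, half_chord x p < d /\ half_chord x q < d) -> p = q.
Proof.
  intros H.
  assert (FI : forall a, ~ (forall d, 0 < d -> exists x, half_chord x (Fin a) < d /\ half_chord x Inf < d)).
  { intros a K. assert (Ha := Cmod_ge_0 a). set (M := Cmod a) in *.
    assert (H1 : 0 < / (2 * (1 + M) ^ 2)).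
    { apply Rinv_0_lt_compat. assert (0 < (1 + M) ^ 2) by (apply pow_lt; lra). lra. }
    destruct (K (Rmin (/ (2 * (1 + M) ^ 2)) (/ (1 + (M + 1))))) as [x [X1 X2]].
    { apply Rmin_glb_lt; [exact H1|]. apply Rinv_0_lt_compat. lra. }
    assert (A := Rmin_l (/ (2 * (1 + M) ^ 2)) (/ (1 + (M + 1)))).
    assert (B := Rmin_r (/ (2 * (1 + M) ^ 2)) (/ (1 + (M + 1)))).
    destruct (half_chord_Fin_close x a M (/ (2 * (1 + M) ^ 2))) as [z [-> Hz]]; try lra.
    - unfold M. lra.
    - replace (/ (2 * (1 + M) ^ 2) * (1 + M)) with (/ 2 * / (1 + M)) by (field; lra).
      assert (/ (1 + M) <= / 1) by (apply Rinv_le_contravar; lra). rewrite Rinv_1 in H0. lra.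
    - replace (2 * / (2 * (1 + M) ^ 2) * (1 + M) ^ 2) with 1 in Hz by (field; lra).
      assert (M + 1 < Cmod z) by (apply half_chord_Inf_large; lra).
      assert (X := Cmod_minus_ge z a). fold M in X. lra. }
  destruct p as [a|], q as [b|].
  - destruct (classic (a = b)) as [->|Hab]; [reflexivity|exfalso].
    assert (Hd := Cmod_minus_gt_0 a b Hab).
    set (M := Rmax (Cmod a) (Cmod b)). assert (Ha := Cmod_ge_0 a).
    assert (M1 := Rmax_l (Cmod a) (Cmod b)). assert (M2 := Rmax_r (Cmod a) (Cmod b)). fold M in M1, M2.
    assert (P0 : 0 < (1 + M) ^ 2) by (apply pow_lt; lra).
    set (d := Rmin (/ (2 * (1 + M))) (Cmod (a - b) / (8 * (1 + M) ^ 2))).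
    assert (Hd0 : 0 < d).
    { apply Rmin_glb_lt; [apply Rinv_0_lt_compat; lra|apply Rdiv_lt_0_compat; lra]. }
    assert (D1 : d * (1 + M) <= / 2).
    { apply Rle_trans with (/ (2 * (1 + M)) * (1 + M)).
      - apply Rmult_le_compat_r; [lra|apply Rmin_l].
      - right. field. lra. }
    assert (D2 : 2 * d * (1 + M) ^ 2 <= Cmod (a - b) / 4).
    { apply Rle_trans with (2 * (Cmod (a - b) / (8 * (1 + M) ^ 2)) * (1 + M) ^ 2).
      - apply Rmult_le_compat_r; [lra|]. apply Rmult_le_compat_l; [lra|apply Rmin_r].
      - right. field. lra. }
    destruct (H d Hd0) as [x [X1 X2]].
    destruct (half_chord_Fin_close x a M d M1 Hd0 D1 X1) as [z [E1 Z1]].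
    destruct (half_chord_Fin_close x b M d M2 Hd0 D1 X2) as [z' [E2 Z2]].
    rewrite E1 in E2. injection E2 as <-.
    assert (T := Cmod_dist_triangle a z b). rewrite (Cmod_minus_sym a z) in T. lra.
  - exfalso. exact (FI a H).
  - exfalso. apply (FI b). intros d Hd. destruct (H d Hd) as [x [X1 X2]]. now exists x.
  - reflexivity.
Qed.

Lemma is_sph_lim_unique (f : C -> sphere) (z : C) (p q : sphere) :
  is_sph_lim f z p -> is_sph_lim f z q -> p = q.
Proof.
  rewrite !is_sph_lim_half_chord. intros Hp Hq. apply sph_points_separated.
  intros d Hd. destruct (Hp d Hd) as [r1 [R1 H1]]. destruct (Hq d Hd) as [r2 [R2 H2]].
  destruct (punctured_point z (Rmin r1 r2)) as [w [W1 W2]]; [now apply Rmin_glb_lt|].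
  exists (f w). assert (A := Rmin_l r1 r2). assert (B := Rmin_r r1 r2).
  split; [apply H1|apply H2]; auto; lra.
Qed.

Lemma sph_lim_eq (f : C -> sphere) (z : C) (p : sphere) : is_sph_lim f z p -> sph_lim f z = p.
Proof.
  intros H. apply (is_sph_lim_unique f z); [|exact H].
  unfold sph_lim. apply epsilon_spec. now exists p.
Qed.

Lemma is_sph_lim_ccont (f : C -> sphere) (h : C -> C) (z : C) (r : R) :
  0 < r -> (forall w, w <> z -> Cmod (w - z) < r -> f w = Fin (h w)) -> ccont h z ->
  is_sph_lim f z (Fin (h z)).
Proof.
  intros Hr E Hc. apply is_sph_lim_half_chord. intros d Hd. destruct (Hc d Hd) as [r' [Hr' H]].
  exists (Rmin r r'). split; [now apply Rmin_glb_lt|]. intros w Hwz Hw.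
  assert (A := Rmin_l r r'). assert (B := Rmin_r r r').
  rewrite E by (auto; lra). eapply Rle_lt_trans; [apply half_chord_le_Cmod|]. apply H. lra.
Qed.

(** * Local form of meromorphic functions *)

Definition mero_at (f : C -> sphere) (p : C) : Prop := holomorphic_at f p \/ pole_at f p.

Definition punctured (p : C) (r : R) (w : C) : Prop := w <> p /\ Cmod (w - p) < r.

Definition regular_on (A : C -> Prop) (f : C -> sphere) : Prop :=
  forall w, A w -> f w <> Inf /\ exists l, is_cd (fun v => fin (f v)) w l.

Lemma Fin_fin (x : sphere) : x <> Inf -> x = Fin (fin x).
Proof. destruct x; [reflexivity|congruence]. Qed.

Lemma holomorphic_at_iff (f : C -> sphere) (p : C) :
  holomorphic_at f p <-> exists r, 0 < r /\ regular_on (fun w => Cmod (w - p) < r) f.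
Proof.
  unfold holomorphic_at. rewrite locally_Cmod. unfold regular_on, regular_pt.
  split; intros [r [Hr H]]; exists r; (split; [exact Hr|]); intros w Hw; destruct (H w Hw) as [H1 H2];
  (split; [exact H1|]); now apply C_differentiable_iff.
Qed.

Lemma locally'_regular (f : C -> sphere) (p : C) :
  @locally' C_UniformSpace p (regular_pt f) <-> exists r, 0 < r /\ regular_on (punctured p r) f.
Proof.
  rewrite locally'_Cmod. unfold regular_on, regular_pt, punctured.
  split; intros [r [Hr H]]; exists r; (split; [exact Hr|]).
  - intros w [Hw1 Hw2]. destruct (H w Hw1 Hw2) as [H1 H2]. split; [exact H1|]. now apply C_differentiable_iff.
  - intros w Hw1 Hw2. destruct (H w (conj Hw1 Hw2)) as [H1 H2]. split; [exact H1|]. now apply C_differentiable_iff.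
Qed.

Lemma punctured_mono (p : C) (r r' : R) (w : C) : r <= r' -> punctured p r w -> punctured p r' w.
Proof. intros H [H1 H2]. split; [exact H1|lra]. Qed.

Lemma nonzero_near (u : C -> C) (p : C) (r : R) : 0 < r -> ccont u p -> u p <> RtoC 0 ->
  exists r', 0 < r' /\ r' <= r /\ forall w, Cmod (w - p) < r' -> u w <> RtoC 0.
Proof.
  intros Hr Hc Hp. assert (Hp' := proj1 (Cmod_gt_0 _) Hp).
  destruct (Hc _ Hp') as [d [Hd H]].
  exists (Rmin r d). split; [now apply Rmin_glb_lt|]. split; [apply Rmin_l|].
  intros w Hw E. assert (A := Rmin_r r d). specialize (H w ltac:(lra)).
  rewrite E in H. replace (0 - u p)%C with (- u p)%C in H by ring. rewrite Cmod_opp in H. lra.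
Qed.

Lemma Cmod_center (p : C) (r : R) : 0 < r -> Cmod (p - p) < r.
Proof. intros H. now rewrite Cmod_minus_diag. Qed.

Lemma lim_pole (f : C -> sphere) (u : C -> C) (p : C) (k : nat) (r : R) :
  0 < r -> (1 <= k)%nat -> ccont u p -> u p <> RtoC 0 ->
  (forall w, punctured p r w -> f w = Fin (u w / (w - p) ^ k)%C) ->
  is_sph_lim f p Inf.
Proof.
  intros Hr Hk Hu Hp E. assert (Hp' := proj1 (Cmod_gt_0 _) Hp).
  apply is_sph_lim_half_chord. intros d Hd.
  set (m := Cmod (u p)) in *.
  destruct (Hu (m / 2)) as [e [He K]]; [lra|].
  assert (Hid : 0 < / d) by now apply Rinv_0_lt_compat.
  set (s := Rmin (Rmin r e) (Rmin 1 (m / 2 * d))).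
  assert (Hs : 0 < s).
  { unfold s. assert (0 < m / 2 * d) by (apply Rmult_lt_0_compat; lra). repeat apply Rmin_glb_lt; lra. }
  assert (S1 : s <= r) by (unfold s; eapply Rle_trans; [apply Rmin_l|apply Rmin_l]).
  assert (S2 : s <= e) by (unfold s; eapply Rle_trans; [apply Rmin_l|apply Rmin_r]).
  assert (S3 : s <= 1) by (unfold s; eapply Rle_trans; [apply Rmin_r|apply Rmin_l]).
  assert (S4 : s <= m / 2 * d) by (unfold s; eapply Rle_trans; [apply Rmin_r|apply Rmin_r]).
  exists s. split; [exact Hs|]. intros w Hwp Hw.
  rewrite E by (split; [exact Hwp|lra]).
  apply half_chord_Inf_small; [exact Hd|].
  assert (N := Cminus_neq_0 _ _ Hwp).
  assert (Hw0 := proj1 (Cmod_gt_0 _) N). set (t := Cmod (w - p)) in *.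
  rewrite Cmod_div by now apply Cpow_nz. rewrite Cmod_pow. fold t.
  assert (Huw : m / 2 < Cmod (u w)).
  { assert (X : Cmod (u w - u p) < m / 2) by (apply K; fold t; lra).
    assert (Y := Cmod_minus_ge (u p) (u w)).
    rewrite Cmod_minus_sym in Y. fold m in Y. lra. }
  assert (Htk : 0 < t ^ k) by now apply pow_lt.
  assert (Htk2 : t ^ k <= t).
  { destruct k as [|k]; [lia|]. simpl.
    assert (t ^ k <= 1). { rewrite <- (pow1 k). apply pow_incr. lra. }
    assert (0 <= t ^ k) by (apply pow_le; lra). nra. }
  apply (Rlt_div_r (/ d)); [exact Htk|].
  assert (T : t < m / 2 * d) by lra.
  apply Rmult_lt_compat_l with (r := / d) in T; [|exact Hid].
  replace (/ d * (m / 2 * d)) with (m / 2) in T by (field; lra).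
  assert (/ d * t ^ k <= / d * t) by (apply Rmult_le_compat_l; lra). lra.
Qed.

(** Near [p] one has [|f| > 1], so [1 / f] is bounded and extends holomorphically. The extension
    vanishes at [p] only, and the order of that zero, finite by [zero_order], is the order of the
    pole. *)
Lemma pole_form (f : C -> sphere) (p : C) : pole_at f p ->
  exists r k u, 0 < r /\ (1 <= k)%nat /\ holB p r u /\
    (forall w, Cmod (w - p) < r -> u w <> RtoC 0) /\ f p = Inf /\
    forall w, punctured p r w -> f w = Fin (u w / (w - p) ^ k)%C.
Proof.
  intros [Hp [Hreg Hlim]]. apply locally'_regular in Hreg. destruct Hreg as [r0 [Hr0 Hreg]].
  rewrite is_sph_lim_half_chord in Hlim.
  destruct (Hlim (/ (1 + 1))) as [r1 [Hr1 Hl]]; [lra|].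
  set (r := Rmin r0 r1). assert (Hr : 0 < r) by now apply Rmin_glb_lt.
  assert (R1 : r <= r0) by apply Rmin_l. assert (R2 : r <= r1) by apply Rmin_r.
  assert (Hf : forall w, punctured p r w -> f w = Fin (fin (f w)) /\ 1 < Cmod (fin (f w)) /\ exists l, is_cd (fun v => fin (f v)) w l).
  { intros w Hw. destruct (Hreg w (punctured_mono _ _ _ _ R1 Hw)) as [H1 H2]. apply Fin_fin in H1.
    split; [exact H1|]. split; [|exact H2]. destruct Hw as [Hw1 Hw2].
    specialize (Hl w Hw1 ltac:(lra)). rewrite H1 in Hl. apply half_chord_Inf_large; lra. }
  destruct (removable_singularity (fun w => / fin (f w))%C p r 1 Hr) as [h [Hh Eh]].
  - intros w Hw1 Hw2. destruct (Hf w (conj Hw1 Hw2)) as [_ [H2 [l H3]]].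
    eexists. apply (is_cd_inv (fun v => fin (f v))); [exact H3|]. apply Cmod_gt_0. lra.
  - intros w Hw1 Hw2. destruct (Hf w (conj Hw1 Hw2)) as [_ [H2 _]].
    rewrite Cmod_inv by (apply Cmod_gt_0; lra). rewrite <- Rinv_1. apply Rinv_le_contravar; lra.
  - assert (Hh0 : forall w, punctured p r w -> h w <> RtoC 0).
    { intros w Hw E. destruct (Hf w Hw) as [_ [H2 _]]. destruct Hw as [Hw1 Hw2].
      rewrite <- (Eh w Hw1 Hw2) in E. apply (f_equal Cmod) in E. rewrite Cmod_0, Cmod_inv in E by (apply Cmod_gt_0; lra).
      assert (0 < / Cmod (fin (f w))) by (apply Rinv_0_lt_compat; lra). lra. }
    assert (Hhp : h p = RtoC 0).
    { apply NNPP. intros N. assert (N' := proj1 (Cmod_gt_0 _) N).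
      destruct (holB_ccont p r h p Hh (Cmod_center p r Hr) (Cmod (h p) / 2)) as [d [Hd K]]; [lra|].
      destruct (Hlim (/ (1 + 2 / Cmod (h p)))) as [r2 [Hr2 Hl2]].
      { apply Rinv_0_lt_compat. assert (0 < 2 / Cmod (h p)) by (apply Rdiv_lt_0_compat; lra). lra. }
      destruct (punctured_point p (Rmin r (Rmin d r2))) as [w [W1 W2]]; [repeat apply Rmin_glb_lt; lra|].
      assert (A1 := Rmin_l r (Rmin d r2)). assert (A2 := Rmin_r r (Rmin d r2)).
      assert (A3 := Rmin_l d r2). assert (A4 := Rmin_r d r2).
      assert (Hw : punctured p r w) by (split; [exact W1|lra]).
      destruct (Hf w Hw) as [H1 [H2 _]]. specialize (Hl2 w W1 ltac:(lra)). rewrite H1 in Hl2.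
      apply half_chord_Inf_large in Hl2; [|apply Rlt_le, Rdiv_lt_0_compat; lra].
      specialize (K w ltac:(lra)). rewrite <- (Eh w W1 ltac:(lra)) in K.
      assert (Y := Cmod_minus_ge (h p) (/ fin (f w))%C). rewrite Cmod_minus_sym in Y.
      rewrite Cmod_inv in Y by (apply Cmod_gt_0; lra).
      assert (Z : / Cmod (fin (f w)) < / (2 / Cmod (h p))).
      { apply Rinv_lt_contravar; [|exact Hl2]. apply Rmult_lt_0_compat; [|lra]. apply Rdiv_lt_0_compat; lra. }
      replace (/ (2 / Cmod (h p))) with (Cmod (h p) / 2) in Z by (field; lra). lra. }
    destruct (zero_order h p r Hr Hh) as [[s [Hs Z]]|[k [v [Hv [Hvp Ev]]]]].
    { exfalso. destruct (punctured_point p (Rmin r s)) as [w [W1 W2]]; [now apply Rmin_glb_lt|].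
      assert (A1 := Rmin_l r s). assert (A2 := Rmin_r r s).
      apply (Hh0 w); [split; [exact W1|lra]|]. apply Z. lra. }
    assert (Hk : (1 <= k)%nat).
    { destruct k; [|lia]. exfalso. apply Hvp. specialize (Ev p (Cmod_center p r Hr)). simpl in Ev.
      rewrite Hhp in Ev. rewrite Cmult_1_l in Ev. auto. }
    destruct (nonzero_near v p r Hr) as [r' [Hr' [Hrr Hv0]]]; [|exact Hvp|].
    { eapply holB_ccont; [exact Hv|]. now apply Cmod_center. }
    exists r', k, (fun w => 1 / v w)%C. split; [exact Hr'|]. split; [exact Hk|]. split.
    { apply holB_div; [apply holB_const| |exact Hv0]. intros w Hw. apply Hv. lra. }
    split.
    { intros w Hw E. assert (N := Hv0 w Hw).
      assert (X : (v w * (1 / v w))%C = RtoC 1) by (field; exact N). rewrite E, Cmult_0_r in X.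
      injection X. lra. }
    split; [exact Hp|].
    intros w [W1 W2]. assert (N := Hv0 w W2). assert (N2 := Cminus_neq_0 _ _ W1).
    destruct (Hf w) as [H1 [H2 _]]; [split; [exact W1|lra]|]. rewrite H1. f_equal.
    assert (Y : (/ fin (f w) = (w - p) ^ k * v w)%C).
    { rewrite (Eh w W1) by lra. apply Ev. lra. }
    assert (N3 : fin (f w) <> RtoC 0) by (apply Cmod_gt_0; lra).
    assert (N4 : ((w - p) ^ k)%C <> RtoC 0) by now apply Cpow_nz.
    replace (fin (f w)) with (/ (/ fin (f w)))%C by (field; exact N3).
    rewrite Y. field. auto.
Qed.

Lemma pole_of_form (f : C -> sphere) (u : C -> C) (p : C) (k : nat) (r : R) :
  0 < r -> (1 <= k)%nat -> holB p r u -> u p <> RtoC 0 -> f p = Inf ->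
  (forall w, punctured p r w -> f w = Fin (u w / (w - p) ^ k)%C) -> pole_at f p.
Proof.
  intros Hr Hk Hu Hup Hp E. split; [exact Hp|]. split.
  - apply locally'_regular. exists r. split; [exact Hr|]. intros w Hw.
    rewrite (E w Hw). split; [discriminate|]. destruct Hw as [W1 W2].
    destruct (Hu w W2) as [l Hl]. destruct (is_cd_pow_n w p k) as [l' Hl'].
    eexists. eapply (is_cd_ext_loc (fun v => u v / (v - p) ^ k)%C _ w _ (Rmin (Cmod (w - p)) (r - Cmod (w - p)))).
    + apply Rmin_glb_lt; [now apply Cmod_minus_gt_0|lra].
    + intros v Hv. rewrite E; [reflexivity|].
      assert (A1 := Rmin_l (Cmod (w - p)) (r - Cmod (w - p))).
      assert (A2 := Rmin_r (Cmod (w - p)) (r - Cmod (w - p))).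
      split.
      * intros ->. rewrite (Cmod_minus_sym p w) in Hv. lra.
      * assert (T := Cmod_dist_triangle v w p). lra.
    + apply is_cd_div; [exact Hl|exact Hl'|]. apply Cpow_nz. now apply Cminus_neq_0.
  - apply (lim_pole f u p k r); auto. eapply holB_ccont; [exact Hu|now apply Cmod_center].
Qed.

Lemma holomorphic_of_form (f : C -> sphere) (h : C -> C) (p : C) (r : R) :
  0 < r -> holB p r h -> (forall w, Cmod (w - p) < r -> f w = Fin (h w)) -> holomorphic_at f p.
Proof.
  intros Hr Hh E. apply holomorphic_at_iff. exists r. split; [exact Hr|].
  intros w Hw. rewrite (E w Hw). split; [discriminate|].
  apply (holB_ext p r h); [|exact Hh|exact Hw]. intros v Hv. now rewrite E.
Qed.

Definition vanishes_near (q : C -> C) (p : C) : Prop :=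
  exists r, 0 < r /\ forall w, punctured p r w -> q w = RtoC 0.

(** The order at [p] is [j - k]. Keeping two natural exponents treats zeros and poles alike and
    makes quotients a matter of adding exponents. *)
Definition order_form (q : C -> C) (p : C) (r : R) (j k : nat) (u : C -> C) : Prop :=
  0 < r /\ holB p r u /\ (forall w, Cmod (w - p) < r -> u w <> RtoC 0) /\
  forall w, punctured p r w -> q w = ((w - p) ^ j * u w / (w - p) ^ k)%C.

Lemma order_form_mono q p r r' j k u :
  0 < r' -> r' <= r -> order_form q p r j k u -> order_form q p r' j k u.
Proof.
  intros Hr' Hrr [Hr [Hu [Hu0 E]]]. split; [exact Hr'|]. split; [|split].
  - intros w Hw. apply Hu. lra.
  - intros w Hw. apply Hu0. lra.
  - intros w Hw. apply E. eapply punctured_mono; eassumption.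
Qed.

Lemma order_form_neq_0 q p r j k u w :
  order_form q p r j k u -> punctured p r w -> q w <> RtoC 0.
Proof.
  intros [Hr [Hu [Hu0 E]]] Hw. rewrite E by exact Hw. destruct Hw as [W1 W2].
  assert (N := Cminus_neq_0 _ _ W1).
  apply Cmult_neq_0.
  - apply Cmult_neq_0; [now apply Cpow_nz|now apply Hu0].
  - intros X. assert (Y : ((w - p) ^ k * / (w - p) ^ k)%C = RtoC 1) by (apply Cinv_r; now apply Cpow_nz).
    rewrite X, Cmult_0_r in Y. injection Y. lra.
Qed.

Lemma holomorphic_order (f : C -> sphere) (p : C) : holomorphic_at f p ->
  ~ vanishes_near (fun w => fin (f w)) p ->
  exists r j u, 0 < r /\ holB p r u /\ (forall w, Cmod (w - p) < r -> u w <> RtoC 0) /\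
    forall w, Cmod (w - p) < r -> f w = Fin ((w - p) ^ j * u w)%C.
Proof.
  intros H Hv. apply holomorphic_at_iff in H. destruct H as [r [Hr H]].
  assert (Hh : holB p r (fun w => fin (f w))) by (intros w Hw; apply (H w Hw)).
  destruct (zero_order _ p r Hr Hh) as [[s [Hs Z]]|[j [u [Hu [Hup Eu]]]]].
  - exfalso. apply Hv. exists s. split; [exact Hs|]. intros w [_ W]. auto.
  - destruct (nonzero_near u p r Hr) as [r' [Hr' [Hrr Hu0]]]; [|exact Hup|].
    { eapply holB_ccont; [exact Hu|]. now apply Cmod_center. }
    exists r', j, u. split; [exact Hr'|]. split; [|split].
    + intros w Hw. apply Hu. lra.
    + exact Hu0.
    + intros w Hw. rewrite <- Eu by lra. apply Fin_fin. apply (H w). lra.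
Qed.

Lemma mero_at_order (f : C -> sphere) (p : C) : mero_at f p ->
  vanishes_near (fun w => fin (f w)) p \/
  exists r j k u, order_form (fun w => fin (f w)) p r j k u.
Proof.
  intros Hf. destruct (classic (vanishes_near (fun w => fin (f w)) p)) as [Hv|Hv]; [now left|right].
  destruct Hf as [Hf|Hf].
  - destruct (holomorphic_order f p Hf Hv) as [r [j [u [Hr [Hu [Hu0 E]]]]]].
    exists r, j, 0%nat, u. split; [exact Hr|]. split; [exact Hu|]. split; [exact Hu0|].
    intros w [W1 W2]. rewrite E by exact W2. simpl. field.
  - destruct (pole_form f p Hf) as [r [k [u [Hr [Hk [Hu [Hu0 [Hp E]]]]]]]].
    exists r, 0%nat, k, u. split; [exact Hr|]. split; [exact Hu|]. split; [exact Hu0|].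
    intros w Hw. rewrite E by exact Hw. simpl. unfold Cdiv. ring.
Qed.

Lemma mero_at_regular (f : C -> sphere) (p : C) : mero_at f p ->
  exists r, 0 < r /\ regular_on (punctured p r) f.
Proof.
  intros [Hf|Hf].
  - apply holomorphic_at_iff in Hf. destruct Hf as [r [Hr H]]. exists r. split; [exact Hr|].
    intros w [_ Hw]. now apply H.
  - now apply locally'_regular, Hf.
Qed.

Lemma order_form_div q1 q2 p r j1 k1 u1 j2 k2 u2 :
  order_form q1 p r j1 k1 u1 -> order_form q2 p r j2 k2 u2 ->
  order_form (fun w => q1 w / q2 w)%C p r (j1 + k2) (k1 + j2) (fun w => u1 w / u2 w)%C.
Proof.
  intros H1 H2. assert (Hq2 := fun w => order_form_neq_0 q2 p r j2 k2 u2 w H2).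
  destruct H1 as [Hr [Hu1 [N1 E1]]]. destruct H2 as [_ [Hu2 [N2 E2]]].
  split; [exact Hr|]. split; [now apply holB_div|]. split.
  - intros w Hw X. apply (N1 w Hw). replace (u1 w) with (u1 w / u2 w * u2 w)%C by (field; auto).
    rewrite X. ring.
  - intros w Hw. specialize (Hq2 w Hw). rewrite E2 in Hq2 by exact Hw. rewrite E1, E2 by exact Hw. destruct Hw as [W1 W2].
    assert (N := Cminus_neq_0 _ _ W1). assert (N' := N2 w W2).
    rewrite !Cpow_add_r. field. repeat split; auto; now apply Cpow_nz.
Qed.

(** Designed for [mquot]: off [p] the function is the pointwise quotient [q], whereas its value at
    [p] is accessible only as a punctured limit. The sign of [j - k] decides between a holomorphic
    extension and a pole. *)
Lemma mero_at_of_order (F : C -> sphere) (q : C -> C) (p : C) (r : R) :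
  0 < r -> (forall w, punctured p r w -> F w = Fin (q w)) ->
  (forall l, is_sph_lim (fun w => Fin (q w)) p l -> F p = l) ->
  vanishes_near q p \/ (exists s j k u, order_form q p s j k u) ->
  mero_at F p.
Proof.
  intros Hr EF Hlim [[s [Hs Z]]|[s [j [k [u H]]]]].
  - left. set (r' := Rmin r s). assert (Hr' : 0 < r') by now apply Rmin_glb_lt.
    assert (A1 : r' <= r) by apply Rmin_l. assert (A2 : r' <= s) by apply Rmin_r.
    assert (Hp : F p = Fin (RtoC 0)).
    { apply Hlim. apply (is_sph_lim_ccont _ (fun _ => RtoC 0) p s Hs).
      - intros w W1 W2. now rewrite Z.
      - eapply is_cd_ccont. apply is_cd_const. }
    apply (holomorphic_of_form F (fun _ => RtoC 0) p r' Hr').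
    + apply holB_const.
    + intros w Hw. destruct (classic (w = p)) as [->|Hwp]; [exact Hp|].
      rewrite EF by (split; [exact Hwp|lra]). f_equal. apply Z. split; [exact Hwp|lra].
  - assert (Hs := proj1 H).
    set (r' := Rmin r s). assert (Hr' : 0 < r') by now apply Rmin_glb_lt.
    assert (A1 : r' <= r) by apply Rmin_l. assert (A2 : r' <= s) by apply Rmin_r.
    apply (order_form_mono q p s r' j k u Hr' A2) in H. destruct H as [_ [Hu [Hu0 E]]].
    destruct (Compare_dec.le_lt_dec k j) as [Hkj|Hkj].
    + left. set (h := fun w => ((w - p) ^ (j - k) * u w)%C).
      assert (Hh : holB p r' h) by (apply holB_mult; [apply holB_pow|exact Hu]).
      assert (Eh : forall w, punctured p r' w -> q w = h w).
      { intros w Hw. rewrite E by exact Hw. destruct Hw as [W1 W2]. unfold h.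
        replace j with (k + (j - k))%nat at 1 by lia. rewrite Cpow_add_r. field.
        apply Cpow_nz. now apply Cminus_neq_0. }
      assert (Hp : F p = Fin (h p)).
      { apply Hlim. apply (is_sph_lim_ccont _ h p r' Hr').
        - intros w W1 W2. f_equal. apply Eh. now split.
        - eapply holB_ccont; [exact Hh|]. now apply Cmod_center. }
      apply (holomorphic_of_form F h p r' Hr' Hh).
      intros w Hw. destruct (classic (w = p)) as [->|Hwp]; [exact Hp|].
      rewrite EF by (split; [exact Hwp|lra]). f_equal. apply Eh. now split.
    + right.
      assert (Eh : forall w, punctured p r' w -> q w = (u w / (w - p) ^ (k - j))%C).
      { intros w Hw. rewrite E by exact Hw. destruct Hw as [W1 W2].
        replace k with (j + (k - j))%nat at 1 by lia. rewrite Cpow_add_r. field.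
        split; apply Cpow_nz; now apply Cminus_neq_0. }
      apply (pole_of_form F u p (k - j) r'); auto.
      * lia.
      * apply Hu0. now apply Cmod_center.
      * apply Hlim. apply (lim_pole _ u p (k - j) r'); auto; try lia.
        -- eapply holB_ccont; [exact Hu|]. now apply Cmod_center.
        -- apply Hu0. now apply Cmod_center.
        -- intros w Hw. f_equal. now apply Eh.
      * intros w Hw. rewrite EF; [|eapply punctured_mono; eassumption]. f_equal. now apply Eh.
Qed.

Lemma punctured_open (p w : C) (r : R) : punctured p r w ->
  exists s, 0 < s /\ forall v, Cmod (v - w) < s -> punctured p r v.
Proof.
  intros [W1 W2]. exists (Rmin (Cmod (w - p)) (r - Cmod (w - p))). split.
  - apply Rmin_glb_lt; [now apply Cmod_minus_gt_0|lra].
  - intros v Hv.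
    assert (A1 := Rmin_l (Cmod (w - p)) (r - Cmod (w - p))).
    assert (A2 := Rmin_r (Cmod (w - p)) (r - Cmod (w - p))).
    split.
    + intros ->. rewrite (Cmod_minus_sym p w) in Hv. lra.
    + assert (T := Cmod_dist_triangle v w p). lra.
Qed.

Lemma mquot_regular (f g : C -> sphere) (w l k : C) :
  is_cd (fun v => fin (f v)) w l -> is_cd (fun v => fin (g v)) w k -> fin (g w) <> RtoC 0 ->
  mquot f g w = Fin (fin (f w) / fin (g w))%C.
Proof.
  intros Hf Hg N. unfold mquot. apply sph_lim_eq.
  apply (is_sph_lim_ccont _ (fun v => fin (f v) / fin (g v))%C w 1 Rlt_0_1).
  - reflexivity.
  - eapply is_cd_ccont. apply (is_cd_div (fun v => fin (f v)) (fun v => fin (g v))); eassumption.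
Qed.

Lemma mquot_local (f g : C -> sphere) (p : C) :
  mero_at f p -> mero_at g p -> ~ vanishes_near (fun w => fin (g w)) p ->
  mero_at (mquot f g) p /\ exists r, 0 < r /\ regular_on (punctured p r) f /\ regular_on (punctured p r) g /\
    forall w, punctured p r w -> fin (g w) <> RtoC 0 /\ mquot f g w = Fin (fin (f w) / fin (g w))%C.
Proof.
  intros Hf Hg Hv.
  destruct (mero_at_order g p Hg) as [X|[r1 [j2 [k2 [u2 O2]]]]]; [contradiction|].
  destruct (mero_at_regular f p Hf) as [r2 [Hr2 R2]].
  destruct (mero_at_regular g p Hg) as [r3 [Hr3 R3]].
  assert (Hr1 := proj1 O2).
  set (r := Rmin r1 (Rmin r2 r3)). assert (Hr : 0 < r) by (repeat apply Rmin_glb_lt; lra).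
  assert (A1 : r <= r1) by apply Rmin_l.
  assert (A2 : r <= r2) by (unfold r; eapply Rle_trans; [apply Rmin_r|apply Rmin_l]).
  assert (A3 : r <= r3) by (unfold r; eapply Rle_trans; [apply Rmin_r|apply Rmin_r]).
  assert (K : forall w, punctured p r w -> fin (g w) <> RtoC 0 /\ mquot f g w = Fin (fin (f w) / fin (g w))%C).
  { intros w Hw.
    assert (N : fin (g w) <> RtoC 0).
    { apply (order_form_neq_0 (fun w => fin (g w)) p r1 j2 k2 u2 w O2). eapply punctured_mono; eassumption. }
    split; [exact N|].
    destruct (R2 w (punctured_mono _ _ _ _ A2 Hw)) as [_ [l Hl]].
    destruct (R3 w (punctured_mono _ _ _ _ A3 Hw)) as [_ [k Hk]].
    eapply mquot_regular; eassumption. }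
  split.
  - apply (mero_at_of_order (mquot f g) (fun w => fin (f w) / fin (g w))%C p r Hr).
    + intros w Hw. now apply K.
    + intros l Hl. unfold mquot. now apply sph_lim_eq.
    + destruct (mero_at_order f p Hf) as [[s [Hs Z]]|[s [j1 [k1 [u1 O1]]]]].
      * left. exists s. split; [exact Hs|]. intros w Hw. rewrite Z by exact Hw. unfold Cdiv. ring.
      * right. assert (Hs := proj1 O1).
        exists (Rmin s r1), (j1 + k2)%nat, (k1 + j2)%nat, (fun w => u1 w / u2 w)%C.
        apply (order_form_div (fun w => fin (f w)) (fun w => fin (g w))).
        -- eapply order_form_mono; [|apply Rmin_l|exact O1]. now apply Rmin_glb_lt.
        -- eapply order_form_mono; [|apply Rmin_r|exact O2]. now apply Rmin_glb_lt.
  - exists r. split; [exact Hr|]. split; [|split].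
    + intros w Hw. apply R2. eapply punctured_mono; eassumption.
    + intros w Hw. apply R3. eapply punctured_mono; eassumption.
    + exact K.
Qed.

(** * Logarithmic derivatives and the identity theorem *)

Lemma mderiv_Fin (f : C -> sphere) (h : C -> C) (w l : C) (s : R) :
  0 < s -> (forall v, Cmod (v - w) < s -> f v = Fin (h v)) -> is_cd h w l -> mderiv f w = Fin l.
Proof.
  intros Hs E H. unfold mderiv. rewrite (E w (Cmod_center w s Hs)). f_equal.
  apply C_derive_is_cd. apply (is_cd_ext_loc h _ w l s Hs); [|exact H].
  intros v Hv. now rewrite E.
Qed.

Lemma mderiv_cd (f : C -> sphere) (w l : C) :
  f w <> Inf -> is_cd (fun v => fin (f v)) w l -> mderiv f w = Fin l.
Proof.
  intros N H. unfold mderiv. destruct (f w); [|congruence]. f_equal. now apply C_derive_is_cd.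
Qed.

Lemma mderiv_neq_Inf (f : C -> sphere) (w : C) : mderiv f w <> Inf -> f w <> Inf.
Proof. unfold mderiv. destruct (f w); congruence. Qed.

Lemma regular_mderiv (f : C -> sphere) (p : C) (r : R) :
  regular_on (fun w => Cmod (w - p) < r) f ->
  regular_on (fun w => Cmod (w - p) < r) (mderiv f) /\
  forall w, Cmod (w - p) < r -> is_cd (fun v => fin (f v)) w (fin (mderiv f w)).
Proof.
  intros H.
  assert (D : forall w, Cmod (w - p) < r -> mderiv f w <> Inf /\ is_cd (fun v => fin (f v)) w (fin (mderiv f w))).
  { intros w Hw. destruct (H w Hw) as [N [l Hl]]. rewrite (mderiv_cd f w l N Hl). split; [discriminate|exact Hl]. }
  split.
  - intros w Hw. split; [now apply D|].
    apply (deriv_holB (fun v => fin (f v)) (fun v => fin (mderiv f v)) p r); [|exact Hw].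
    intros v Hv. now apply D.
  - intros w Hw. now apply D.
Qed.

Lemma holomorphic_mderiv (f : C -> sphere) (p : C) :
  holomorphic_at f p -> holomorphic_at (mderiv f) p /\ is_cd (fun v => fin (f v)) p (fin (mderiv f p)).
Proof.
  intros H. apply holomorphic_at_iff in H. destruct H as [r [Hr H]].
  destruct (regular_mderiv f p r H) as [H1 H2]. split.
  - apply holomorphic_at_iff. now exists r.
  - apply H2. now apply Cmod_center.
Qed.

Lemma holB_derive (u : C -> C) (p : C) (r : R) : holB p r u ->
  holB p r (C_derive u) /\ forall w, Cmod (w - p) < r -> is_cd u w (C_derive u w).
Proof.
  intros Hu.
  assert (D : forall w, Cmod (w - p) < r -> is_cd u w (C_derive u w)).
  { intros w Hw. apply C_differentiable_derive, C_differentiable_iff. now apply Hu. }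
  split; [|exact D]. now apply (deriv_holB u).
Qed.

Lemma holB_id (p a : C) (r : R) : holB p r (fun w => w - a)%C.
Proof. intros w _. eexists. apply is_cd_minus; [apply is_cd_id|apply is_cd_const]. Qed.

Lemma mderiv_of_zero_form (g : C -> sphere) (u : C -> C) (p : C) (i : nat) (r : R) :
  holB p r u -> (forall w, Cmod (w - p) < r -> g w = Fin ((w - p) ^ S i * u w)%C) ->
  forall w, Cmod (w - p) < r ->
    mderiv g w = Fin ((w - p) ^ i * (INR (S i) * u w + (w - p) * C_derive u w))%C.
Proof.
  intros Hu E w Hw. destruct (holB_derive u p r Hu) as [_ D].
  apply (mderiv_Fin g (fun w => (w - p) ^ S i * u w)%C w _ (r - Cmod (w - p))); [lra| |].
  - intros v Hv. apply E. assert (T := Cmod_dist_triangle v w p). lra.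
  - eapply is_cd_val; [apply is_cd_mult; [apply is_cd_pow|now apply D]|].
    cbv beta. cbn [Cpow]. ring.
Qed.

Lemma mderiv_of_pole_form (g : C -> sphere) (u : C -> C) (p : C) (k : nat) (r : R) :
  (1 <= k)%nat -> holB p r u -> (forall w, punctured p r w -> g w = Fin (u w / (w - p) ^ k)%C) ->
  forall w, punctured p r w ->
    mderiv g w = Fin (((w - p) * C_derive u w - INR k * u w) / (w - p) ^ S k)%C.
Proof.
  intros Hk Hu E w Hw. destruct (holB_derive u p r Hu) as [_ D].
  destruct (punctured_open p w r Hw) as [s [Hs Hsub]].
  destruct k as [|i]; [lia|].
  destruct Hw as [W1 W2]. assert (N := Cminus_neq_0 _ _ W1).
  apply (mderiv_Fin g (fun w => u w / (w - p) ^ S i)%C w _ s Hs).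
  - intros v Hv. now apply E, Hsub.
  - eapply is_cd_val; [apply is_cd_div; [now apply D|apply is_cd_pow|now apply Cpow_nz]|].
    cbv beta.
    assert (N' : ((w - p) ^ i)%C <> RtoC 0) by now apply Cpow_nz.
    simpl (Cpow _ (S (S i))). simpl (Cpow _ (S i)). field. split; assumption.
Qed.

Lemma INR_neq_0 (k : nat) : (1 <= k)%nat -> RtoC (INR k) <> RtoC 0.
Proof. intros H. apply RtoC_neq. assert (0 < INR k) by (apply lt_0_INR; lia). lra. Qed.

Lemma pole_mderiv (f : C -> sphere) (p : C) : pole_at f p -> pole_at (mderiv f) p.
Proof.
  intros H. destruct (pole_form f p H) as [r [k [u [Hr [Hk [Hu [Hu0 [Hp E]]]]]]]].
  destruct (holB_derive u p r Hu) as [Hu' _].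
  apply (pole_of_form (mderiv f) (fun w => (w - p) * C_derive u w - INR k * u w)%C p (S k) r Hr); [lia| | | |].
  - apply (holB_ext p r (fun w => (w - p) * C_derive u w + (- INR k) * u w)%C).
    { intros w _. ring. }
    apply holB_plus; apply holB_mult; auto using holB_id, holB_const.
  - replace ((p - p) * C_derive u p - INR k * u p)%C with (- (INR k * u p))%C by ring.
    intros X. assert (X' : (INR k * u p)%C = RtoC 0).
    { replace (INR k * u p)%C with (- - (INR k * u p))%C by ring. rewrite X. ring. }
    revert X'. apply Cmult_neq_0; [now apply INR_neq_0|]. apply Hu0. now apply Cmod_center.
  - unfold mderiv. now rewrite Hp.
  - now apply mderiv_of_pole_form.
Qed.

Lemma mero_mderiv (f : C -> sphere) (p : C) : mero_at f p -> mero_at (mderiv f) p.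
Proof.
  intros [H|H]; [left|right].
  - now apply holomorphic_mderiv.
  - now apply pole_mderiv.
Qed.

Lemma mero_mderiv_n (f : C -> sphere) (p : C) (j : nat) : mero_at f p -> mero_at (mderiv_n j f) p.
Proof.
  intros H. induction j; [exact H|]. simpl. now apply mero_mderiv.
Qed.

(** Each derivative lowers the exponent of [w - p] by one and multiplies the value of the cofactor
    at [p] by the old exponent, which is nonzero. *)
Lemma zero_of_mult_of_form (g : C -> sphere) (u : C -> C) (p : C) (k : nat) (r : R) :
  0 < r -> (1 <= k)%nat -> holB p r u -> u p <> RtoC 0 ->
  (forall w, Cmod (w - p) < r -> g w = Fin ((w - p) ^ k * u w)%C) -> zero_of_mult g p k.
Proof.
  intros Hr Hk Hu Hup E.
  assert (G : forall j i, (i + j = k)%nat -> exists v, holB p r v /\ v p <> RtoC 0 /\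
    forall w, Cmod (w - p) < r -> mderiv_n j g w = Fin ((w - p) ^ i * v w)%C).
  { induction j as [|j IH]; intros i Hij.
    - exists u. replace i with k by lia. auto.
    - destruct (IH (S i) ltac:(lia)) as [v [Hv [Hvp Ev]]].
      destruct (holB_derive v p r Hv) as [Hv' _].
      exists (fun w => INR (S i) * v w + (w - p) * C_derive v w)%C. split; [|split].
      + apply holB_plus; apply holB_mult; auto using holB_id, holB_const.
      + replace (INR (S i) * v p + (p - p) * C_derive v p)%C with (INR (S i) * v p)%C by ring.
        apply Cmult_neq_0; [|exact Hvp]. apply INR_neq_0. lia.
      + intros w Hw. change (mderiv_n (S j) g) with (mderiv (mderiv_n j g)).
        now apply (mderiv_of_zero_form (mderiv_n j g) v p i r). }
  split; [exact Hk|]. split.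
  - intros j Hj. destruct (G j (k - j)%nat ltac:(lia)) as [v [_ [_ Ev]]].
    rewrite Ev by now apply Cmod_center. f_equal.
    replace (k - j)%nat with (S (k - j - 1)) by lia. simpl. ring.
  - destruct (G k 0%nat ltac:(lia)) as [v [_ [Hvp Ev]]].
    rewrite Ev by now apply Cmod_center. intros X. apply (f_equal fin) in X.
    cbn [fin Cpow] in X. rewrite Cmult_1_l in X. contradiction.
Qed.

Lemma logderiv_regular (g : C -> sphere) (p : C) :
  holomorphic_at g p -> fin (g p) <> RtoC 0 ->
  mquot (mderiv g) g p = Fin (fin (mderiv g p) / fin (g p))%C.
Proof.
  intros H N. destruct (holomorphic_mderiv g p H) as [H1 H2].
  destruct (holomorphic_mderiv (mderiv g) p H1) as [_ H4].
  eapply mquot_regular; eassumption.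
Qed.

Lemma logderiv_at_form (g : C -> sphere) (h : C -> C) (p : C) (r : R) :
  0 < r -> holB p r h -> h p <> RtoC 0 ->
  (forall w, punctured p r w -> (fin (mderiv g w) / fin (g w))%C = (h w / (w - p) ^ 1)%C) ->
  mquot (mderiv g) g p = Inf.
Proof.
  intros Hr Hh Hp E. unfold mquot. apply sph_lim_eq.
  apply (lim_pole _ h p 1 r); auto.
  - eapply holB_ccont; [exact Hh|]. now apply Cmod_center.
  - intros w Hw. f_equal. now apply E.
Qed.

(** The numerator [h] is [k + (w - p) u'/u] at a zero and [- k + (w - p) u'/u] at a pole, where [u]
    is the nonvanishing cofactor. So [h p] is the residue: its sign tells zeros from poles and its
    modulus is the order. *)
Lemma logderiv_residue (g : C -> sphere) (p : C) :
  mero_at g p -> ~ vanishes_near (fun w => fin (g w)) p ->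
  (holomorphic_at g p /\ fin (g p) <> RtoC 0) \/
  (mquot (mderiv g) g p = Inf /\ exists r k h, 0 < r /\ (1 <= k)%nat /\ holB p r h /\
    (forall w, punctured p r w -> mquot (mderiv g) g w = Fin (h w / (w - p))%C) /\
    ((h p = RtoC (INR k) /\ zero_of_mult g p k) \/
     (h p = (- RtoC (INR k))%C /\ g p = Inf /\ exists u, holB p r u /\
        (forall w, Cmod (w - p) < r -> u w <> RtoC 0) /\
        forall w, punctured p r w -> g w = Fin (u w / (w - p) ^ k)%C))).
Proof.
  intros Hg Hv.
  destruct (mquot_local (mderiv g) g p (mero_mderiv g p Hg) Hg Hv) as [_ [r0 [Hr0 [_ [_ Q]]]]].
  destruct Hg as [Hg|Hg].
  - destruct (holomorphic_order g p Hg Hv) as [r1 [j [u [Hr1 [Hu [Hu0 E]]]]]].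
    destruct j as [|i].
    { left. split; [exact Hg|]. rewrite E by now apply Cmod_center. simpl. rewrite Cmult_1_l.
      apply Hu0. now apply Cmod_center. }
    right. destruct (holB_derive u p r1 Hu) as [Hu' _].
    set (h := fun w => (INR (S i) + (w - p) * C_derive u w / u w)%C).
    assert (Hh : holB p r1 h).
    { apply holB_plus; [apply holB_const|]. apply holB_div; auto. apply holB_mult; [apply holB_id|exact Hu']. }
    assert (Hhp : h p = RtoC (INR (S i))).
    { unfold h. unfold Cdiv. ring. }
    assert (Eq : forall w, punctured p r1 w -> (fin (mderiv g w) / fin (g w))%C = (h w / (w - p))%C).
    { intros w [W1 W2]. rewrite (mderiv_of_zero_form g u p i r1 Hu E w W2), E by exact W2.
      assert (N := Cminus_neq_0 _ _ W1). assert (N2 := Hu0 w W2).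
      assert (N3 : ((w - p) ^ i)%C <> RtoC 0) by now apply Cpow_nz.
      unfold fin, h. simpl (Cpow _ (S i)). field. auto. }
    split.
    + apply (logderiv_at_form g h p r1 Hr1 Hh).
      * rewrite Hhp. apply INR_neq_0. lia.
      * intros w Hw. rewrite Eq by exact Hw. simpl. now rewrite Cmult_1_r.
    + exists (Rmin r0 r1), (S i), h. split; [now apply Rmin_glb_lt|]. split; [lia|]. split; [|split].
      * intros w Hw. apply Hh. assert (A := Rmin_r r0 r1). lra.
      * intros w Hw. assert (A := Rmin_r r0 r1). assert (B := Rmin_l r0 r1).
        destruct (Q w (punctured_mono _ _ _ _ B Hw)) as [_ ->]. f_equal. apply Eq.
        eapply punctured_mono; eassumption.
      * left. split; [exact Hhp|].
        apply (zero_of_mult_of_form g u p (S i) r1); auto; [lia|]. apply Hu0. now apply Cmod_center.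
  - right. destruct (pole_form g p Hg) as [r1 [k [u [Hr1 [Hk [Hu [Hu0 [Hp E]]]]]]]].
    destruct (holB_derive u p r1 Hu) as [Hu' _].
    set (h := fun w => (- INR k + (w - p) * C_derive u w / u w)%C).
    assert (Hh : holB p r1 h).
    { apply holB_plus; [apply holB_const|]. apply holB_div; auto. apply holB_mult; [apply holB_id|exact Hu']. }
    assert (Hhp : h p = (- RtoC (INR k))%C).
    { unfold h. unfold Cdiv. ring. }
    assert (Eq : forall w, punctured p r1 w -> (fin (mderiv g w) / fin (g w))%C = (h w / (w - p))%C).
    { intros w Hw. rewrite (mderiv_of_pole_form g u p k r1 Hk Hu E w Hw), E by exact Hw.
      destruct Hw as [W1 W2].
      assert (N := Cminus_neq_0 _ _ W1). assert (N2 := Hu0 w W2).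
      assert (N3 : ((w - p) ^ k)%C <> RtoC 0) by now apply Cpow_nz.
      unfold fin, h. simpl (Cpow _ (S k)). field. auto. }
    split.
    + apply (logderiv_at_form g h p r1 Hr1 Hh).
      * rewrite Hhp. intros X. apply (INR_neq_0 k Hk).
        replace (RtoC (INR k)) with (- - RtoC (INR k))%C by ring. rewrite X. ring.
      * intros w Hw. rewrite Eq by exact Hw. simpl. now rewrite Cmult_1_r.
    + assert (A := Rmin_r r0 r1). assert (B := Rmin_l r0 r1).
      exists (Rmin r0 r1), k, h. split; [now apply Rmin_glb_lt|]. split; [exact Hk|]. split; [|split].
      * intros w Hw. apply Hh. lra.
      * intros w Hw.
        destruct (Q w (punctured_mono _ _ _ _ B Hw)) as [_ ->]. f_equal. apply Eq.
        eapply punctured_mono; eassumption.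
      * right. split; [exact Hhp|]. split; [exact Hp|]. exists u. split; [|split].
        -- intros w Hw. apply Hu. lra.
        -- intros w Hw. apply Hu0. lra.
        -- intros w Hw. apply E. eapply punctured_mono; eassumption.
Qed.

Lemma Cinv_zero : (/ RtoC 0)%C = RtoC 0.
Proof. unfold Cinv, RtoC. simpl. f_equal; unfold Rdiv; ring. Qed.

(** At a pole [fin] takes its junk value 0 and the inverse of 0 is again 0, which is the correct
    value of [1 / f]. Hence one formula serves regular points and poles. *)
Lemma inverse_holomorphic (f : C -> sphere) (p : C) :
  mero_at f p -> f p <> Fin (RtoC 0) -> exists l, is_cd (fun w => / fin (f w))%C p l.
Proof.
  intros [H|H] N.
  - destruct (holomorphic_mderiv f p H) as [_ D]. eexists.
    apply (is_cd_inv (fun w => fin (f w))); [exact D|]. intros X. apply N.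
    apply holomorphic_at_iff in H. destruct H as [r [Hr H]]. destruct (H p (Cmod_center p r Hr)) as [K _].
    rewrite (Fin_fin _ K), X. reflexivity.
  - destruct (pole_form f p H) as [r [k [u [Hr [Hk [Hu [Hu0 [Hp E]]]]]]]].
    destruct (is_cd_pow_n p p k) as [l Hl]. destruct (Hu p (Cmod_center p r Hr)) as [l' Hl'].
    eexists. eapply (is_cd_ext_loc (fun w => (w - p) ^ k / u w)%C _ p _ r Hr).
    + intros w Hw. destruct (classic (w = p)) as [->|Hwp].
      * rewrite Hp. simpl. replace (p - p)%C with (RtoC 0) by ring.
        destruct k; [lia|]. rewrite Cinv_zero. cbn [Cpow]. unfold Cdiv. ring.
      * rewrite (E w (conj Hwp Hw)). simpl. assert (N1 := Cminus_neq_0 _ _ Hwp).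
        field. split; [|now apply Hu0]. now apply Cpow_nz.
    + apply is_cd_div; [exact Hl|exact Hl'|]. apply Hu0. now apply Cmod_center.
Qed.

(** The points with a punctured disc on which [g] vanishes and those with a punctured disc on which
    it has no zero form two disjoint open classes covering [D]. Puncturing makes both insensitive to
    the value at the centre, which may be a pole or an isolated zero. *)
Lemma identity_theorem (D : C -> Prop) (g : C -> sphere) :
  planar_domain D -> (forall z, D z -> mero_at g z) -> not_identically_zero D g ->
  forall p, D p -> ~ vanishes_near (fun w => fin (g w)) p.
Proof.
  intros [_ [_ Hc]] Hg [z0 [Dz0 Hz0]] p Dp Hv.
  set (ball_all := fun (P : C -> Prop) z => exists r, 0 < r /\ forall w, punctured z r w -> P w).
  assert (Op : forall P : C -> Prop, open (ball_all P)).
  { intros P z [r [Hr H]]. apply locally_Cmod. exists r. split; [exact Hr|]. intros v Hv'.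
    destruct (classic (v = z)) as [->|N]; [now exists r|].
    destruct (punctured_open z v r (conj N Hv')) as [s [Hs K]].
    exists s. split; [exact Hs|]. intros w [_ W]. apply H. now apply K. }
  apply Hc.
  exists (ball_all (fun w => fin (g w) = RtoC 0)), (ball_all (fun w => fin (g w) <> RtoC 0)).
  split; [apply Op|]. split; [apply Op|]. split; [|split; [|split]].
  - intros z Dz. destruct (mero_at_order g z (Hg z Dz)) as [H|[r [j [k [u H]]]]]; [now left|right].
    exists r. split; [exact (proj1 H)|]. intros w Hw. exact (order_form_neq_0 _ _ _ _ _ _ _ H Hw).
  - exists p. split; [exact Dp|exact Hv].
  - exists z0. split; [exact Dz0|].
    destruct (mero_at_order g z0 (Hg z0 Dz0)) as [[s [Hs Z]]|[r [j [k [u H]]]]].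
    (* At [z0] vanishing on a punctured disc is excluded by continuity if [g] is holomorphic there,
       and by [pole_form] otherwise. *)
    + exfalso. destruct (Hg z0 Dz0) as [K|K].
      * apply Hz0. assert (K' := K). apply holomorphic_at_iff in K'. destruct K' as [r [Hr K']].
        destruct (K' z0 (Cmod_center z0 r Hr)) as [N _]. rewrite (Fin_fin _ N). f_equal.
        apply NNPP. intros X.
        destruct (holomorphic_mderiv g z0 K) as [_ D0]. apply is_cd_ccont in D0.
        destruct (nonzero_near (fun w => fin (g w)) z0 s Hs D0 X) as [s' [Hs' [Hss H0]]].
        destruct (punctured_point z0 s' Hs') as [w [W1 W2]].
        apply (H0 w W2). apply Z. split; [exact W1|lra].
      * destruct (pole_form g z0 K) as [r [k [u [Hr [Hk [Hu [Hu0 [Hp E]]]]]]]].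
        destruct (punctured_point z0 (Rmin r s)) as [w [W1 W2]]; [now apply Rmin_glb_lt|].
        assert (A := Rmin_l r s). assert (B := Rmin_r r s).
        assert (W3 : Cmod (w - z0) < r) by lra.
        assert (W4 : Cmod (w - z0) < s) by lra.
        assert (X := Z w (conj W1 W4)). cbv beta in X.
        rewrite (E w (conj W1 W3)) in X. simpl in X.
        apply (Hu0 w W3). assert (N := Cminus_neq_0 _ _ W1).
        replace (u w) with (u w / (w - z0) ^ k * (w - z0) ^ k)%C by (field; now apply Cpow_nz).
        rewrite X. ring.
    + exists r. split; [exact (proj1 H)|]. intros w Hw. exact (order_form_neq_0 _ _ _ _ _ _ _ H Hw).
  - intros z Dz [[r [Hr H1]] [s [Hs H2]]].
    destruct (punctured_point z (Rmin r s)) as [w [W1 W2]]; [now apply Rmin_glb_lt|].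
    assert (A := Rmin_l r s). assert (B := Rmin_r r s).
    apply (H2 w); [split; [exact W1|lra]|]. apply H1. split; [exact W1|lra].
Qed.

(** Used contrapositively: nonvanishing of the highest derivative passes down to the denominators of
    both quotients. *)
Lemma vanishes_near_mderiv (g : C -> sphere) (p : C) : mero_at g p ->
  vanishes_near (fun w => fin (g w)) p -> vanishes_near (fun w => fin (mderiv g w)) p.
Proof.
  intros Hg [s [Hs Z]]. destruct (mero_at_regular g p Hg) as [r [Hr Hreg]].
  assert (A := Rmin_l r s). assert (B := Rmin_r r s).
  exists (Rmin r s). split; [now apply Rmin_glb_lt|]. intros w Hw.
  destruct (punctured_open _ _ _ Hw) as [t [Ht K]].
  rewrite (mderiv_Fin g (fun _ => RtoC 0) w (RtoC 0) t Ht).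
  - reflexivity.
  - intros v Hv. assert (V := K v Hv).
    destruct (Hreg v (punctured_mono _ _ _ _ A V)) as [N _].
    rewrite (Fin_fin _ N). f_equal. apply Z. exact (punctured_mono _ _ _ _ B V).
  - apply is_cd_const.
Qed.

(** * Poles of the limit are simple *)

Definition ucv_sph (A : C -> Prop) (f : nat -> C -> sphere) (g : C -> sphere) : Prop :=
  forall eps, 0 < eps -> exists n0, forall n, (n0 <= n)%nat ->
    forall w, A w -> sph_dist (f n w) (g w) < eps.

Lemma sph_dist_Fin_close (B eta : R) : 0 <= B -> 0 < eta -> exists eps, 0 < eps /\
  forall x w, Cmod w <= B -> sph_dist x (Fin w) < eps -> exists z, x = Fin z /\ Cmod (z - w) <= eta.
Proof.
  intros HB He.
  assert (HP : 0 < (1 + B) ^ 2) by (apply pow_lt; lra).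
  set (d := Rmin (/ (2 * (1 + B))) (eta / (2 * (1 + B) ^ 2))).
  assert (Hd : 0 < d).
  { apply Rmin_glb_lt; [apply Rinv_0_lt_compat; lra|apply Rdiv_lt_0_compat; lra]. }
  destruct (half_chord_small d Hd) as [eps [Heps H]].
  exists eps. split; [exact Heps|]. intros x w Hw Hx.
  destruct (half_chord_Fin_close x w B d Hw Hd) as [z [E Hz]]; [|now apply H|].
  - apply Rle_trans with (/ (2 * (1 + B)) * (1 + B)).
    + apply Rmult_le_compat_r; [lra|apply Rmin_l].
    + right. field. lra.
  - exists z. split; [exact E|]. eapply Rle_trans; [exact Hz|].
    apply Rle_trans with (2 * (eta / (2 * (1 + B) ^ 2)) * (1 + B) ^ 2).
    + apply Rmult_le_compat_r; [lra|]. apply Rmult_le_compat_l; [lra|apply Rmin_r].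
    + right. field. lra.
Qed.

Lemma ucv_sph_Fin (A : C -> Prop) (f : nat -> C -> sphere) (g : C -> sphere) (B eta : R) :
  ucv_sph A f g -> 0 <= B -> 0 < eta ->
  exists n0, forall n, (n0 <= n)%nat -> forall w, A w -> g w <> Inf -> Cmod (fin (g w)) <= B ->
    f n w <> Inf /\ Cmod (fin (f n w) - fin (g w)) <= eta.
Proof.
  intros H HB He. destruct (sph_dist_Fin_close B eta HB He) as [eps [Heps K]].
  destruct (H eps Heps) as [n0 Hn0]. exists n0. intros n Hn w Hw Hg HgB.
  specialize (Hn0 n Hn w Hw). rewrite (Fin_fin _ Hg) in Hn0.
  destruct (K _ _ HgB Hn0) as [z [E Hz]]. rewrite E. split; [discriminate|exact Hz].
Qed.

Lemma sinv_Fin_neq_0 (x : sphere) (z : C) : sinv x = Fin z -> x <> Fin (RtoC 0) /\ (/ fin x)%C = z.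
Proof.
  unfold sinv. destruct x as [a|].
  - destruct (excluded_middle_informative (a = RtoC 0)) as [->|N]; [discriminate|].
    intros E. injection E as <-. split; [|reflexivity]. congruence.
  - intros E. injection E as <-. split; [discriminate|]. simpl. apply Cinv_zero.
Qed.

Lemma sinv_sph_dist (x y : sphere) : sph_dist (sinv x) (sinv y) = sph_dist x y.
Proof. unfold sph_dist. now rewrite sinv_half_chord. Qed.

Lemma bounded_near (u : C -> C) (p : C) (r : R) : 0 < r -> ccont u p ->
  exists r' B, 0 < r' /\ r' <= r /\ 0 < B /\ forall w, Cmod (w - p) < r' -> Cmod (u w) <= B.
Proof.
  intros Hr Hc. destruct (Hc 1 Rlt_0_1) as [d [Hd H]].
  exists (Rmin r d), (Cmod (u p) + 1). assert (X := Cmod_ge_0 (u p)).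
  split; [now apply Rmin_glb_lt|]. split; [apply Rmin_l|]. split; [lra|].
  intros w Hw. assert (A := Rmin_r r d). specialize (H w ltac:(lra)).
  assert (Y := Cmod_minus_ge (u w) (u p)). lra.
Qed.

(** The reciprocal of [phi] has a simple zero at [z], with derivative [chi z] equal to the
    reciprocal of the residue. Cauchy's estimate on the circle of radius [s / 2] bounds that
    derivative by [4 b / s]. *)
Lemma residue_lower_bound (phi : C -> sphere) (h : C -> C) (z : C) (s r b K : R) :
  0 < s -> 0 < r -> 0 <= b ->
  (forall w, Cmod (w - z) < s -> mero_at phi w /\ phi w <> Fin (RtoC 0) /\ Cmod (/ fin (phi w)) <= b) ->
  phi z = Inf -> holB z r h -> (forall w, punctured z r w -> phi w = Fin (h w / (w - z))%C) ->
  Cmod (h z) = K -> s <= 4 * b * K.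
Proof.
  intros Hs Hr Hb Hphi Hz Hh E HK.
  set (psi := fun w => (/ fin (phi w))%C).
  assert (Hpsi : holB z s psi).
  { intros w Hw. destruct (Hphi w Hw) as [H1 [H2 _]]. now apply inverse_holomorphic. }
  assert (Hpz : psi z = RtoC 0) by (unfold psi; rewrite Hz; apply Cinv_zero).
  destruct (divide_root psi z s Hs Hpsi Hpz) as [chi [Hchi Echi]].
  assert (B1 : Cmod (chi z) <= 4 * b / s).
  { eapply Rle_trans; [apply (cauchy_estimate chi z z (s / 2) (2 * b / s))|].
    - rewrite Cmod_minus_diag. lra.
    - intros w Hw. apply Hchi. lra.
    - intros t _. set (w := circ z (s / 2) t).
      assert (Hw : Cmod (w - z) = s / 2) by (apply Cmod_circ; lra).
      assert (Ew := Echi w ltac:(lra)). apply (f_equal Cmod) in Ew. rewrite Cmod_mult, Hw in Ew.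
      destruct (Hphi w ltac:(lra)) as [_ [_ H3]]. unfold psi in Ew.
      apply Rle_div_r; [exact Hs|]. lra.
    - rewrite Cmod_minus_diag. right. field. lra. }
  assert (L : (chi z * h z)%C = RtoC 1).
  { assert (D : forall eps, 0 < eps -> Cmod (chi z * h z - 1) < eps).
    { intros eps Heps.
      assert (Cc : ccont (fun w => chi w * h w)%C z).
      { destruct (Hchi z (Cmod_center z s Hs)) as [l1 H1]. destruct (Hh z (Cmod_center z r Hr)) as [l2 H2].
        eapply is_cd_ccont. apply is_cd_mult; eassumption. }
      destruct (Cc eps Heps) as [d [Hd Hc]].
      destruct (punctured_point z (Rmin d (Rmin s r))) as [w [W1 W2]]; [repeat apply Rmin_glb_lt; lra|].
      assert (A1 := Rmin_l d (Rmin s r)). assert (A2 := Rmin_r d (Rmin s r)).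
      assert (A3 := Rmin_l s r). assert (A4 := Rmin_r s r).
      specialize (Hc w ltac:(lra)). rewrite Cmod_minus_sym.
      replace (RtoC 1) with (chi w * h w)%C; [exact Hc|].
      assert (W3 : Cmod (w - z) < s) by lra. assert (W4 : Cmod (w - z) < r) by lra.
      assert (Ew := Echi w W3). unfold psi in Ew. rewrite (E w (conj W1 W4)) in Ew. simpl in Ew.
      assert (N := Cminus_neq_0 _ _ W1).
      destruct (Hphi w W3) as [_ [N2 _]]. rewrite (E w (conj W1 W4)) in N2.
      assert (N3 : h w <> RtoC 0). { intros X. apply N2. rewrite X. f_equal. unfold Cdiv. ring. }
      assert (chi w = (/ (h w / (w - z)) / (w - z))%C).
      { rewrite Ew. field. exact N. }
      rewrite H. field. auto. }
    assert (X : Cmod (chi z * h z - 1) <= 0).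
    { apply Rnot_lt_le. intros Y. specialize (D _ Y). lra. }
    apply Cmod_le_0 in X. replace (chi z * h z)%C with ((chi z * h z - 1) + 1)%C by ring. rewrite X. ring. }
  apply (f_equal Cmod) in L. rewrite Cmod_mult, HK, Cmod_1 in L.
  assert (HK0 : 0 <= K) by (rewrite <- HK; apply Cmod_ge_0).
  assert (1 <= 4 * b / s * K) by (rewrite <- L; now apply Rmult_le_compat_r).
  apply Rmult_le_compat_r with (r := s) in H; [|lra].
  replace (4 * b / s * K * s) with (4 * b * K) in H by (field; lra). lra.
Qed.

(** Serves to produce poles: without poles inside, a bound on a circle would bound the value at the
    centre, which convergence to [Inf] at [p] forbids. *)
Lemma regular_center_bound (phi : C -> sphere) (p : C) (rho M : R) :
  0 < rho -> (forall w, Cmod (w - p) < rho -> mero_at phi w /\ phi w <> Inf) ->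
  (forall t, Cmod (fin (phi (circ p (rho / 2) t))) <= M) -> Cmod (fin (phi p)) <= 2 * M.
Proof.
  intros Hr H HM.
  eapply Rle_trans; [apply (cauchy_estimate (fun w => fin (phi w)) p p (rho / 2) M)|].
  - rewrite Cmod_minus_diag. lra.
  - intros w Hw. destruct (H w ltac:(lra)) as [[H1|[H1 _]] H2]; [|contradiction].
    eexists. now apply holomorphic_mderiv.
  - intros t _. apply HM.
  - rewrite Cmod_minus_diag. right. field. lra.
Qed.

Lemma le_of_sq_le (x y K : R) : 0 <= y -> 1 <= K -> x ^ 2 <= y ^ 2 * K -> x <= K * y.
Proof.
  intros Hy HK H. apply Rnot_lt_le. intros N.
  assert (0 <= K * y) by nra. assert ((K * y) * (K * y) < x * x) by nra.
  assert (y ^ 2 * K <= K * y * (K * y)).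
  { replace (K * y * (K * y)) with (y ^ 2 * K * K) by ring. assert (0 <= y ^ 2 * K) by (assert (Z := pow2_ge_0 y); nra). nra. }
  nra.
Qed.

Lemma exp_ge_1 (x : R) : 0 <= x -> 1 <= exp x.
Proof. intros H. rewrite <- exp_0. destruct H as [H| <-]; [left; now apply exp_increasing|right; reflexivity]. Qed.

(** Product of the Gronwall factor along a radial segment, the loss [8/3 = 2 r1 / (r1 - r1/4)] of
    Cauchy's estimate, and the Gronwall factor once around the circle. *)
Definition decay_const (M r1 : R) : R :=
  exp ((6 * (M * r1) + 1) * 1) * (8 / 3 * exp ((6 * (M * r1) + 1) * (2 * PI))).

(* Gronwall keeps |G| comparable on the annulus r1/4 <= |w - p| <= r1, whereas a
   zero of order k near p forces |G| to drop by (3/7)^k between the two circles. *)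
Lemma zero_order_bound (G phi u : C -> C) (p z : C) (r1 M s : R) (k : nat) :
  0 < r1 -> 0 <= M -> holB p (2 * r1) G ->
  (forall w, r1 / 4 <= Cmod (w - p) <= r1 -> is_cd G w (phi w * G w)%C /\ Cmod (phi w) <= M /\ G w <> RtoC 0) ->
  Cmod (z - p) < r1 / 8 -> 0 < s -> holB z s u ->
  (forall w, punctured z s w -> G w = ((w - z) ^ k * u w)%C) ->
  1 <= decay_const M r1 * (3 / 7) ^ k.
Proof.
  intros Hr HM HG Hode Hz Hs Hu Eu.
  assert (Hpi := PI_RGT_0).
  set (a := circ p r1 0). set (b := circ p (r1 / 4) 0).
  assert (Ha : Cmod (a - p) = r1) by (apply Cmod_circ; lra).
  assert (Hb : Cmod (b - p) = r1 / 4) by (apply Cmod_circ; lra).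
  set (d := Cmod (G a)).
  assert (Hd : 0 < d) by (apply Cmod_gt_0; apply Hode; lra).
  set (E1 := exp ((6 * (M * r1) + 1) * (2 * PI))).
  set (E2 := exp ((6 * (M * r1) + 1) * 1)).
  assert (HMr : 0 <= M * r1) by (apply Rmult_le_pos; lra).
  assert (HE1 : 1 <= E1) by (apply exp_ge_1; apply Rmult_le_pos; lra).
  assert (HE2 : 1 <= E2) by (apply exp_ge_1; lra).
  assert (Hcirc : forall t, 0 <= t <= 2 * PI -> Cmod (G (circ p r1 t)) <= E1 * d).
  { intros T HT. apply le_of_sq_le; [lra|exact HE1|].
    eapply Rle_trans; [apply (gronwall1 (fun t => G (circ p r1 t))
      (fun t => phi (circ p r1 t) * G (circ p r1 t) * (RtoC r1 * (Ci * cis t)))%C T (M * r1) 0)|]; try lra.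
    - intros t Ht. apply (pder_comp G (circ p r1)); [|apply pder_circ].
      apply Hode. rewrite Cmod_circ; lra.
    - intros t Ht. rewrite !Cmod_mult, Cmod_Ci, Cmod_cis, Cmod_R, Rabs_right by lra.
      destruct (Hode (circ p r1 t)) as [_ [H2 _]]; [rewrite Cmod_circ; lra|].
      replace (Cmod (phi (circ p r1 t)) * Cmod (G (circ p r1 t)) * (r1 * (1 * 1)))
        with (Cmod (phi (circ p r1 t)) * r1 * Cmod (G (circ p r1 t))) by ring.
      rewrite Rplus_0_r. apply Rmult_le_compat_r; [apply Cmod_ge_0|]. apply Rmult_le_compat_r; lra.
    - fold a. fold d. replace (d ^ 2 + 3 * 0 ^ 2) with (d ^ 2) by ring.
      apply Rmult_le_compat_l; [apply pow2_ge_0|]. unfold E1.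
      assert ((6 * (M * r1) + 1) * T <= (6 * (M * r1) + 1) * (2 * PI)) by (apply Rmult_le_compat_l; lra).
      destruct H as [H| ->]; [left; now apply exp_increasing|right; reflexivity]. }
  assert (Hba : (a - b)%C = RtoC (3 / 4 * r1)).
  { unfold a, b, circ, cis. rewrite cos_0, sin_0. unfold RtoC, Cminus, Cplus, Copp, Cmult. simpl. f_equal; field. }
  assert (Hsg : forall t, 0 <= t <= 1 -> r1 / 4 <= Cmod (seg b a t - p) <= r1).
  { intros t Ht. unfold seg. rewrite Hba. unfold b, circ.
      replace (p + RtoC (r1 / 4) * cis 0 + RtoC (3 / 4 * r1) * RtoC t - p)%C with (RtoC (r1 / 4 + 3 / 4 * r1 * t)).
      - rewrite Cmod_R, Rabs_right by nra. nra.
      - unfold cis. rewrite cos_0, sin_0. unfold RtoC, Cminus, Cplus, Copp, Cmult. simpl. f_equal; ring. }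
  assert (Hseg : d <= E2 * Cmod (G b)).
  { apply le_of_sq_le; [apply Cmod_ge_0|exact HE2|].
    eapply Rle_trans; [|eapply Rle_trans; [apply (gronwall1 (fun t => G (seg b a t))
      (fun t => phi (seg b a t) * G (seg b a t) * (a - b))%C 1 (M * r1) 0)|]]; try lra.
    - cbv beta. rewrite seg_1. fold d. lra.
    - intros t Ht. apply (pder_comp G (seg b a)); [|apply pder_seg].
      apply Hode. now apply Hsg.
    - intros t Ht. rewrite !Cmod_mult. destruct (Hode (seg b a t) (Hsg t Ht)) as [_ [H2 _]].
      rewrite Hba, Cmod_R, Rabs_right by lra.
      replace (Cmod (phi (seg b a t)) * Cmod (G (seg b a t)) * (3 / 4 * r1))
        with (Cmod (phi (seg b a t)) * (3 / 4 * r1) * Cmod (G (seg b a t))) by ring.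
      rewrite Rplus_0_r. apply Rmult_le_compat_r; [apply Cmod_ge_0|].
      apply Rmult_le_compat; try lra. apply Cmod_ge_0.
    - cbv beta. rewrite seg_0. fold E2. right. ring. }
  (* [H] is [G] with the zero at [z] divided out; Cauchy's estimate for [H] carries the bound on the
     outer circle to the point [b] of the inner one. *)
  set (H := fun w => if excluded_middle_informative (w = z) then u z else (G w / (w - z) ^ k)%C).
  assert (HG' : forall w, Cmod (w - p) < 2 * r1 -> G w = ((w - z) ^ k * H w)%C \/ w = z).
  { intros w Hw. unfold H. destruct (excluded_middle_informative (w = z)) as [->|N]; [now right|left].
    field. apply Cpow_nz. now apply Cminus_neq_0. }
  assert (HH : holB p (2 * r1) H).
  { intros w Hw. destruct (classic (w = z)) as [->|N].
    - destruct (Hu z (Cmod_center z s Hs)) as [l Hl]. exists l.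
      apply (is_cd_ext_loc u _ z l s Hs); [|exact Hl]. intros v Hv. unfold H.
      destruct (excluded_middle_informative (v = z)) as [->|N]; [reflexivity|].
      rewrite (Eu v (conj N Hv)). field. apply Cpow_nz. now apply Cminus_neq_0.
    - destruct (HG w Hw) as [l Hl]. destruct (is_cd_pow_n w z k) as [l' Hl'].
      eexists. eapply (is_cd_ext_loc (fun w => G w / (w - z) ^ k)%C _ w _ (Cmod (w - z))).
      + now apply Cmod_minus_gt_0.
      + intros v Hv. unfold H. destruct (excluded_middle_informative (v = z)) as [->|N']; [|reflexivity].
        rewrite Cmod_minus_sym in Hv. lra.
      + apply is_cd_div; [exact Hl|exact Hl'|]. apply Cpow_nz. now apply Cminus_neq_0. }
  assert (P7 : 0 < (7 / 8 * r1) ^ k) by (apply pow_lt; lra).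
  assert (HHb : Cmod (H b) <= 2 * (E1 * d / (7 / 8 * r1) ^ k) * r1 / (r1 - r1 / 4)).
  { rewrite <- Hb. apply cauchy_estimate.
    - lra.
    - intros w Hw. apply HH. lra.
    - intros t Ht. set (w := circ p r1 t). assert (Hw : Cmod (w - p) = r1) by (apply Cmod_circ; lra).
      assert (Hwz : 7 / 8 * r1 <= Cmod (w - z)).
      { assert (T := Cmod_dist_triangle w z p). lra. }
      destruct (HG' w ltac:(lra)) as [E|E]; [|rewrite E in Hw; lra].
      apply (f_equal Cmod) in E. rewrite Cmod_mult, Cmod_pow in E.
      assert (Hc := Hcirc t Ht). fold w in Hc.
      assert (Hpow : (7 / 8 * r1) ^ k <= Cmod (w - z) ^ k) by (apply pow_incr; lra).
      apply Rle_div_r; [exact P7|]. rewrite E in Hc.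
      eapply Rle_trans; [|exact Hc]. rewrite Rmult_comm. apply Rmult_le_compat_r; [apply Cmod_ge_0|exact Hpow]. }
  (* The outer circle is at distance at least [7/8 r1] from [z] and [b] at distance at most
     [3/8 r1], whence the ratio [3/7] per order of the zero. *)
  assert (Hbz : Cmod (b - z) <= 3 / 8 * r1).
  { assert (T := Cmod_dist_triangle b p z). rewrite (Cmod_minus_sym p z) in T. lra. }
  assert (HGb : Cmod (G b) <= 8 / 3 * E1 * d * (3 / 7) ^ k).
  { destruct (HG' b ltac:(lra)) as [E|E].
    - rewrite E, Cmod_mult, Cmod_pow.
      apply Rle_trans with ((3 / 8 * r1) ^ k * (2 * (E1 * d / (7 / 8 * r1) ^ k) * r1 / (r1 - r1 / 4))).
      + apply Rmult_le_compat; [apply pow_le, Cmod_ge_0|apply Cmod_ge_0| |exact HHb].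
        apply pow_incr. split; [apply Cmod_ge_0|exact Hbz].
      + right. replace (3 / 8 * r1) with (3 / 7 * (7 / 8 * r1)) by field.
        rewrite (Rpow_mult_distr (3 / 7) (7 / 8 * r1) k). field. split; lra.
    - rewrite E in Hb. lra. }
  assert (K : d * 1 <= d * (decay_const M r1 * (3 / 7) ^ k)).
  { unfold decay_const. fold E1 E2.
    apply Rle_trans with (E2 * (8 / 3 * E1 * d * (3 / 7) ^ k)).
    - rewrite Rmult_1_r. eapply Rle_trans; [exact Hseg|]. apply Rmult_le_compat_l; lra.
    - right. ring. }
  apply Rmult_le_reg_l in K; assumption.
Qed.

Definition logderiv (g : C -> sphere) : C -> sphere := mquot (mderiv g) g.

Lemma mero_logderiv (g : C -> sphere) (z : C) :
  mero_at g z -> ~ vanishes_near (fun w => fin (g w)) z -> mero_at (logderiv g) z.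
Proof. intros H1 H2. apply mquot_local; auto using mero_mderiv. Qed.

Lemma logderiv_finite (g : C -> sphere) (z : C) :
  mero_at g z -> ~ vanishes_near (fun w => fin (g w)) z -> logderiv g z <> Inf ->
  holomorphic_at g z /\ fin (g z) <> RtoC 0 /\ is_cd (fun w => fin (g w)) z (fin (logderiv g z) * fin (g z))%C.
Proof.
  intros Hg Hv Hi. destruct (logderiv_residue g z Hg Hv) as [[H N]|[H _]]; [|contradiction].
  split; [exact H|]. split; [exact N|]. unfold logderiv. rewrite logderiv_regular by assumption.
  destruct (holomorphic_mderiv g z H) as [_ D]. eapply is_cd_val; [exact D|].
  cbn [fin]. field. exact N.
Qed.

Lemma max4 (a b c d : nat) : exists n : nat, (a <= n /\ b <= n /\ c <= n /\ d <= n)%nat.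
Proof. exists (a + b + c + d)%nat. lia. Qed.

(** The order of choices matters. For large [n] all residues within [rN] of [p] exceed [N] in
    modulus, so [g n] has no zeros there; this fixes [R1], the bound [M] on an annulus and the decay
    constant. Only then is [L] taken so large that a zero of order above [L] of the reciprocal is
    impossible, and [rho] so small that poles within [rho] have residues above [L] in modulus. *)
Lemma no_higher_pole (g : nat -> C -> sphere) (F : C -> sphere) (p : C) (R0 : R) (N : nat)
  (r1 : R) (i : nat) (u : C -> C) :
  0 < R0 ->
  (forall n z, Cmod (z - p) < R0 -> mero_at (g n) z) ->
  (forall n z, Cmod (z - p) < R0 -> ~ vanishes_near (fun w => fin (g n w)) z) ->
  (forall n z k, Cmod (z - p) < R0 -> zero_of_mult (g n) z k -> (k <= N)%nat) ->
  ucv_sph (fun w => Cmod (w - p) < R0) (fun n => logderiv (g n)) F ->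
  0 < r1 -> holB p r1 u -> (forall w, Cmod (w - p) < r1 -> u w <> RtoC 0) -> F p = Inf ->
  (forall w, punctured p r1 w -> F w = Fin (u w / (w - p) ^ S (S i))%C) -> False.
Proof.
  intros HR Hmero Hvan Hmult Hcv Hr1 Hu Hu0 HFp HF.
  set (k := S (S i)) in *. set (phi := fun n => logderiv (g n)) in *.
  destruct (bounded_near u p r1 Hr1) as [r2 [B [Hr2 [Hr21 [HB HuB]]]]].
  { eapply holB_ccont; [exact Hu|]. now apply Cmod_center. }
  assert (Hiu : holB p r1 (fun w => 1 / u w)%C) by (apply holB_div; auto using holB_const).
  destruct (bounded_near (fun w => 1 / u w)%C p r2 Hr2) as [r3 [K [Hr3 [Hr32 [HK HuK]]]]].
  { eapply holB_ccont; [exact Hiu|]. apply Cmod_center. exact Hr1. }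
  set (rs := Rmin r3 (Rmin R0 1)).
  assert (Hrs : 0 < rs) by (repeat apply Rmin_glb_lt; lra).
  assert (S1 : rs <= r3) by apply Rmin_l.
  assert (S2 : rs <= R0) by (unfold rs; eapply Rle_trans; [apply Rmin_r|apply Rmin_l]).
  assert (S3 : rs <= 1) by (unfold rs; eapply Rle_trans; [apply Rmin_r|apply Rmin_r]).
  (* The reciprocal of [F], including its value 0 at [p]. Since [k >= 2] and [rs <= 1], it is
     bounded by [K |w - p|^2]. *)
  set (psi := fun w => ((w - p) ^ k / u w)%C).
  assert (Hpsi : forall w, Cmod (w - p) < rs ->
    sinv (F w) = Fin (psi w) /\ Cmod (psi w) <= K * (Cmod (w - p) * Cmod (w - p))).
  { intros w Hw. assert (Nu := Hu0 w ltac:(lra)). split.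
    - destruct (classic (w = p)) as [->|W1].
      + rewrite HFp. simpl. f_equal. unfold psi, k. cbn [Cpow]. unfold Cdiv. ring.
      + assert (W2 : Cmod (w - p) < r1) by lra. rewrite (HF w (conj W1 W2)).
        assert (Nw : ((w - p) ^ k)%C <> RtoC 0) by (apply Cpow_nz; now apply Cminus_neq_0).
        unfold sinv. destruct (excluded_middle_informative _) as [X|X].
        * exfalso. apply Nu. replace (u w) with (u w / (w - p) ^ k * (w - p) ^ k)%C by (field; exact Nw).
          rewrite X. ring.
        * f_equal. unfold psi. field. auto.
    - unfold psi. replace ((w - p) ^ k / u w)%C with ((w - p) ^ k * (1 / u w))%C by (field; exact Nu).
      rewrite Cmod_mult, Cmod_pow. unfold k. set (t := Cmod (w - p)) in *.
      assert (Ht : 0 <= t) by apply Cmod_ge_0.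
      assert (Hti : t ^ i <= 1). { rewrite <- (pow1 i). apply pow_incr. lra. }
      assert (Hti0 : 0 <= t ^ i) by now apply pow_le.
      assert (HuKw : Cmod (1 / u w) <= K) by (apply HuK; fold t; lra).
      replace (t ^ S (S i)) with (t * t * t ^ i) by (simpl; ring).
      rewrite (Rmult_comm K). apply Rmult_le_compat; [|apply Cmod_ge_0| |exact HuKw].
      + repeat apply Rmult_le_pos; lra.
      + assert (0 <= t * t) by nra. nra. }
  (* Inversion preserves [sph_dist], so near [p] spherical convergence to [F] becomes uniform
     convergence of the reciprocals to [psi]. *)
  assert (FA : forall rho eta, 0 < rho -> rho <= rs -> K * (rho * rho) <= 1 -> 0 < eta ->
    exists n0, forall n, (n0 <= n)%nat -> forall w, Cmod (w - p) < rho ->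
      phi n w <> Fin (RtoC 0) /\ Cmod (/ fin (phi n w) - psi w) <= eta).
  { intros rho eta Hrho Hrhos HKr Heta.
    destruct (sph_dist_Fin_close 1 eta Rle_0_1 Heta) as [eps [Heps Hc]].
    destruct (Hcv eps Heps) as [n0 Hn0]. exists n0. intros n Hn w Hw.
    destruct (Hpsi w ltac:(lra)) as [E1 E2].
    specialize (Hn0 n Hn w ltac:(lra)). rewrite <- sinv_sph_dist, E1 in Hn0.
    destruct (Hc (sinv (phi n w)) (psi w)) as [z [Ez Hz]].
    - eapply Rle_trans; [exact E2|]. eapply Rle_trans; [|exact HKr].
      assert (Z := Cmod_ge_0 (w - p)%C). apply Rmult_le_compat_l; [lra|]. apply Rmult_le_compat; lra.
    - exact Hn0.
    - destruct (sinv_Fin_neq_0 _ _ Ez) as [N1 N2]. split; [exact N1|]. now rewrite N2. }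
  (* Reciprocals are O(rho^2) on the disc of radius [2 rho], while a pole within [rho] of [p] has a
     disc of radius [rho] around it inside; so its residue is at least of order [1 / rho]. *)
  assert (FB : forall L : nat, exists rL, 0 < rL /\ rL <= rs /\ forall rho, 0 < rho -> rho <= rL ->
    exists n0, forall n, (n0 <= n)%nat -> forall z, Cmod (z - p) < rho -> phi n z = Inf ->
    forall r q h, 0 < r -> holB z r h -> (forall w, punctured z r w -> phi n w = Fin (h w / (w - z))%C) ->
      Cmod (h z) = INR q -> (L < q)%nat).
  { intros L. assert (HL := pos_INR L).
    (* The middle bound makes the residue [q >= 1 / (32 K rho)] at least [2 (L + 1)]; the others
       keep the disc of radius [2 rho] within [rs] and [psi] at most 1 on it. *)
    set (rL := Rmin (rs / 2) (Rmin (/ (64 * K * (INR L + 1))) (/ (4 * (K + 1))))).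
    assert (P1 : 0 < / (64 * K * (INR L + 1))).
    { apply Rinv_0_lt_compat. apply Rmult_lt_0_compat; lra. }
    assert (P2 : 0 < / (4 * (K + 1))) by (apply Rinv_0_lt_compat; lra).
    assert (L1 : rL <= rs / 2) by apply Rmin_l.
    assert (L2 : rL <= / (64 * K * (INR L + 1))) by (unfold rL; eapply Rle_trans; [apply Rmin_r|apply Rmin_l]).
    assert (L3 : rL <= / (4 * (K + 1))) by (unfold rL; eapply Rle_trans; [apply Rmin_r|apply Rmin_r]).
    exists rL. split; [unfold rL; repeat apply Rmin_glb_lt; lra|]. split; [lra|].
    intros rho Hrho Hrho2.
    assert (Hk4 : K * (2 * rho * (2 * rho)) <= 1).
    { assert (A1 : rho * (4 * (K + 1)) <= 1).
      { apply Rle_trans with (/ (4 * (K + 1)) * (4 * (K + 1))).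
        - apply Rmult_le_compat_r; lra.
        - right. field. lra. }
      assert (rho * K <= / 4) by nra.
      assert (rho <= / 4) by nra. nra. }
    assert (Hkr : 0 < K * (2 * rho * (2 * rho))) by (repeat apply Rmult_lt_0_compat; lra).
    destruct (FA (2 * rho) (K * (2 * rho * (2 * rho)))) as [n0 Hn0]; try lra.
    exists n0. intros n Hn z Hz Hinf r q h Hr Hh Eh Hq.
    assert (X : rho <= 4 * (2 * (K * (2 * rho * (2 * rho)))) * INR q).
    { apply (residue_lower_bound (phi n) h z rho r _ (INR q)); try lra; try assumption.
      intros w Hw. assert (T := Cmod_dist_triangle w z p).
      assert (Hwp : Cmod (w - p) < 2 * rho) by lra.
      destruct (Hn0 n Hn w Hwp) as [N1 N2].
      split; [|split; [exact N1|]].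
      - apply mero_logderiv; [apply Hmero|apply Hvan]; lra.
      - destruct (Hpsi w ltac:(lra)) as [_ E2].
        assert (Y := Cmod_minus_ge (/ fin (phi n w))%C (psi w)).
        assert (Z : K * (Cmod (w - p) * Cmod (w - p)) <= K * (2 * rho * (2 * rho))).
        { assert (Z := Cmod_ge_0 (w - p)%C). apply Rmult_le_compat_l; [lra|]. apply Rmult_le_compat; lra. }
        lra. }
    assert (X2 : 1 <= 32 * K * rho * INR q).
    { apply Rmult_le_reg_l with rho; [lra|]. nra. }
    apply INR_lt. apply Rnot_le_lt. intros Y.
    assert (rho * (64 * K * (INR L + 1)) <= 1).
    { apply Rle_trans with (/ (64 * K * (INR L + 1)) * (64 * K * (INR L + 1))).
      - apply Rmult_le_compat_r; [|lra]. apply Rlt_le, Rmult_lt_0_compat; lra.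
      - right. field. split; lra. }
    assert (0 < K * rho) by (apply Rmult_lt_0_compat; lra).
    assert (K * rho * INR q <= K * rho * INR L) by (apply Rmult_le_compat_l; lra).
    nra. }
  assert (FM : forall del, 0 < del -> exists n0, forall n, (n0 <= n)%nat -> forall w,
    del <= Cmod (w - p) < rs -> phi n w <> Inf /\ Cmod (fin (phi n w)) <= B / del ^ k + 1).
  { intros del Hdel. assert (Hdk : 0 < del ^ k) by now apply pow_lt.
    destruct (ucv_sph_Fin _ _ _ (B / del ^ k) 1 Hcv) as [n0 Hn0].
    - apply Rlt_le. apply Rdiv_lt_0_compat; lra.
    - lra.
    - exists n0. intros n Hn w Hw.
      assert (W1 : w <> p). { intros ->. rewrite Cmod_minus_diag in Hw. lra. }
      assert (W2 : Cmod (w - p) < r1) by lra.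
      assert (EF := HF w (conj W1 W2)).
      assert (BF : Cmod (fin (F w)) <= B / del ^ k).
      { rewrite EF. cbn [fin]. rewrite Cmod_div by (apply Cpow_nz; now apply Cminus_neq_0).
        rewrite Cmod_pow. apply Rmult_le_compat.
        - apply Cmod_ge_0.
        - apply Rlt_le, Rinv_0_lt_compat. apply pow_lt. lra.
        - apply HuB. lra.
        - apply Rinv_le_contravar; [exact Hdk|]. apply pow_incr. lra. }
      destruct (Hn0 n Hn w) as [H1 H2].
      + lra.
      + rewrite EF. discriminate.
      + exact BF.
      + split; [exact H1|]. assert (Y := Cmod_minus_ge (fin (phi n w)) (fin (F w))).
        unfold phi in *. lra. }
  (* Some pole must exist: otherwise [phi n p] would be bounded by [2 M] although its reciprocal is
     at most [1 / (2 M + 1)]. *)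
  assert (FC : forall rho, 0 < rho -> rho <= rs -> K * (rho * rho) <= 1 ->
    exists n0, forall n, (n0 <= n)%nat -> exists z, Cmod (z - p) < rho /\ phi n z = Inf).
  { intros rho Hrho Hrhos HKr.
    destruct (FM (rho / 2)) as [n1 Hn1]; [lra|].
    set (M := B / (rho / 2) ^ k + 1) in *.
    assert (HM : 0 < M). { unfold M. assert (0 < B / (rho / 2) ^ k); [|lra]. apply Rdiv_lt_0_compat; [lra|]. apply pow_lt. lra. }
    destruct (FA rho (/ (2 * M + 1))) as [n2 Hn2]; try lra.
    { apply Rinv_0_lt_compat. lra. }
    exists (n1 + n2)%nat. intros n Hn. apply NNPP. intros Hno.
    assert (HnI : forall w, Cmod (w - p) < rho -> phi n w <> Inf).
    { intros w Hw E. apply Hno. now exists w. }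
    assert (X : Cmod (fin (phi n p)) <= 2 * M).
    { apply (regular_center_bound (phi n) p rho M Hrho).
      - intros w Hw. split; [|now apply HnI]. apply mero_logderiv; [apply Hmero|apply Hvan]; lra.
      - intros t. apply Hn1; [lia|]. rewrite Cmod_circ; lra. }
    destruct (Hn2 n ltac:(lia) p (Cmod_center p rho Hrho)) as [Y1 Y2].
    assert (Hpp : psi p = RtoC 0). { unfold psi, k. cbn [Cpow]. unfold Cdiv. ring. }
    rewrite Hpp in Y2. replace (/ fin (phi n p) - 0)%C with (/ fin (phi n p))%C in Y2 by ring.
    assert (N0 : fin (phi n p) <> RtoC 0).
    { intros E. apply Y1. rewrite (Fin_fin _ (HnI p (Cmod_center p rho Hrho))), E. reflexivity. }
    rewrite Cmod_inv in Y2 by exact N0. assert (N1 := proj1 (Cmod_gt_0 _) N0).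
    assert (Z : / (2 * M) <= / Cmod (fin (phi n p))) by (apply Rinv_le_contravar; lra).
    assert (Z2 : / (2 * M + 1) < / (2 * M)).
    { apply Rinv_lt_contravar; [|lra]. apply Rmult_lt_0_compat; lra. }
    lra. }
  destruct (FB N) as [rN [HrN [HrNs FBN]]].
  destruct (FBN rN HrN ltac:(lra)) as [n1 Hn1].
  (* Then the disc of radius [2 * R1] required by [zero_order_bound] is the disc without zeros of
     [g n]. *)
  set (R1 := rN / 2). assert (HR1 : 0 < R1) by (unfold R1; lra).
  destruct (FM (R1 / 4)) as [n2 Hn2]; [lra|].
  set (M := B / (R1 / 4) ^ k + 1) in *.
  assert (HM : 0 < M). { unfold M. assert (0 < B / (R1 / 4) ^ k); [|lra]. apply Rdiv_lt_0_compat; [lra|]. apply pow_lt. lra. }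
  assert (HDC : 0 < decay_const M R1).
  { unfold decay_const. repeat apply Rmult_lt_0_compat; try lra; apply exp_pos. }
  destruct (pow_lt_1_zero (3 / 7)) with (y := / decay_const M R1) as [L HL].
  { rewrite Rabs_right; lra. }
  { now apply Rinv_0_lt_compat. }
  destruct (FB L) as [rL [HrL [HrLs FBL]]].
  set (rho := Rmin (Rmin rL (R1 / 8)) (/ (K + 1))).
  assert (Hrho : 0 < rho). { assert (0 < / (K + 1)) by (apply Rinv_0_lt_compat; lra). repeat apply Rmin_glb_lt; lra. }
  assert (Q1 : rho <= rL) by (unfold rho; eapply Rle_trans; [apply Rmin_l|apply Rmin_l]).
  assert (Q2 : rho <= R1 / 8) by (unfold rho; eapply Rle_trans; [apply Rmin_l|apply Rmin_r]).
  assert (Q3 : K * rho <= 1).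
  { apply Rle_trans with (K * / (K + 1)).
    - apply Rmult_le_compat_l; [lra|apply Rmin_r].
    - apply Rmult_le_reg_r with (K + 1); [lra|]. rewrite Rmult_assoc, Rinv_l; lra. }
  destruct (FBL rho Hrho Q1) as [n3 Hn3].
  destruct (FC rho Hrho ltac:(lra)) as [n4 Hn4]; [nra|].
  destruct (max4 n1 n2 n3 n4) as [n [M1 [M2 [M3 M4]]]].
  destruct (Hn4 n M4) as [z [Hz Hzinf]].
  (* residues in the ball of radius rN exceed N, so zeros of g n are excluded there *)
  assert (Hpole : forall w, Cmod (w - p) < rN -> phi n w = Inf -> forall r q h, 0 < r -> (1 <= q)%nat -> holB w r h ->
     (forall v, punctured w r v -> phi n v = Fin (h v / (v - w))%C) -> h w = RtoC (INR q) -> ~ zero_of_mult (g n) w q).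
  { intros w Hw Hwi r q h Hr Hq Hh Eh Ehw Hzm.
    assert (N < q)%nat.
    { apply (Hn1 n M1 w Hw Hwi r q h Hr Hh Eh). rewrite Ehw, Cmod_R. apply Rabs_right. apply Rle_ge, pos_INR. }
    assert (q <= N)%nat by (apply (Hmult n w); [lra|exact Hzm]). lia. }
  assert (HG : holB p (2 * R1) (fun w => / fin (g n w))%C).
  { intros w Hw. assert (HwN : Cmod (w - p) < rN) by (unfold R1 in Hw; lra).
    apply inverse_holomorphic; [apply Hmero; lra|].
    destruct (logderiv_residue (g n) w) as [[_ Nw]|[Hwi [r [q [h [Hr [Hq [Hh [Eh [[Ehw Hzm]|[Ehw [Hgi _]]]]]]]]]]]].
    - apply Hmero; lra.
    - apply Hvan; lra.
    - intros E. apply Nw. now rewrite E.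
    - exfalso. exact (Hpole w HwN Hwi r q h Hr Hq Hh Eh Ehw Hzm).
    - rewrite Hgi. discriminate. }
  assert (HzN : Cmod (z - p) < rN) by (unfold R1 in Q2; lra).
  destruct (logderiv_residue (g n) z) as [[Hgh Nz]|[Hwi [r [q [h [Hr [Hq [Hh [Eh [[Ehw Hzm]|[Ehw [Hgi [v [Hv [Hv0 Ev]]]]]]]]]]]]]]].
  - apply Hmero; lra.
  - apply Hvan; lra.
  - unfold phi, logderiv in Hzinf. rewrite logderiv_regular in Hzinf by assumption. discriminate.
  - exact (Hpole z HzN Hwi r q h Hr Hq Hh Eh Ehw Hzm).
  - assert (HLq : (L < q)%nat).
    { apply (Hn3 n M3 z Hz Hzinf r q h Hr Hh Eh). rewrite Ehw, Cmod_opp, Cmod_R. apply Rabs_right. apply Rle_ge, pos_INR. }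
    (* The reciprocal of [g n] has logarithmic derivative [- phi n] and a zero of order [q] at
       [z]. *)
    assert (X : 1 <= decay_const M R1 * (3 / 7) ^ q).
    { apply (zero_order_bound (fun w => / fin (g n w))%C (fun w => - fin (phi n w))%C (fun w => 1 / v w)%C p z R1 M r q);
        try lra; try exact HG.
      - intros w Hw.
        assert (HwN : Cmod (w - p) < rN) by (unfold R1 in Hw; lra).
        destruct (Hn2 n M2 w) as [H1 H2]; [lra|].
        destruct (logderiv_finite (g n) w) as [D1 [D2 D3]].
        + apply Hmero; lra.
        + apply Hvan; lra.
        + exact H1.
        + split; [|split].
          * eapply is_cd_val; [apply (is_cd_inv (fun w => fin (g n w))); eassumption|]. unfold phi. field. exact D2.
          * rewrite Cmod_opp. exact H2.
          * intros E. assert (Y : (fin (g n w) * / fin (g n w))%C = RtoC 1) by now apply Cinv_r.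
            rewrite E, Cmult_0_r in Y. injection Y. lra.
      - apply holB_div; auto using holB_const.
      - intros w Hw. rewrite (Ev w Hw). cbn [fin]. destruct Hw as [W1 W2]. assert (N1 := Cminus_neq_0 _ _ W1).
        field. split; [now apply Hv0|now apply Cpow_nz]. }
    specialize (HL q ltac:(lia)). rewrite Rabs_right in HL by (apply Rle_ge, pow_le; lra).
    apply Rmult_lt_compat_l with (r := decay_const M R1) in HL; [|exact HDC].
    rewrite Rinv_r in HL by lra. lra.
Qed.

(** The conclusion covers a regular point and a simple pole by one bound on [F(w) (w - p)], which is
    the form in which Gronwall uses it. *)
Theorem limit_simple_pole (g : nat -> C -> sphere) (F : C -> sphere) (p : C) (R0 : R) (N : nat) :
  0 < R0 ->
  (forall n z, Cmod (z - p) < R0 -> mero_at (g n) z) ->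
  (forall n z, Cmod (z - p) < R0 -> ~ vanishes_near (fun w => fin (g n w)) z) ->
  (forall n z k, Cmod (z - p) < R0 -> zero_of_mult (g n) z k -> (k <= N)%nat) ->
  mero_at F p ->
  ucv_sph (fun w => Cmod (w - p) < R0) (fun n => logderiv (g n)) F ->
  exists r M, 0 < r /\ r <= R0 /\ 0 <= M /\
    forall w, punctured p r w -> F w <> Inf /\ Cmod (fin (F w)) * Cmod (w - p) <= M.
Proof.
  intros HR Hmero Hvan Hmult HF Hcv.
  destruct HF as [HF|HF].
  - assert (HF' := HF). apply holomorphic_at_iff in HF'. destruct HF' as [r [Hr H]].
    destruct (bounded_near (fun w => fin (F w)) p r Hr) as [r' [B [Hr' [Hrr [HB K]]]]].
    { eapply is_cd_ccont. now apply holomorphic_mderiv. }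
    exists (Rmin r' R0), (B * r'). split; [now apply Rmin_glb_lt|]. split; [apply Rmin_r|].
    split; [apply Rmult_le_pos; lra|]. intros w [W1 W2].
    assert (A := Rmin_l r' R0). split; [apply H; lra|].
    apply Rmult_le_compat; try apply Cmod_ge_0; [apply K; lra|lra].
  - destruct (pole_form F p HF) as [r1 [k [u [Hr1 [Hk [Hu [Hu0 [Hp E]]]]]]]].
    destruct k as [|[|i]]; [lia| |].
    + destruct (bounded_near u p r1 Hr1) as [r' [B [Hr' [Hrr [HB K]]]]].
      { eapply holB_ccont; [exact Hu|]. now apply Cmod_center. }
      exists (Rmin r' R0), B. split; [now apply Rmin_glb_lt|]. split; [apply Rmin_r|].
      split; [lra|]. intros w [W1 W2].
      assert (A := Rmin_l r' R0). assert (W3 : Cmod (w - p) < r1) by lra.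
      rewrite (E w (conj W1 W3)). split; [discriminate|]. cbn [fin Cpow].
      assert (N1 := Cminus_neq_0 _ _ W1).
      rewrite <- Cmod_mult. replace (u w / ((w - p) * 1) * (w - p))%C with (u w) by (field; exact N1).
      apply K. lra.
    + exfalso. eapply (no_higher_pole g F p R0 N r1 i u); eassumption.
Qed.

(** * The companion system *)

(* With [c = 1] this is the system satisfied by a function and its first two derivatives
   when [phi] is the logarithmic derivative of the second one; with [c = 0] and [x = 0] it
   describes only the pair [(y, z)]. *)
Definition companion (c : C) (phi x y z : C -> C) (A : C -> Prop) : Prop :=
  forall w, A w -> is_cd x w (c * y w)%C /\ is_cd y w (z w) /\ is_cd z w (phi w * z w)%C.

Definition segment (a b : C) (w : C) : Prop := exists t, 0 <= t <= 1 /\ w = seg a b t.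

Lemma sq3_ge_0 x y z : 0 <= sq3 x y z.
Proof.
  unfold sq3. assert (A := pow2_ge_0 (Cmod x)). assert (B := pow2_ge_0 (Cmod y)).
  assert (D := pow2_ge_0 (Cmod z)). lra.
Qed.

Lemma sq3_bound x y z e : 0 <= e -> sq3 x y z <= e ^ 2 -> Cmod x <= e /\ Cmod y <= e /\ Cmod z <= e.
Proof.
  unfold sq3. intros He H. assert (A := pow2_ge_0 (Cmod x)). assert (B := pow2_ge_0 (Cmod y)).
  assert (D := pow2_ge_0 (Cmod z)).
  assert (G : forall u, 0 <= u -> u ^ 2 <= e ^ 2 -> u <= e).
  { intros u Hu K. apply Rsqr_incr_0_var; [|exact He]. unfold Rsqr. simpl in K. lra. }
  repeat split; apply G; try apply Cmod_ge_0; lra.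
Qed.

Lemma sq3_le x y z e : Cmod x <= e -> Cmod y <= e -> Cmod z <= e -> sq3 x y z <= 3 * e ^ 2.
Proof.
  intros H1 H2 H3. unfold sq3.
  assert (G : forall u, Cmod u <= e -> Cmod u ^ 2 <= e ^ 2).
  { intros u Hu. apply pow_incr. split; [apply Cmod_ge_0|exact Hu]. }
  specialize (G x H1) as G1. specialize (G y H2) as G2. specialize (G z H3) as G3. lra.
Qed.

(** The difference of the two solutions solves the first system up to the forcing term
    [(f - f') z'], of size at most [eta * S]. Parametrising the segment by [0, 1] multiplies the
    coefficients by [Cmod (b - a)]. *)
Lemma companion_diff (c : C) (f x y z f' x' y' z' : C -> C) (a b : C) (K eta S : R) :
  Cmod c <= 1 -> 1 <= K -> 0 <= eta -> 0 <= S ->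
  companion c f x y z (segment a b) -> companion c f' x' y' z' (segment a b) ->
  (forall w, segment a b w -> Cmod (f w) <= K /\ Cmod (f w - f' w) <= eta /\ Cmod (z' w) <= S) ->
  forall t, 0 <= t <= 1 -> let w := seg a b t in
  sq3 (x w - x' w)%C (y w - y' w)%C (z w - z' w)%C
  <= (sq3 (x a - x' a)%C (y a - y' a)%C (z a - z' a)%C + 3 * (eta * S * Cmod (b - a)) ^ 2)
     * exp (6 * (K * Cmod (b - a)) + 1).
Proof.
  intros Hc HK He HS H H' Hb t Ht w.
  assert (Hd := Cmod_ge_0 (b - a)%C). set (d := Cmod (b - a)) in *.
  assert (HKd : 0 <= K * d) by (apply Rmult_le_pos; lra).
  assert (HeS : 0 <= eta * S) by (apply Rmult_le_pos; lra).
  assert (Hes : 0 <= eta * S * d) by (apply Rmult_le_pos; lra).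
  assert (Seg : forall s, 0 <= s <= t -> segment a b (seg a b s)).
  { intros s Hs. exists s. split; [lra|reflexivity]. }
  eapply Rle_trans.
  - apply (gronwall3
      (fun s => x (seg a b s) - x' (seg a b s))%C (fun s => y (seg a b s) - y' (seg a b s))%C
      (fun s => z (seg a b s) - z' (seg a b s))%C
      (fun s => (c * y (seg a b s) - c * y' (seg a b s)) * (b - a))%C
      (fun s => (z (seg a b s) - z' (seg a b s)) * (b - a))%C
      (fun s => (f (seg a b s) * z (seg a b s) - f' (seg a b s) * z' (seg a b s)) * (b - a))%C
      t (K * d) (eta * S * d)); try lra.
    + intros s Hs. apply (pder_comp (fun w => x w - x' w)%C (seg a b)); [|apply pder_seg].
      apply is_cd_minus; [apply H|apply H']; auto.
    + intros s Hs. apply (pder_comp (fun w => y w - y' w)%C (seg a b)); [|apply pder_seg].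
      apply is_cd_minus; [apply H|apply H']; auto.
    + intros s Hs. apply (pder_comp (fun w => z w - z' w)%C (seg a b)); [|apply pder_seg].
      apply is_cd_minus; [apply H|apply H']; auto.
    + intros s Hs. set (v := seg a b s).
      replace ((c * y v - c * y' v) * (b - a))%C with (c * (y v - y' v) * (b - a))%C by ring.
      rewrite !Cmod_mult. fold d.
      assert (P1 := Cmod_ge_0 (x v - x' v)%C). assert (P2 := Cmod_ge_0 (y v - y' v)%C).
      assert (P3 := Cmod_ge_0 (z v - z' v)%C). assert (Pc := Cmod_ge_0 c).
      assert (Cmod c * Cmod (y v - y' v) * d <= K * d * Cmod (y v - y' v)).
      { replace (Cmod c * Cmod (y v - y' v) * d) with (Cmod c * (d * Cmod (y v - y' v))) by ring.
        rewrite Rmult_assoc. apply Rmult_le_compat_r; [apply Rmult_le_pos; lra|lra]. }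
      assert (0 <= K * d * Cmod (x v - x' v)) by (apply Rmult_le_pos; lra).
      assert (0 <= K * d * Cmod (z v - z' v)) by (apply Rmult_le_pos; lra).
      lra.
    + intros s Hs. set (v := seg a b s). rewrite Cmod_mult. fold d.
      assert (P1 := Cmod_ge_0 (x v - x' v)%C). assert (P2 := Cmod_ge_0 (y v - y' v)%C).
      assert (P3 := Cmod_ge_0 (z v - z' v)%C).
      assert (Cmod (z v - z' v) * d <= K * d * Cmod (z v - z' v)).
      { rewrite Rmult_comm. apply Rmult_le_compat_r; nra. }
      assert (0 <= K * d * Cmod (x v - x' v)) by (apply Rmult_le_pos; lra).
      assert (0 <= K * d * Cmod (y v - y' v)) by (apply Rmult_le_pos; lra).
      lra.
    + intros s Hs. set (v := seg a b s). destruct (Hb v (Seg s Hs)) as [B1 [B2 B3]].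
      replace ((f v * z v - f' v * z' v) * (b - a))%C with
        ((f v * (z v - z' v)) * (b - a) + (f v - f' v) * z' v * (b - a))%C by ring.
      eapply Rle_trans; [apply Cmod_triangle|]. rewrite !Cmod_mult. fold d.
      assert (P1 := Cmod_ge_0 (x v - x' v)%C). assert (P2 := Cmod_ge_0 (y v - y' v)%C).
      assert (P3 := Cmod_ge_0 (z v - z' v)%C).
      assert (Cmod (f v) * Cmod (z v - z' v) * d <= K * d * Cmod (z v - z' v)).
      { replace (Cmod (f v) * Cmod (z v - z' v) * d) with (Cmod (f v) * (d * Cmod (z v - z' v))) by ring.
        rewrite Rmult_assoc. apply Rmult_le_compat_r; [apply Rmult_le_pos; lra|lra]. }
      assert (Cmod (f v - f' v) * Cmod (z' v) * d <= eta * S * d).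
      { apply Rmult_le_compat_r; [lra|]. apply Rmult_le_compat; auto using Cmod_ge_0. }
      assert (0 <= K * d * Cmod (x v - x' v)) by (apply Rmult_le_pos; lra).
      assert (0 <= K * d * Cmod (y v - y' v)) by (apply Rmult_le_pos; lra).
      lra.
  - rewrite seg_0. apply Rmult_le_compat_l.
    + assert (A := sq3_ge_0 (x a - x' a)%C (y a - y' a)%C (z a - z' a)%C).
      assert (B := pow2_ge_0 (eta * S * d)). lra.
    + assert ((6 * (K * d) + 1) * t <= 6 * (K * d) + 1) by nra.
      destruct H0 as [H0|H0]; [left; now apply exp_increasing|right; now rewrite H0].
Qed.

Lemma companion_zero (c : C) (f : C -> C) (A : C -> Prop) :
  companion c f (fun _ => RtoC 0) (fun _ => RtoC 0) (fun _ => RtoC 0) A.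
Proof.
  intros w _. repeat split; (eapply is_cd_val; [apply is_cd_const|ring]).
Qed.

Lemma companion_bound (c : C) (f x y z : C -> C) (a b : C) (K : R) :
  Cmod c <= 1 -> 1 <= K -> companion c f x y z (segment a b) ->
  (forall w, segment a b w -> Cmod (f w) <= K) ->
  forall t, 0 <= t <= 1 -> let w := seg a b t in
  sq3 (x w) (y w) (z w) <= sq3 (x a) (y a) (z a) * exp (6 * (K * Cmod (b - a)) + 1).
Proof.
  intros Hc HK H Hf t Ht w.
  (* Comparison with the zero solution of the same system, for which there is no forcing term. *)
  assert (X := companion_diff c f x y z f (fun _ => RtoC 0) (fun _ => RtoC 0) (fun _ => RtoC 0) a b K 0 0
    Hc HK (Rle_refl 0) (Rle_refl 0) H (companion_zero c f _)).
  assert (E : forall v : C, (v - 0)%C = v) by (intros v; ring).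
  cbv zeta beta in X.
  assert (Y := X ltac:(intros v Hv; rewrite Cmod_minus_diag, Cmod_0; split; [now apply Hf|lra]) t Ht).
  rewrite !E in Y. fold w in Y. replace (3 * (0 * 0 * Cmod (b - a)) ^ 2) with 0 in Y by ring.
  rewrite Rplus_0_r in Y. exact Y.
Qed.

(** * Limits of sequences, uniform limits and their derivatives *)

Definition tends (u : nat -> C) (l : C) : Prop :=
  forall eps, 0 < eps -> exists n0, forall n, (n0 <= n)%nat -> Cmod (u n - l) <= eps.

Definition cauchy_seq (u : nat -> C) : Prop :=
  forall eps, 0 < eps -> exists n0, forall n m, (n0 <= n)%nat -> (n0 <= m)%nat -> Cmod (u n - u m) <= eps.

Definition ucv (A : C -> Prop) (f : nat -> C -> C) (g : C -> C) : Prop :=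
  forall eps, 0 < eps -> exists n0, forall n, (n0 <= n)%nat ->
    forall w, A w -> Cmod (f n w - g w) <= eps.

Lemma cauchy_seq_tends (u : nat -> C) : cauchy_seq u -> exists l, tends u l.
Proof.
  intros H.
  assert (C1 : Cauchy_crit (fun n => fst (u n))).
  { intros eps Heps. destruct (H (eps / 2)) as [n0 Hn]; [lra|]. exists n0. intros n m Hn1 Hm1.
    unfold Rdist. eapply Rle_lt_trans; [apply (fst_le_Cmod (u n - u m))|].
    specialize (Hn n m Hn1 Hm1). lra. }
  assert (C2 : Cauchy_crit (fun n => snd (u n))).
  { intros eps Heps. destruct (H (eps / 2)) as [n0 Hn]; [lra|]. exists n0. intros n m Hn1 Hm1.
    unfold Rdist. eapply Rle_lt_trans; [apply (snd_le_Cmod (u n - u m))|].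
    specialize (Hn n m Hn1 Hm1). lra. }
  destruct (Rcomplete.R_complete _ C1) as [l1 L1]. destruct (Rcomplete.R_complete _ C2) as [l2 L2].
  exists (l1, l2). intros eps Heps.
  destruct (L1 (eps / 2)) as [n1 N1]; [lra|]. destruct (L2 (eps / 2)) as [n2 N2]; [lra|].
  exists (n1 + n2)%nat. intros n Hn. eapply Rle_trans; [apply Cmod_le_fst_snd|]. simpl.
  specialize (N1 n ltac:(lia)). specialize (N2 n ltac:(lia)). unfold Rdist, Rminus in *. lra.
Qed.

Lemma tends_cauchy (u : nat -> C) (l : C) : tends u l -> cauchy_seq u.
Proof.
  intros H eps Heps. destruct (H (eps / 2)) as [n0 Hn]; [lra|]. exists n0. intros n m Hn1 Hm1.
  assert (T := Cmod_dist_triangle (u n) l (u m)). rewrite (Cmod_minus_sym l) in T.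
  assert (A := Hn n Hn1). assert (B := Hn m Hm1). lra.
Qed.

Lemma Cmod_limit_le (x : C) (B : R) : (forall eps, 0 < eps -> Cmod x <= B + eps) -> Cmod x <= B.
Proof. intros H. apply Rnot_lt_le. intros K. specialize (H ((Cmod x - B) / 2)). lra. Qed.

Lemma tends_unique (u : nat -> C) (l l' : C) : tends u l -> tends u l' -> l = l'.
Proof.
  intros H1 H2. assert (Cmod (l - l') <= 0).
  { apply Cmod_limit_le. intros eps Heps. destruct (H1 (eps / 2)) as [n1 N1]; [lra|].
    destruct (H2 (eps / 2)) as [n2 N2]; [lra|].
    specialize (N1 (n1 + n2)%nat ltac:(lia)). specialize (N2 (n1 + n2)%nat ltac:(lia)).
    assert (T := Cmod_dist_triangle l (u (n1 + n2)%nat) l'). rewrite (Cmod_minus_sym l (u _)) in T. lra. }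
  apply Cmod_le_0 in H. replace l with ((l - l') + l')%C by ring. rewrite H. ring.
Qed.

Definition climit (u : nat -> C) : C := epsilon (inhabits (RtoC 0)) (tends u).

Lemma climit_spec (u : nat -> C) : cauchy_seq u -> tends u (climit u).
Proof. intros H. unfold climit. apply epsilon_spec. now apply cauchy_seq_tends. Qed.

Lemma ucauchy_ucv (A : C -> Prop) (f : nat -> C -> C) :
  (forall eps, 0 < eps -> exists n0, forall n m, (n0 <= n)%nat -> (n0 <= m)%nat ->
     forall w, A w -> Cmod (f n w - f m w) <= eps) ->
  ucv A f (fun w => climit (fun n => f n w)).
Proof.
  intros H eps Heps. destruct (H eps Heps) as [n0 Hn]. exists n0. intros n Hn1 w Hw.
  assert (Hc : cauchy_seq (fun n => f n w)).
  { intros e He. destruct (H e He) as [n1 Hn1']. exists n1. intros i j Hi Hj. now apply Hn1'. }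
  apply climit_spec in Hc. apply Cmod_limit_le. intros e He.
  destruct (Hc e He) as [n2 Hn2].
  specialize (Hn2 (n0 + n2)%nat ltac:(lia)). specialize (Hn n (n0 + n2)%nat Hn1 ltac:(lia) w Hw).
  assert (T := Cmod_dist_triangle (f n w) (f (n0 + n2)%nat w) (climit (fun n => f n w))). lra.
Qed.

Lemma ucv_tends A f g w : ucv A f g -> A w -> tends (fun n => f n w) (g w).
Proof. intros H Hw eps Heps. destruct (H eps Heps) as [n0 Hn]. exists n0. intros n Hn1. now apply Hn. Qed.

Lemma ucv_ccont (w : C) (s : R) (f : nat -> C -> C) (g : C -> C) :
  0 < s -> ucv (fun v => Cmod (v - w) < s) f g ->
  (exists n0, forall n, (n0 <= n)%nat -> ccont (f n) w) -> ccont g w.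
Proof.
  intros Hs H [n0 Hc] eps Heps. destruct (H (eps / 4)) as [n1 Hn1]; [lra|].
  destruct (Hc (n0 + n1)%nat ltac:(lia) (eps / 4)) as [d [Hd K]]; [lra|].
  exists (Rmin s d). split; [now apply Rmin_glb_lt|]. intros v Hv.
  assert (A := Rmin_l s d). assert (B := Rmin_r s d).
  assert (X1 := Hn1 (n0 + n1)%nat ltac:(lia) v ltac:(lra)).
  assert (X2 := Hn1 (n0 + n1)%nat ltac:(lia) w (Cmod_center w s Hs)).
  specialize (K v ltac:(lra)). rewrite Cmod_minus_sym in X1.
  assert (T1 := Cmod_dist_triangle (g v) (f (n0 + n1)%nat v) (g w)).
  assert (T2 := Cmod_dist_triangle (f (n0 + n1)%nat v) (f (n0 + n1)%nat w) (g w)). lra.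
Qed.

(** The mean value inequality bounds the linearisation error of [f n] at [w] uniformly in [n], so
    the bound survives the pointwise limit. The two errors [eps / 12] and the factor 3 leave
    [eps / 2]. *)
Lemma limit_derivative (w : C) (s : R) (f df : nat -> C -> C) (g dg : C -> C) :
  0 < s -> (forall v, Cmod (v - w) < s -> tends (fun n => f n v) (g v)) ->
  ucv (fun v => Cmod (v - w) < s) df dg -> ccont dg w ->
  (exists n0, forall n, (n0 <= n)%nat -> forall v, Cmod (v - w) < s -> is_cd (f n) v (df n v)) ->
  is_cd g w (dg w).
Proof.
  intros Hs Hf Hdf Hc [n0 Hd] eps Heps.
  destruct (Hc (eps / 12)) as [d [Hd0 K]]; [lra|].
  assert (A := Rmin_l s d). assert (B := Rmin_r s d).
  exists (Rmin s d). split; [now apply Rmin_glb_lt|]. intros v Hv.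
  destruct (Hdf (eps / 12)) as [n1 Hn1]; [lra|].
  assert (Hh := Cmod_ge_0 (v - w)%C). set (h := Cmod (v - w)) in *.
  assert (Mv : forall n, (n0 + n1 <= n)%nat ->
    Cmod (f n v - f n w - dg w * (v - w)) <= 3 * (eps / 6) * h).
  { intros n Hn. assert (Sb : forall t, 0 <= t <= 1 -> Cmod (seg w v t - w) < Rmin s d).
    { intros t Ht. apply seg_ball; [exact Ht| |exact Hv]. apply Cmod_center. now apply Rmin_glb_lt. }
    apply (mean_value (f n) (df n)); [lra| |].
    - intros t Ht. apply Hd; [lia|]. specialize (Sb t Ht). lra.
    - intros t Ht. specialize (Sb t Ht).
      assert (X1 := Hn1 n ltac:(lia) (seg w v t) ltac:(lra)).
      assert (X2 := K (seg w v t) ltac:(lra)).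
      assert (T := Cmod_dist_triangle (df n (seg w v t)) (dg (seg w v t)) (dg w)). lra. }
  apply Rle_trans with (3 * (eps / 6) * h); [|nra].
  apply Cmod_limit_le. intros e He.
  destruct (Hf v ltac:(unfold h in *; lra) (e / 2)) as [n2 N2]; [lra|].
  destruct (Hf w (Cmod_center w s Hs) (e / 2)) as [n3 N3]; [lra|].
  set (n := (n0 + n1 + n2 + n3)%nat).
  specialize (Mv n ltac:(lia)). specialize (N2 n ltac:(lia)). specialize (N3 n ltac:(lia)).
  replace (g v - g w - dg w * (v - w))%C with
    ((f n v - f n w - dg w * (v - w)) - ((f n v - g v) - (f n w - g w)))%C by ring.
  eapply Rle_trans; [apply Cmod_minus_le|].
  assert (T := Cmod_minus_le (f n v - g v)%C (f n w - g w)%C). lra.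
Qed.

Lemma ccont_mult (f g : C -> C) (z : C) : ccont f z -> ccont g z -> ccont (fun w => f w * g w)%C z.
Proof.
  intros Hf Hg eps Heps.
  set (M := Cmod (f z) + Cmod (g z) + 1).
  assert (P1 := Cmod_ge_0 (f z)). assert (P2 := Cmod_ge_0 (g z)).
  assert (HM : 1 <= M) by (unfold M; lra).
  set (e := Rmin 1 (eps / (2 * M))).
  assert (He : 0 < e). { apply Rmin_glb_lt; [lra|]. apply Rdiv_lt_0_compat; lra. }
  assert (He1 : e <= 1) by apply Rmin_l.
  assert (He2 : e * (2 * M) <= eps).
  { apply Rle_trans with (eps / (2 * M) * (2 * M)); [apply Rmult_le_compat_r; [lra|apply Rmin_r]|].
    right. field. lra. }
  destruct (Hf e He) as [d1 [Hd1 K1]]. destruct (Hg e He) as [d2 [Hd2 K2]].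
  exists (Rmin d1 d2). split; [now apply Rmin_glb_lt|]. intros w Hw.
  assert (A := Rmin_l d1 d2). assert (B := Rmin_r d1 d2).
  specialize (K1 w ltac:(lra)). specialize (K2 w ltac:(lra)).
  replace (f w * g w - f z * g z)%C with
    ((f w - f z) * (g w - g z) + ((f w - f z) * g z + f z * (g w - g z)))%C by ring.
  eapply Rle_lt_trans; [apply Cmod_triangle|].
  eapply Rle_lt_trans; [apply Rplus_le_compat_l, Cmod_triangle|]. rewrite !Cmod_mult.
  assert (Q1 := Cmod_ge_0 (f w - f z)%C). assert (Q2 := Cmod_ge_0 (g w - g z)%C).
  assert (Cmod (f w - f z) * Cmod (g w - g z) <= e * 1) by (apply Rmult_le_compat; lra).
  assert (Cmod (f w - f z) * Cmod (g z) <= e * Cmod (g z)) by (apply Rmult_le_compat_r; lra).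
  assert (Cmod (f z) * Cmod (g w - g z) <= Cmod (f z) * e) by (apply Rmult_le_compat_l; lra).
  assert (e * 1 + (e * Cmod (g z) + Cmod (f z) * e) = e * M) by (unfold M; ring).
  assert (0 < e * M) by (apply Rmult_lt_0_compat; lra). lra.
Qed.

(** * Sequences of solutions on a punctured disc *)

Definition annulus (p : C) (d r : R) (w : C) : Prop := d <= Cmod (w - p) < r.

(** The index [n0] depends on the inner radius [d]: singularities of the n-th solution may lie near
    [p] for every [n], and are only eventually absent from each annulus. *)
Definition cvg_system (c p : C) (r0 : R) (phi : nat -> C -> C) (F : C -> C) (x y z : nat -> C -> C) : Prop :=
  forall d eta, 0 < d -> 0 < eta -> exists n0, forall n, (n0 <= n)%nat ->
    companion c (phi n) (x n) (y n) (z n) (annulus p d r0) /\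
    forall w, annulus p d r0 w -> Cmod (phi n w - F w) <= eta.

Lemma companion_sub c f x y z (A B : C -> Prop) :
  (forall w, A w -> B w) -> companion c f x y z B -> companion c f x y z A.
Proof. intros H K w Hw. apply K. auto. Qed.

Lemma segment_start a b : segment a b a.
Proof. exists 0. split; [lra|]. now rewrite seg_0. Qed.
Lemma segment_end a b : segment a b b.
Proof. exists 1. split; [lra|]. now rewrite seg_1. Qed.

(** Convergence at the single point [a] spreads uniformly over [A]. Before two solutions can be
    compared, [companion_bound] has to bound [z m] along the segments by a constant [S] independent
    of [m]; the forcing term is then as small as [phi n - phi m]. *)
Lemma propagate (c p : C) (r0 M d : R) phi F x y z (a : C) (A : C -> Prop) :
  Cmod c <= 1 -> 0 < r0 -> 0 <= M -> 0 < d ->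
  (forall w, punctured p r0 w -> Cmod (F w) * Cmod (w - p) <= M) ->
  cvg_system c p r0 phi F x y z ->
  (forall b, A b -> forall w, segment a b w -> annulus p d r0 w) ->
  cauchy_seq (fun n => x n a) -> cauchy_seq (fun n => y n a) -> cauchy_seq (fun n => z n a) ->
  forall eps, 0 < eps -> exists n0, forall n m, (n0 <= n)%nat -> (n0 <= m)%nat -> forall b, A b ->
    Cmod (x n b - x m b) <= eps /\ Cmod (y n b - y m b) <= eps /\ Cmod (z n b - z m b) <= eps.
Proof.
  intros Hc Hr HM Hd HF Hsys HA Cx Cy Cz eps Heps.
  set (K := M / d + 2).
  assert (HMd : 0 <= M / d). { apply Rmult_le_pos; [exact HM|]. apply Rlt_le. now apply Rinv_0_lt_compat. }
  assert (HK : 1 <= K) by (unfold K; lra).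
  set (E := exp (6 * (K * (2 * r0)) + 1)).
  assert (HKr : 0 <= K * (2 * r0)) by (apply Rmult_le_pos; lra).
  assert (HE : 1 <= E) by (apply exp_ge_1; lra).
  destruct (Cx 1 Rlt_0_1) as [n1 N1]. destruct (Cy 1 Rlt_0_1) as [n2 N2]. destruct (Cz 1 Rlt_0_1) as [n3 N3].
  set (B := Cmod (x n1 a) + Cmod (y n2 a) + Cmod (z n3 a) + 1).
  assert (P1 := Cmod_ge_0 (x n1 a)). assert (P2 := Cmod_ge_0 (y n2 a)). assert (P3 := Cmod_ge_0 (z n3 a)).
  assert (HB : 1 <= B) by (unfold B; lra).
  set (S := 3 * B * E).
  assert (HS : 0 < S) by (unfold S; repeat apply Rmult_lt_0_compat; lra).
  set (eta := eps / (6 * E * (S + 1) * r0)).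
  assert (HD : 0 < 6 * E * (S + 1) * r0) by (repeat apply Rmult_lt_0_compat; lra).
  assert (Heta : 0 < eta) by (apply Rdiv_lt_0_compat; lra).
  (* The initial difference and the forcing term each contribute at most [3 e^2] to the squared
     norm, and [6 e^2 E <= eps^2]. *)
  set (e := eps / (3 * E)).
  assert (He : 0 < e) by (apply Rdiv_lt_0_compat; lra).
  destruct (Hsys d 1 Hd Rlt_0_1) as [n4 N4].
  destruct (Hsys d (eta / 2) Hd) as [n5 N5]; [lra|].
  destruct (Cx e He) as [n6 N6]. destruct (Cy e He) as [n7 N7]. destruct (Cz e He) as [n8 N8].
  set (n0 := (n1 + n2 + n3 + n4 + n5 + n6 + n7 + n8)%nat).
  exists n0. intros n m Hn Hm b Hb. unfold n0 in *.
  assert (Sg := HA b Hb).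
  assert (Hab : Cmod (b - a) <= 2 * r0).
  { destruct (Sg a (segment_start a b)) as [_ A1]. destruct (Sg b (segment_end a b)) as [_ A2].
    assert (T := Cmod_dist_triangle b p a). rewrite (Cmod_minus_sym p a) in T. lra. }
  assert (HFK : forall k, (n0 <= k)%nat -> forall w, segment a b w -> Cmod (phi k w) <= K).
  { intros k Hk w Hw. unfold n0 in Hk. destruct (N4 k ltac:(lia)) as [_ H4].
    assert (Hw' := Sg w Hw). assert (X := H4 w Hw'). destruct Hw' as [W1 W2].
    assert (Hpw : punctured p r0 w). { split; [|exact W2]. intros ->. rewrite Cmod_minus_diag in W1. lra. }
    assert (Y := HF w Hpw). assert (Z := Cmod_minus_ge (phi k w) (F w)).
    assert (Cmod (F w) <= M / d).
    { apply Rle_div_r; [exact Hd|]. eapply Rle_trans; [|exact Y]. apply Rmult_le_compat_l; [apply Cmod_ge_0|lra]. }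
    unfold K. lra. }
  assert (Hcomp : forall k, (n0 <= k)%nat -> companion c (phi k) (x k) (y k) (z k) (segment a b)).
  { intros k Hk. unfold n0 in Hk. destruct (N4 k ltac:(lia)) as [H4 _]. eapply companion_sub; [|exact H4]. exact Sg. }
  assert (HE' : exp (6 * (K * Cmod (b - a)) + 1) <= E).
  { unfold E. assert (X : K * Cmod (b - a) <= K * (2 * r0)) by (apply Rmult_le_compat_l; lra).
    destruct X as [X| ->]; [left; apply exp_increasing; lra|right; reflexivity]. }
  assert (HzS : forall w, segment a b w -> Cmod (z m w) <= S).
  { intros w [t [Ht ->]].
    assert (X := companion_bound c (phi m) (x m) (y m) (z m) a b K Hc HK (Hcomp m Hm) (HFK m Hm) t Ht).
    cbv zeta in X.
    assert (Hs3 : sq3 (x m a) (y m a) (z m a) <= 3 * B ^ 2).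
    { apply sq3_le.
      - assert (Y := N1 m n1 ltac:(lia) ltac:(lia)). assert (Z := Cmod_minus_ge (x m a) (x n1 a)). unfold B. lra.
      - assert (Y := N2 m n2 ltac:(lia) ltac:(lia)). assert (Z := Cmod_minus_ge (y m a) (y n2 a)). unfold B. lra.
      - assert (Y := N3 m n3 ltac:(lia) ltac:(lia)). assert (Z := Cmod_minus_ge (z m a) (z n3 a)). unfold B. lra. }
    apply (sq3_bound (x m (seg a b t)) (y m (seg a b t)) (z m (seg a b t)) S); [lra|].
    eapply Rle_trans; [exact X|].
    apply Rle_trans with (3 * B ^ 2 * E).
    - apply Rmult_le_compat; [apply sq3_ge_0|left; apply exp_pos|exact Hs3|exact HE'].
    - unfold S. replace ((3 * B * E) ^ 2) with (3 * B ^ 2 * E * (3 * E)) by ring.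
      assert (0 < 3 * B ^ 2 * E). { assert (0 < B ^ 2) by (apply pow_lt; lra). repeat apply Rmult_lt_0_compat; lra. }
      nra. }
  assert (Hphi : forall w, segment a b w ->
    Cmod (phi n w) <= K /\ Cmod (phi n w - phi m w) <= eta /\ Cmod (z m w) <= S).
  { intros w Hw. split; [now apply HFK|]. split; [|now apply HzS].
    destruct (N5 n ltac:(lia)) as [_ U1]. destruct (N5 m ltac:(lia)) as [_ U2].
    assert (V1 := U1 w (Sg w Hw)). assert (V2 := U2 w (Sg w Hw)).
    assert (T := Cmod_dist_triangle (phi n w) (F w) (phi m w)).
    rewrite (Cmod_minus_sym (F w)) in T. lra. }
  assert (Y := companion_diff c (phi n) (x n) (y n) (z n) (phi m) (x m) (y m) (z m) a b K eta S
     Hc HK ltac:(lra) ltac:(lra) (Hcomp n Hn) (Hcomp m Hm) Hphi 1 ltac:(lra)).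
  cbv zeta in Y. rewrite seg_1 in Y.
  apply sq3_bound; [lra|]. eapply Rle_trans; [exact Y|].
  assert (Hs3 : sq3 (x n a - x m a)%C (y n a - y m a)%C (z n a - z m a)%C <= 3 * e ^ 2).
  { apply sq3_le; [apply N6|apply N7|apply N8]; lia. }
  assert (Hes : 0 <= eta * S * Cmod (b - a) <= e).
  { assert (Q := Cmod_ge_0 (b - a)%C). split; [apply Rmult_le_pos; [apply Rmult_le_pos; lra|exact Q]|].
    apply Rle_trans with (eta * S * (2 * r0)).
    - apply Rmult_le_compat_l; [apply Rmult_le_pos; lra|exact Hab].
    - apply Rle_trans with (eta * (S + 1) * (2 * r0)).
      + apply Rmult_le_compat_r; [lra|]. apply Rmult_le_compat_l; lra.
      + right. unfold eta, e. field. repeat split; lra. }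
  assert (Hes2 : (eta * S * Cmod (b - a)) ^ 2 <= e ^ 2) by (apply pow_incr; exact Hes).
  apply Rle_trans with ((3 * e ^ 2 + 3 * e ^ 2) * E).
  - apply Rmult_le_compat.
    + assert (U1 := sq3_ge_0 (x n a - x m a)%C (y n a - y m a)%C (z n a - z m a)%C).
      assert (U2 := pow2_ge_0 (eta * S * Cmod (b - a))). lra.
    + left. apply exp_pos.
    + lra.
    + exact HE'.
  - unfold e. replace ((3 * (eps / (3 * E)) ^ 2 + 3 * (eps / (3 * E)) ^ 2) * E) with (eps ^ 2 * (2 / 3 * / E)) by (field; lra).
    assert (/ E <= 1) by (rewrite <- Rinv_1; apply Rinv_le_contravar; lra).
    assert (0 <= eps ^ 2) by apply pow2_ge_0. nra.
Qed.

(** * Continuation along segments that avoid the puncture *)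

Definition same_half_plane (p a b : C) : Prop :=
  0 <= fst (a - p)%C * fst (b - p)%C + snd (a - p)%C * snd (b - p)%C.

Lemma same_half_plane_sym p a b : same_half_plane p a b -> same_half_plane p b a.
Proof. unfold same_half_plane. intros H. rewrite (Rmult_comm (fst (b - p)%C)), (Rmult_comm (snd (b - p)%C)). exact H. Qed.

(** When the angle between [a] and [b] seen from [p] is at most a right angle, the mixed term in the
    squared distance to [p] is nonnegative, so the segment stays at distance at least [m / 2] from
    [p]. *)
Lemma segment_annulus (p a b : C) (r0 m : R) :
  same_half_plane p a b -> 0 < m -> annulus p m r0 a -> annulus p m r0 b ->
  forall w, segment a b w -> annulus p (m / 2) r0 w.
Proof.
  intros H Hm [A1 A2] [B1 B2] w [t [Ht ->]]. split; [|now apply seg_ball].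
  set (al := (a - p)%C) in *. set (be := (b - p)%C) in *.
  assert (E : (seg a b t - p)%C = (RtoC (1 - t) * al + RtoC t * be)%C).
  { unfold seg, al, be. rewrite RtoC_minus. ring. }
  assert (Q : Cmod (seg a b t - p) ^ 2 = (1 - t) ^ 2 * Cmod al ^ 2 + t ^ 2 * Cmod be ^ 2
     + 2 * (t * (1 - t)) * (fst al * fst be + snd al * snd be)).
  { rewrite E, !Cmod2_alt. unfold Re, Im. simpl. ring. }
  assert (Hh : 0 <= t * (1 - t) * (fst al * fst be + snd al * snd be)).
  { apply Rmult_le_pos; [apply Rmult_le_pos; lra|exact H]. }
  assert (Ha2 : m ^ 2 <= Cmod al ^ 2) by (apply pow_incr; lra).
  assert (Hb2 : m ^ 2 <= Cmod be ^ 2) by (apply pow_incr; lra).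
  assert (Hm2 : 0 < m ^ 2) by (apply pow_lt; lra).
  assert (L : (m / 2) ^ 2 <= Cmod (seg a b t - p) ^ 2).
  { rewrite Q.
    assert (T1 : (1 - t) ^ 2 * m ^ 2 <= (1 - t) ^ 2 * Cmod al ^ 2) by (apply Rmult_le_compat_l; [apply pow2_ge_0|lra]).
    assert (T2 : t ^ 2 * m ^ 2 <= t ^ 2 * Cmod be ^ 2) by (apply Rmult_le_compat_l; [apply pow2_ge_0|lra]).
    assert (T3 : / 2 <= (1 - t) ^ 2 + t ^ 2) by (assert (U := pow2_ge_0 (2 * t - 1)); nra).
    assert (T4 : / 2 * m ^ 2 <= ((1 - t) ^ 2 + t ^ 2) * m ^ 2) by (apply Rmult_le_compat_r; lra).
    replace ((m / 2) ^ 2) with (/ 4 * m ^ 2) by field. nra. }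
  apply Rsqr_incr_0_var; [|apply Cmod_ge_0]. unfold Rsqr. simpl in L. lra.
Qed.

Definition quarter_turn (p a : C) (s : R) : C := (p + RtoC s * Ci * (a - p))%C.

Lemma quarter_turn_dist p a s : s = 1 \/ s = -1 -> Cmod (quarter_turn p a s - p) = Cmod (a - p).
Proof.
  intros Hs. unfold quarter_turn. replace (p + s * Ci * (a - p) - p)%C with (s * Ci * (a - p))%C by ring.
  rewrite !Cmod_mult, Cmod_Ci, Cmod_R. destruct Hs as [-> | ->].
  - rewrite Rabs_R1. ring.
  - rewrite Rabs_left by lra. ring.
Qed.

(** Turning [a] by a right angle towards the side of [b] gives an intermediate point at an angle of
    at most 90 degrees from both. The sign of the cross product [v] tells the side. *)
Lemma quarter_turn_link p a b : exists s, (s = 1 \/ s = -1) /\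
  same_half_plane p a (quarter_turn p a s) /\ same_half_plane p (quarter_turn p a s) b.
Proof.
  set (v := - snd (a - p)%C * fst (b - p)%C + fst (a - p)%C * snd (b - p)%C).
  assert (G : forall s, fst (quarter_turn p a s - p)%C = - s * snd (a - p)%C /\ snd (quarter_turn p a s - p)%C = s * fst (a - p)%C).
  { intros s. unfold quarter_turn. simpl. split; ring. }
  destruct (Rle_lt_dec 0 v) as [Hv|Hv].
  - exists 1. split; [now left|]. unfold same_half_plane. destruct (G 1) as [-> ->]. split; [right; ring|].
    unfold v in Hv. lra.
  - exists (-1). split; [now right|]. unfold same_half_plane. destruct (G (-1)) as [-> ->]. split; [right; ring|].
    unfold v in Hv. lra.
Qed.

(** A punctured disc is not convex, but two admissible segments join any two of its points. This
    replaces a connectedness argument and keeps the number of Gronwall steps bounded. *)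
Lemma punctured_chain (p : C) (r0 : R) (Q : C -> Prop) :
  (forall a b, punctured p r0 a -> punctured p r0 b -> same_half_plane p a b -> Q a -> Q b) ->
  forall a b, punctured p r0 a -> punctured p r0 b -> Q a -> Q b.
Proof.
  intros H a b Ha Hb Qa. destruct (quarter_turn_link p a b) as [s [Hs [H1 H2]]].
  assert (Hq : punctured p r0 (quarter_turn p a s)).
  { destruct Ha as [A1 A2]. assert (D := quarter_turn_dist p a s Hs). split; [|lra].
    intros E. rewrite E, Cmod_minus_diag in D. assert (X := Cmod_minus_gt_0 _ _ A1). lra. }
  apply (H (quarter_turn p a s) b); auto. apply (H a); auto.
Qed.

Lemma punctured_annulus p r0 a b : punctured p r0 a -> punctured p r0 b ->
  exists m, 0 < m /\ annulus p m r0 a /\ annulus p m r0 b.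
Proof.
  intros [A1 A2] [B1 B2]. exists (Rmin (Cmod (a - p)) (Cmod (b - p))).
  assert (X := Rmin_l (Cmod (a - p)) (Cmod (b - p))). assert (Y := Rmin_r (Cmod (a - p)) (Cmod (b - p))).
  split; [apply Rmin_glb_lt; now apply Cmod_minus_gt_0|]. unfold annulus. lra.
Qed.

Definition cauchy3 (x y z : nat -> C -> C) (w : C) : Prop :=
  cauchy_seq (fun n => x n w) /\ cauchy_seq (fun n => y n w) /\ cauchy_seq (fun n => z n w).

Lemma cauchy3_everywhere (c p : C) (r0 M : R) phi F x y z (a : C) :
  Cmod c <= 1 -> 0 < r0 -> 0 <= M ->
  (forall w, punctured p r0 w -> Cmod (F w) * Cmod (w - p) <= M) ->
  cvg_system c p r0 phi F x y z -> punctured p r0 a -> cauchy3 x y z a ->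
  forall b, punctured p r0 b -> cauchy3 x y z b.
Proof.
  intros Hc Hr HM HF Hsys Ha Ca b Hb.
  apply (punctured_chain p r0 (cauchy3 x y z)) with (a := a); auto.
  clear a Ha Ca b Hb. intros a b Ha Hb Hab [Cx [Cy Cz]].
  destruct (punctured_annulus p r0 a b Ha Hb) as [m [Hm [A1 A2]]].
  assert (P := propagate c p r0 M (m / 2) phi F x y z a (fun v => v = b) Hc Hr HM ltac:(lra) HF Hsys
    ltac:(intros v ->; now apply segment_annulus) Cx Cy Cz).
  repeat split; intros eps Heps; destruct (P eps Heps) as [n0 Hn]; exists n0; intros i j Hi Hj;
  apply (Hn i j Hi Hj b eq_refl).
Qed.

Definition lim_fun (x : nat -> C -> C) (w : C) : C := climit (fun n => x n w).

Lemma ball_in_annulus (p w : C) (r0 : R) : punctured p r0 w ->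
  exists s, 0 < s /\ forall v, Cmod (v - w) < s -> annulus p (Cmod (w - p) / 2) r0 v.
Proof.
  intros [W1 W2]. assert (H := Cmod_minus_gt_0 _ _ W1).
  exists (Rmin (Cmod (w - p) / 2) (r0 - Cmod (w - p))). split; [apply Rmin_glb_lt; lra|].
  intros v Hv.
  assert (A1 := Rmin_l (Cmod (w - p) / 2) (r0 - Cmod (w - p))).
  assert (A2 := Rmin_r (Cmod (w - p) / 2) (r0 - Cmod (w - p))).
  assert (T1 := Cmod_dist_triangle v w p). assert (T2 := Cmod_dist_triangle w v p).
  rewrite (Cmod_minus_sym w v) in T2. unfold annulus. lra.
Qed.

Lemma locally_uniform_limit (c p : C) (r0 M : R) phi F x y z (w : C) :
  Cmod c <= 1 -> 0 < r0 -> 0 <= M ->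
  (forall w, punctured p r0 w -> Cmod (F w) * Cmod (w - p) <= M) ->
  cvg_system c p r0 phi F x y z -> punctured p r0 w -> cauchy3 x y z w ->
  exists s, 0 < s /\ (forall v, Cmod (v - w) < s -> annulus p (Cmod (w - p) / 2) r0 v) /\
    ucv (fun v => Cmod (v - w) < s) x (lim_fun x) /\
    ucv (fun v => Cmod (v - w) < s) y (lim_fun y) /\
    ucv (fun v => Cmod (v - w) < s) z (lim_fun z).
Proof.
  intros Hc Hr HM HF Hsys Hw [Cx [Cy Cz]].
  destruct (ball_in_annulus p w r0 Hw) as [s [Hs Hsub]].
  exists s. split; [exact Hs|]. split; [exact Hsub|].
  assert (Hw0 := Cmod_minus_gt_0 _ _ (proj1 Hw)).
  assert (P := propagate c p r0 M (Cmod (w - p) / 2) phi F x y z w (fun v => Cmod (v - w) < s) Hc Hr HM ltac:(lra) HF Hsys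
    ltac:(intros v Hv u [t [Ht ->]]; apply Hsub; apply seg_ball; auto using Cmod_center) Cx Cy Cz).
  repeat split; apply ucauchy_ucv; intros eps Heps; destruct (P eps Heps) as [n0 Hn]; exists n0; intros i j Hi Hj v Hv;
  apply (Hn i j Hi Hj v Hv).
Qed.

Lemma limit_companion (c p : C) (r0 M : R) phi F x y z (a : C) :
  Cmod c <= 1 -> 0 < r0 -> 0 <= M ->
  (forall w, punctured p r0 w -> Cmod (F w) * Cmod (w - p) <= M) ->
  (forall w, punctured p r0 w -> ccont F w) ->
  cvg_system c p r0 phi F x y z -> punctured p r0 a -> cauchy3 x y z a ->
  companion c F (lim_fun x) (lim_fun y) (lim_fun z) (punctured p r0).
Proof.
  intros Hc Hr HM HF HFc Hsys Ha Ca w Hw.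
  assert (Cw := cauchy3_everywhere c p r0 M phi F x y z a Hc Hr HM HF Hsys Ha Ca w Hw).
  destruct (locally_uniform_limit c p r0 M phi F x y z w Hc Hr HM HF Hsys Hw Cw) as [s [Hs [Hsub [Ux [Uy Uz]]]]].
  assert (Hw0 := Cmod_minus_gt_0 _ _ (proj1 Hw)).
  destruct (Hsys (Cmod (w - p) / 2) 1 ltac:(lra) Rlt_0_1) as [n0 Hn0].
  assert (D : forall n, (n0 <= n)%nat -> forall v, Cmod (v - w) < s ->
    is_cd (x n) v (c * y n v)%C /\ is_cd (y n) v (z n v) /\ is_cd (z n) v (phi n v * z n v)%C).
  { intros n Hn v Hv. destruct (Hn0 n Hn) as [H _]. apply H. now apply Hsub. }
  assert (Yc : ccont (lim_fun y) w).
  { apply (ucv_ccont w s y); auto. exists n0. intros n Hn. eapply is_cd_ccont.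
    apply (D n Hn w (Cmod_center w s Hs)). }
  assert (Zc : ccont (lim_fun z) w).
  { apply (ucv_ccont w s z); auto. exists n0. intros n Hn. eapply is_cd_ccont.
    apply (D n Hn w (Cmod_center w s Hs)). }
  split; [|split].
  - apply (limit_derivative w s x (fun n v => c * y n v)%C (lim_fun x) (fun v => c * lim_fun y v)%C Hs).
    + intros v Hv. now apply (ucv_tends _ _ _ v Ux).
    + intros eps Heps. destruct (Uy eps Heps) as [n1 Hn1]. exists n1. intros n Hn v Hv.
      replace (c * y n v - c * lim_fun y v)%C with (c * (y n v - lim_fun y v))%C by ring.
      rewrite Cmod_mult. specialize (Hn1 n Hn v Hv). assert (A := Cmod_ge_0 (y n v - lim_fun y v)%C).
      assert (B := Cmod_ge_0 c). nra.
    + apply ccont_mult; [|exact Yc]. eapply is_cd_ccont. apply is_cd_const.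
    + exists n0. intros n Hn v Hv. now apply D.
  - apply (limit_derivative w s y z (lim_fun y) (lim_fun z) Hs); auto.
    + intros v Hv. now apply (ucv_tends _ _ _ v Uy).
    + exists n0. intros n Hn v Hv. now apply D.
  - set (K := 2 * M / Cmod (w - p)).
    assert (HK : 0 <= K). { apply Rmult_le_pos; [lra|]. apply Rlt_le. now apply Rinv_0_lt_compat. }
    assert (HFK : forall v, Cmod (v - w) < s -> Cmod (F v) <= K).
    { intros v Hv. destruct (Hsub v Hv) as [V1 V2].
      assert (Hv' : punctured p r0 v). { split; [|exact V2]. intros ->. rewrite Cmod_minus_diag in V1. lra. }
      assert (Y := HF v Hv'). unfold K. apply Rle_div_r; [exact Hw0|].
      assert (A := Cmod_ge_0 (F v)). nra. }
    destruct (bounded_near (lim_fun z) w s Hs Zc) as [s' [B [Hs' [Hss [HB HzB]]]]].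
    apply (limit_derivative w s' z (fun n v => phi n v * z n v)%C (lim_fun z) (fun v => F v * lim_fun z v)%C Hs').
    + intros v Hv. apply (ucv_tends _ _ _ v Uz). lra.
    + (* |phi_n z_n - F z| <= |phi_n - F| |z_n| + |F| |z_n - z| *)
      intros eps Heps.
      set (eta := Rmin 1 (eps / (2 * (B + 1)))).
      assert (Heta : 0 < eta) by (apply Rmin_glb_lt; [lra|apply Rdiv_lt_0_compat; lra]).
      assert (E1 : eta * (B + 1) <= eps / 2).
      { apply Rle_trans with (eps / (2 * (B + 1)) * (B + 1)); [apply Rmult_le_compat_r; [lra|apply Rmin_r]|right; field; lra]. }
      set (e := Rmin 1 (eps / (2 * (K + 1)))).
      assert (He : 0 < e) by (apply Rmin_glb_lt; [lra|apply Rdiv_lt_0_compat; lra]).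
      assert (E2 : (K + 1) * e <= eps / 2).
      { apply Rle_trans with ((K + 1) * (eps / (2 * (K + 1)))); [apply Rmult_le_compat_l; [lra|apply Rmin_r]|right; field; lra]. }
      assert (E3 : e <= 1) by apply Rmin_l.
      destruct (Uz e He) as [n1 Hn1].
      destruct (Hsys (Cmod (w - p) / 2) eta ltac:(lra) Heta) as [n2 Hn2].
      exists (n1 + n2)%nat. intros n Hn v Hv.
      assert (Hvs : Cmod (v - w) < s) by lra.
      specialize (Hn1 n ltac:(lia) v Hvs). destruct (Hn2 n ltac:(lia)) as [_ Q]. specialize (Q v (Hsub v Hvs)).
      specialize (HzB v Hv). specialize (HFK v Hvs).
      replace (phi n v * z n v - F v * lim_fun z v)%C with
        ((phi n v - F v) * z n v + F v * (z n v - lim_fun z v))%C by ring.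
      eapply Rle_trans; [apply Cmod_triangle|]. rewrite !Cmod_mult.
      assert (T := Cmod_minus_ge (z n v) (lim_fun z v)).
      assert (Cmod (phi n v - F v) * Cmod (z n v) <= eta * (B + 1)).
      { apply Rmult_le_compat; try apply Cmod_ge_0; lra. }
      assert (Cmod (F v) * Cmod (z n v - lim_fun z v)%C <= (K + 1) * e).
      { apply Rmult_le_compat; try apply Cmod_ge_0; lra. }
      lra.
    + apply ccont_mult; [now apply HFc|exact Zc].
    + exists n0. intros n Hn v Hv. apply D; [exact Hn|lra].
Qed.

(** * Nonvanishing and growth of the limit solution *)

Lemma annulus_bound (F : C -> C) (p : C) (r0 M m : R) :
  0 < m -> (forall w, punctured p r0 w -> Cmod (F w) * Cmod (w - p) <= M) ->
  forall w, annulus p m r0 w -> punctured p r0 w /\ Cmod (F w) <= M / m.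
Proof.
  intros Hm HF w [W1 W2].
  assert (Hw : punctured p r0 w). { split; [|exact W2]. intros ->. rewrite Cmod_minus_diag in W1. lra. }
  split; [exact Hw|]. apply Rle_div_r; [exact Hm|].
  eapply Rle_trans; [|apply (HF w Hw)]. apply Rmult_le_compat_l; [apply Cmod_ge_0|lra].
Qed.

Lemma companion_step (c p : C) (r0 M m : R) (F U V W : C -> C) (a b : C) :
  Cmod c <= 1 -> 0 <= M -> 0 < m ->
  (forall w, punctured p r0 w -> Cmod (F w) * Cmod (w - p) <= M) ->
  companion c F U V W (punctured p r0) ->
  same_half_plane p a b -> annulus p m r0 a -> annulus p m r0 b ->
  sq3 (U b) (V b) (W b) <= sq3 (U a) (V a) (W a) * exp (6 * ((M / (m / 2) + 1) * Cmod (b - a)) + 1).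
Proof.
  intros Hc HM Hm HF H Hab Ha Hb.
  assert (Hs := segment_annulus p a b r0 m Hab Hm Ha Hb).
  assert (HMm : 0 <= M / (m / 2)).
  { apply Rmult_le_pos; [exact HM|]. apply Rlt_le, Rinv_0_lt_compat. lra. }
  assert (X := companion_bound c F U V W a b (M / (m / 2) + 1) Hc ltac:(lra)).
  assert (Y : forall w, segment a b w -> punctured p r0 w /\ Cmod (F w) <= M / (m / 2)).
  { intros w Hw. apply (annulus_bound F p r0 M (m / 2)); [lra|exact HF|now apply Hs]. }
  assert (Z := X ltac:(eapply companion_sub; [|exact H]; intros w Hw; now apply Y)
    ltac:(intros w Hw; destruct (Y w Hw); lra) 1 ltac:(lra)).
  cbv zeta in Z. rewrite seg_1 in Z. exact Z.
Qed.

(** Gronwall run backwards: a zero vector at one end of a segment forces a zero vector at the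
    other. *)
Lemma companion_nonzero (c p : C) (r0 M : R) (F U V W : C -> C) (a : C) :
  Cmod c <= 1 -> 0 <= M ->
  (forall w, punctured p r0 w -> Cmod (F w) * Cmod (w - p) <= M) ->
  companion c F U V W (punctured p r0) -> punctured p r0 a ->
  sq3 (U a) (V a) (W a) <> 0 -> forall b, punctured p r0 b -> sq3 (U b) (V b) (W b) <> 0.
Proof.
  intros Hc HM HF H Ha Na b Hb.
  apply (punctured_chain p r0 (fun w => sq3 (U w) (V w) (W w) <> 0)) with (a := a); auto.
  clear a Ha Na b Hb. intros a b Ha Hb Hab Na Nb. apply Na.
  destruct (punctured_annulus p r0 a b Ha Hb) as [m [Hm [A1 A2]]].
  assert (X := companion_step c p r0 M m F U V W b a Hc HM Hm HF H (same_half_plane_sym _ _ _ Hab) A2 A1).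
  rewrite Nb in X. assert (Y := sq3_ge_0 (U a) (V a) (W a)). lra.
Qed.

Lemma exp_INR_mult (n : nat) (t : R) : exp (INR n * t) = exp t ^ n.
Proof.
  induction n as [|n IH].
  - simpl. rewrite Rmult_0_l. apply exp_0.
  - rewrite S_INR. replace ((INR n + 1) * t) with (INR n * t + t) by ring.
    rewrite exp_plus, IH. simpl. ring.
Qed.

Lemma Cmod_le_sq3 x y z : Cmod x ^ 2 <= sq3 x y z /\ Cmod y ^ 2 <= sq3 x y z.
Proof.
  unfold sq3. assert (A := pow2_ge_0 (Cmod x)). assert (B := pow2_ge_0 (Cmod y)).
  assert (D := pow2_ge_0 (Cmod z)). lra.
Qed.

(* Gronwall along t |-> p + exp (-t) (w' - p), where the coefficient matrix
   contributes at most (rho + M) per unit of t because F has a simple pole. *)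
Lemma companion_growth (c p : C) (r0 M : R) (F U V W : C -> C) :
  Cmod c <= 1 -> 0 < r0 -> 0 <= M ->
  (forall w, punctured p r0 w -> Cmod (F w) * Cmod (w - p) <= M) ->
  companion c F U V W (punctured p r0) ->
  exists (L : nat) B, 0 <= B /\ forall w, punctured p (r0 / 2) w ->
    sq3 (U w) (V w) (W w) * Cmod (w - p) ^ L <= B.
Proof.
  intros Hc Hr HM HF H.
  set (rho := r0 / 2). assert (Hrho : 0 < rho) by (unfold rho; lra).
  assert (Hcircle : forall w, Cmod (w - p) = rho -> annulus p rho r0 w) by (intros w E; unfold annulus, rho in *; lra).
  set (E := exp (6 * ((M / (rho / 2) + 1) * (2 * rho)) + 1)).
  set (a0 := circ p rho 0). assert (Ha0 : Cmod (a0 - p) = rho) by (apply Cmod_circ; lra).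
  assert (HMr : 0 <= M / (rho / 2)).
  { apply Rmult_le_pos; [exact HM|]. apply Rlt_le, Rinv_0_lt_compat. lra. }
  assert (HE0 : 0 < E) by apply exp_pos.
  assert (Step : forall a b, Cmod (a - p) = rho -> Cmod (b - p) = rho -> same_half_plane p a b ->
    sq3 (U b) (V b) (W b) <= sq3 (U a) (V a) (W a) * E).
  { intros a b Ea Eb Hab. eapply Rle_trans; [apply (companion_step c p r0 M rho F U V W a b); auto|].
    apply Rmult_le_compat_l; [apply sq3_ge_0|]. unfold E.
    assert (T : Cmod (b - a) <= 2 * rho).
    { assert (T := Cmod_dist_triangle b p a). rewrite (Cmod_minus_sym p a) in T. lra. }
    assert (T2 : (M / (rho / 2) + 1) * Cmod (b - a) <= (M / (rho / 2) + 1) * (2 * rho)) by (apply Rmult_le_compat_l; lra).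
    destruct T2 as [T2| ->]; [left; apply exp_increasing; lra|right; reflexivity]. }
  (* Two admissible segments link [a0] to any point of the circle, hence the factor [E] twice. *)
  set (B0 := sq3 (U a0) (V a0) (W a0) * E * E).
  assert (Circ : forall w, Cmod (w - p) = rho -> sq3 (U w) (V w) (W w) <= B0).
  { intros w Ew. destruct (quarter_turn_link p a0 w) as [s [Hs [H1 H2]]].
    assert (D := quarter_turn_dist p a0 s Hs). rewrite Ha0 in D.
    eapply Rle_trans; [apply (Step _ w D Ew H2)|]. unfold B0. apply Rmult_le_compat_r; [lra|].
    now apply Step. }
  assert (HB0 : 0 <= B0). { eapply Rle_trans; [apply sq3_ge_0|apply (Circ a0 Ha0)]. }
  set (kap := rho + M).
  assert (Hkap : 0 < kap) by (unfold kap; lra).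
  (* An integer above the Gronwall rate: since [exp T = rho / d], the exponential factor at time [T]
     is at most [(rho / d) ^ L]. *)
  destruct (INR_unbounded (6 * kap + 1)) as [L HL].
  assert (HrL : 0 < rho ^ L) by now apply pow_lt.
  exists L, (B0 * rho ^ L). split; [apply Rmult_le_pos; lra|].
  intros w [W1 W2]. set (d := Cmod (w - p)) in *.
  assert (Hd : 0 < d) by now apply Cmod_minus_gt_0.
  set (T := ln (rho / d)).
  assert (Hq : 1 <= rho / d). { apply Rle_div_r; lra. }
  assert (HT : 0 <= T). { unfold T. rewrite <- ln_1. destruct Hq as [Hq|Hq]; [left; apply ln_increasing; lra|right; now rewrite <- Hq]. }
  assert (HeT : exp T = rho / d) by (apply exp_ln; lra).
  set (w' := (p + RtoC (rho / d) * (w - p))%C).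
  assert (Hw' : Cmod (w' - p) = rho).
  { unfold w'. replace (p + RtoC (rho / d) * (w - p) - p)%C with (RtoC (rho / d) * (w - p))%C by ring.
    rewrite Cmod_mult, Cmod_R, Rabs_right by lra. fold d. field. lra. }
  set (g := fun t => (p + (w' - p) * RtoC (exp (- t)))%C).
  assert (Hg : forall t, pder g t (- (g t - p))%C).
  { intros t. apply (pder_ext g g t ((w' - p) * RtoC (- exp (- t)))%C); [reflexivity| |].
    - unfold g. rewrite RtoC_opp. ring.
    - unfold g. apply pder_affine. split; simpl.
      + auto_derive; [trivial|ring].
      + apply (is_derive_const (V := R_NormedModule)). }
  assert (Hgd : forall t, Cmod (g t - p) = rho * exp (- t)).
  { intros t. unfold g. replace (p + (w' - p) * RtoC (exp (- t)) - p)%C with ((w' - p) * RtoC (exp (- t)))%C by ring.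
    rewrite Cmod_mult, Hw', Cmod_R, Rabs_right; [reflexivity|]. left. apply exp_pos. }
  assert (Hgp : forall t, 0 <= t -> Cmod (g t - p) <= rho /\ punctured p r0 (g t)).
  { intros t Ht. assert (E1 : exp (- t) <= 1).
    { rewrite <- exp_0. destruct Ht as [Ht|Ht]; [left; apply exp_increasing; lra|right; rewrite <- Ht; f_equal; ring]. }
    assert (E2 := exp_pos (- t)). assert (D := Hgd t).
    split; [nra|]. split.
    - intros X. rewrite X, Cmod_minus_diag in D. nra.
    - unfold rho in *. nra. }
  assert (Hg0 : g 0 = w'). { unfold g. rewrite Ropp_0, exp_0. ring. }
  assert (HgT : g T = w).
  { unfold g. rewrite exp_Ropp, HeT. unfold w'.
    replace (p + RtoC (rho / d) * (w - p) - p)%C with (RtoC (rho / d) * (w - p))%C by ring.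
    replace (RtoC (rho / d) * (w - p) * RtoC (/ (rho / d)))%C with (RtoC (rho / d * / (rho / d)) * (w - p))%C by (rewrite RtoC_mult; ring).
    rewrite Rinv_r by lra. ring. }
  assert (G : sq3 (U w) (V w) (W w) <= B0 * (rho / d) ^ L).
  { rewrite <- HgT.
    eapply Rle_trans.
    - apply (gronwall3 (fun t => U (g t)) (fun t => V (g t)) (fun t => W (g t))
        (fun t => c * V (g t) * - (g t - p))%C (fun t => W (g t) * - (g t - p))%C
        (fun t => F (g t) * W (g t) * - (g t - p))%C T kap 0); try lra.
      + intros t Ht. apply (pder_comp U g); [|apply Hg]. apply H. apply Hgp. lra.
      + intros t Ht. apply (pder_comp V g); [|apply Hg]. apply H. apply Hgp. lra.
      + intros t Ht. apply (pder_comp W g); [|apply Hg]. apply H. apply Hgp. lra.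
      + intros t Ht. destruct (Hgp t ltac:(lra)) as [G1 G2]. rewrite !Cmod_mult, Cmod_opp.
        assert (P1 := Cmod_ge_0 (U (g t))). assert (P2 := Cmod_ge_0 (V (g t))). assert (P3 := Cmod_ge_0 (W (g t))).
        assert (P4 := Cmod_ge_0 (g t - p)%C). assert (P5 := Cmod_ge_0 c).
        assert (Cmod c * Cmod (V (g t)) * Cmod (g t - p) <= 1 * Cmod (V (g t)) * rho).
        { apply Rmult_le_compat; try lra; [apply Rmult_le_pos; lra|]. apply Rmult_le_compat_r; lra. }
        assert (0 <= kap * Cmod (U (g t))) by (apply Rmult_le_pos; lra).
        assert (0 <= kap * Cmod (W (g t))) by (apply Rmult_le_pos; lra).
        assert (Cmod (V (g t)) * rho <= Cmod (V (g t)) * kap) by (apply Rmult_le_compat_l; unfold kap; lra).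
        lra.
      + intros t Ht. destruct (Hgp t ltac:(lra)) as [G1 G2]. rewrite !Cmod_mult, Cmod_opp.
        assert (P1 := Cmod_ge_0 (U (g t))). assert (P2 := Cmod_ge_0 (V (g t))). assert (P3 := Cmod_ge_0 (W (g t))).
        assert (P4 := Cmod_ge_0 (g t - p)%C).
        assert (Cmod (W (g t)) * Cmod (g t - p) <= Cmod (W (g t)) * kap) by (apply Rmult_le_compat_l; unfold kap; lra).
        assert (0 <= kap * Cmod (U (g t))) by (apply Rmult_le_pos; lra).
        assert (0 <= kap * Cmod (V (g t))) by (apply Rmult_le_pos; lra).
        lra.
      + intros t Ht. destruct (Hgp t ltac:(lra)) as [G1 G2]. rewrite !Cmod_mult, Cmod_opp.
        assert (P1 := Cmod_ge_0 (U (g t))). assert (P2 := Cmod_ge_0 (V (g t))). assert (P3 := Cmod_ge_0 (W (g t))).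
        assert (HFg := HF (g t) G2).
        assert (Cmod (F (g t)) * Cmod (W (g t)) * Cmod (g t - p) <= Cmod (W (g t)) * kap).
        { replace (Cmod (F (g t)) * Cmod (W (g t)) * Cmod (g t - p)) with
            (Cmod (W (g t)) * (Cmod (F (g t)) * Cmod (g t - p))) by ring.
          apply Rmult_le_compat_l; unfold kap; lra. }
        assert (0 <= kap * Cmod (U (g t))) by (apply Rmult_le_pos; lra).
        assert (0 <= kap * Cmod (V (g t))) by (apply Rmult_le_pos; lra).
        lra.
    - cbv beta. rewrite Hg0. replace (3 * 0 ^ 2) with 0 by ring. rewrite Rplus_0_r.
      apply Rmult_le_compat; [apply sq3_ge_0|left; apply exp_pos|now apply Circ|].
      rewrite <- HeT, <- exp_INR_mult.
      assert (X : (6 * kap + 1) * T <= INR L * T) by (apply Rmult_le_compat_r; lra).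
      destruct X as [X| ->]; [left; now apply exp_increasing|right; reflexivity]. }
  apply Rle_trans with (B0 * (rho / d) ^ L * d ^ L).
  - apply Rmult_le_compat_r; [apply pow_le; lra|exact G].
  - right. unfold Rdiv. rewrite Rpow_mult_distr, pow_inv. field. apply pow_nonzero. lra.
Qed.

(** Polynomial growth makes [(w - p)^L X] extend holomorphically to [p], so its zero there has
    finite order and zeros of [X] cannot accumulate at [p]. At other points this is [zero_order] for
    [X] itself; the last hypothesis excludes the identically vanishing alternative. *)
Lemma isolated_zeros (X : C -> C) (p : C) (rho B : R) (L : nat) :
  0 < rho -> (forall w, punctured p rho w -> exists l, is_cd X w l) ->
  (forall w, punctured p rho w -> Cmod ((w - p) ^ L * X w) <= B) ->
  (forall w s, punctured p rho w -> 0 < s -> exists v, Cmod (v - w) < s /\ X v <> RtoC 0) ->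
  forall z, Cmod (z - p) < rho -> exists r, 0 < r /\
    forall w, punctured z r w -> punctured p rho w /\ X w <> RtoC 0.
Proof.
  intros Hrho HX HB HN z Hz.
  destruct (classic (z = p)) as [->|Hzp].
  - destruct (removable_singularity (fun w => (w - p) ^ L * X w)%C p rho B Hrho) as [h [Hh Eh]].
    + intros w W1 W2. destruct (HX w (conj W1 W2)) as [l Hl]. destruct (is_cd_pow_n w p L) as [l' Hl'].
      eexists. apply is_cd_mult; eassumption.
    + intros w W1 W2. now apply HB.
    + destruct (zero_order h p rho Hrho Hh) as [[s [Hs Z]]|[k [u [Hu [Hup Eu]]]]].
      * exfalso. destruct (punctured_point p (Rmin s rho)) as [w [W1 W2]]; [now apply Rmin_glb_lt|].
        destruct (punctured_open p w (Rmin s rho) (conj W1 W2)) as [t [Ht K]].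
        assert (A1 := Rmin_l s rho). assert (A2 := Rmin_r s rho).
        destruct (HN w t) as [v [V1 V2]]; [split; [exact W1|lra]|exact Ht|].
        destruct (K v V1) as [K1 K2]. apply V2.
        assert (E := Eh v K1 ltac:(lra)). rewrite Z in E by lra.
        assert (N : ((v - p) ^ L)%C <> RtoC 0) by (apply Cpow_nz; now apply Cminus_neq_0).
        replace (X v) with ((v - p) ^ L * X v / (v - p) ^ L)%C by (field; exact N).
        rewrite E. unfold Cdiv. ring.
      * destruct (nonzero_near u p rho Hrho) as [r [Hr [Hrr Hu0]]]; [|exact Hup|].
        { eapply holB_ccont; [exact Hu|now apply Cmod_center]. }
        exists r. split; [exact Hr|]. intros w [W1 W2]. split; [split; [exact W1|lra]|].
        intros E. assert (E2 := Eh w W1 ltac:(lra)). rewrite E, Cmult_0_r, Eu in E2 by lra.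
        symmetry in E2. revert E2. apply Cmult_neq_0; [|now apply Hu0].
        apply Cpow_nz. now apply Cminus_neq_0.
  - assert (Hzp' : punctured p rho z) by now split.
    destruct (punctured_open p z rho Hzp') as [s [Hs Hsub]].
    assert (Hol : holB z s X) by (intros w Hw; apply HX; now apply Hsub).
    destruct (zero_order X z s Hs Hol) as [[t [Ht Z]]|[k [u [Hu [Hup Eu]]]]].
    + exfalso. destruct (HN z t Hzp' Ht) as [v [V1 V2]]. apply V2. now apply Z.
    + destruct (nonzero_near u z s Hs) as [r [Hr [Hrr Hu0]]]; [|exact Hup|].
      { eapply holB_ccont; [exact Hu|now apply Cmod_center]. }
      exists r. split; [exact Hr|]. intros w [W1 W2]. split; [apply Hsub; lra|].
      rewrite Eu by lra. apply Cmult_neq_0; [|now apply Hu0]. apply Cpow_nz. now apply Cminus_neq_0.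
Qed.

(** * Subsequences and normalisation of solutions *)

Lemma extraction_S (psi : nat -> nat) : (forall n, (psi n < psi (S n))%nat) -> extraction psi.
Proof.
  intros H i j Hij. induction Hij as [|j Hij IH]; [apply H|]. specialize (H j). lia.
Qed.

Lemma extraction_ge (psi : nat -> nat) : extraction psi -> forall n, (n <= psi n)%nat.
Proof.
  intros H n. induction n as [|n IH]; [lia|]. specialize (H n (S n) ltac:(lia)). lia.
Qed.

Lemma extraction_comp (psi th : nat -> nat) : extraction psi -> extraction th -> extraction (fun n => th (psi n)).
Proof. intros H1 H2 i j Hij. now apply H2, H1. Qed.

Lemma extraction_of_frequent (P : nat -> nat -> Prop) :
  (forall k N, exists n, (N <= n)%nat /\ P k n) -> exists psi, extraction psi /\ forall k, P k (psi k).
Proof.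
  intros H.
  set (next := fun k N => proj1_sig (constructive_indefinite_description _ (H k N))).
  assert (Hn : forall k N, (N <= next k N)%nat /\ P k (next k N)).
  { intros k N. unfold next. now destruct (constructive_indefinite_description _ (H k N)). }
  set (psi := fix psi k := match k with O => next 0%nat 0%nat | S j => next (S j) (S (psi j)) end).
  exists psi. split.
  - apply extraction_S. intros n. simpl. destruct (Hn (S n) (S (psi n))). lia.
  - intros [|k]; apply Hn.
Qed.

Lemma bounded_subsequence_R (u : nat -> R) (B : R) : (forall n, Rabs (u n) <= B) ->
  exists psi l, extraction psi /\ forall eps, 0 < eps -> exists n0, forall n, (n0 <= n)%nat -> Rabs (u (psi n) - l) <= eps.
Proof.
  intros HB.
  destruct (Bolzano_Weierstrass u (fun x => - B <= x <= B) (compact_P3 (- B) B)) as [l Hl].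
  { intros n. specialize (HB n). now apply Rabs_le_between. }
  destruct (extraction_of_frequent (fun k n => Rabs (u n - l) < / (INR k + 1))) as [psi [Hpsi K]].
  { intros k N. assert (Hk : 0 < / (INR k + 1)) by (apply Rinv_0_lt_compat; assert (X := pos_INR k); lra).
    destruct (Hl (disc l (mkposreal _ Hk)) N) as [n [Hn1 Hn2]].
    - exists (mkposreal _ Hk). intros x Hx. exact Hx.
    - exists n. split; [exact Hn1|exact Hn2]. }
  exists psi, l. split; [exact Hpsi|]. intros eps Heps.
  destruct (INR_unbounded (/ eps)) as [n0 Hn0]. exists n0. intros n Hn.
  apply Rlt_le. eapply Rlt_le_trans; [apply K|].
  assert (INR n0 <= INR n) by now apply le_INR.
  rewrite <- (Rinv_inv eps). apply Rinv_le_contravar; [now apply Rinv_0_lt_compat|lra].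
Qed.

Lemma tends_sub u l psi : extraction psi -> tends u l -> tends (fun n => u (psi n)) l.
Proof.
  intros Hpsi H eps Heps. destruct (H eps Heps) as [n0 Hn]. exists n0. intros n Hn'. apply Hn.
  assert (X := extraction_ge psi Hpsi n). lia.
Qed.

Lemma bounded_subsequence (u : nat -> C) (B : R) : (forall n, Cmod (u n) <= B) ->
  exists psi l, extraction psi /\ tends (fun n => u (psi n)) l.
Proof.
  intros HB.
  destruct (bounded_subsequence_R (fun n => fst (u n)) B) as [p1 [l1 [E1 T1]]].
  { intros n. eapply Rle_trans; [apply fst_le_Cmod|apply HB]. }
  destruct (bounded_subsequence_R (fun n => snd (u (p1 n))) B) as [p2 [l2 [E2 T2]]].
  { intros n. eapply Rle_trans; [apply snd_le_Cmod|apply HB]. }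
  exists (fun n => p1 (p2 n)), (l1, l2). split; [now apply extraction_comp|].
  intros eps Heps.
  destruct (T1 (eps / 2)) as [n1 N1]; [lra|]. destruct (T2 (eps / 2)) as [n2 N2]; [lra|].
  exists (n1 + n2)%nat. intros n Hn. eapply Rle_trans; [apply Cmod_le_fst_snd|]. simpl.
  assert (X := extraction_ge p2 E2 n).
  specialize (N1 (p2 n) ltac:(lia)). specialize (N2 n ltac:(lia)). unfold Rminus in *. lra.
Qed.

Lemma bounded_subsequence3 (u v w : nat -> C) (B : R) :
  (forall n, Cmod (u n) <= B) -> (forall n, Cmod (v n) <= B) -> (forall n, Cmod (w n) <= B) ->
  exists psi l1 l2 l3, extraction psi /\ tends (fun n => u (psi n)) l1 /\
    tends (fun n => v (psi n)) l2 /\ tends (fun n => w (psi n)) l3.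
Proof.
  intros Hu Hv Hw.
  destruct (bounded_subsequence u B Hu) as [p1 [l1 [E1 T1]]].
  destruct (bounded_subsequence (fun n => v (p1 n)) B) as [p2 [l2 [E2 T2]]]; [auto|].
  destruct (bounded_subsequence (fun n => w (p1 (p2 n))) B) as [p3 [l3 [E3 T3]]]; [auto|].
  exists (fun n => p1 (p2 (p3 n))), l1, l2, l3.
  split; [exact (extraction_comp _ _ E3 (extraction_comp _ _ E2 E1))|].
  split; [|split].
  - apply (tends_sub (fun n => u (p1 n)) l1 (fun n => p2 (p3 n))); [|exact T1]. now apply extraction_comp.
  - now apply (tends_sub (fun n => v (p1 (p2 n))) l2 p3).
  - exact T3.
Qed.

Lemma cvg_system_scale_sub c p r0 phi F x y z (psi : nat -> nat) (d : nat -> C) :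
  extraction psi -> cvg_system c p r0 phi F x y z ->
  cvg_system c p r0 (fun n => phi (psi n)) F (fun n w => d n * x (psi n) w)%C
    (fun n w => d n * y (psi n) w)%C (fun n w => d n * z (psi n) w)%C.
Proof.
  intros Hpsi H del eta Hd He. destruct (H del eta Hd He) as [n0 Hn]. exists n0. intros n Hn'.
  assert (X := extraction_ge psi Hpsi n). destruct (Hn (psi n) ltac:(lia)) as [H1 H2].
  split; [|exact H2]. intros w Hw. destruct (H1 w Hw) as [D1 [D2 D3]]. repeat split.
  - eapply is_cd_val; [apply is_cd_scal, D1|]. ring.
  - now apply is_cd_scal.
  - eapply is_cd_val; [apply is_cd_scal, D3|]. ring.
Qed.

(** Dividing by the sum [S n] of the three moduli at [a] makes the vectors bounded, and the sum of
    the moduli stays 1, so the limit along a convergent subsequence is not zero. By linearity the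
    system is preserved. *)
Lemma normalised_subsequence c p r0 phi F x y z (a : C) :
  cvg_system c p r0 phi F x y z ->
  (exists n0, forall n, (n0 <= n)%nat -> sq3 (x n a) (y n a) (z n a) <> 0) ->
  exists psi d, extraction psi /\ (exists n0, forall n, (n0 <= n)%nat -> d n <> RtoC 0) /\
    let x' := fun n w => (d n * x (psi n) w)%C in
    let y' := fun n w => (d n * y (psi n) w)%C in
    let z' := fun n w => (d n * z (psi n) w)%C in
    cvg_system c p r0 (fun n => phi (psi n)) F x' y' z' /\ cauchy3 x' y' z' a /\
    sq3 (lim_fun x' a) (lim_fun y' a) (lim_fun z' a) <> 0.
Proof.
  intros Hsys [n0 Hn0].
  set (S := fun n => Cmod (x n a) + Cmod (y n a) + Cmod (z n a)).
  assert (HS : forall n, 0 <= S n /\ Cmod (x n a) <= S n /\ Cmod (y n a) <= S n /\ Cmod (z n a) <= S n).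
  { intros n. unfold S. assert (A := Cmod_ge_0 (x n a)). assert (B := Cmod_ge_0 (y n a)). assert (D := Cmod_ge_0 (z n a)). lra. }
  assert (HS0 : forall n, (n0 <= n)%nat -> 0 < S n).
  { intros n Hn. destruct (HS n) as [S0 [S1 [S2 S3]]]. destruct S0 as [S0|S0]; [exact S0|exfalso].
    apply (Hn0 n Hn). rewrite <- S0 in *. assert (A := sq3_le (x n a) (y n a) (z n a) 0 S1 S2 S3).
    assert (B := sq3_ge_0 (x n a) (y n a) (z n a)). lra. }
  set (e := fun n => RtoC (/ S n)).
  (* For the finitely many [n] with [S n = 0] the default value [/ 0 = 0] keeps the bound valid. *)
  assert (He : forall n u, Cmod u <= S n -> Cmod (e n * u) <= 1).
  { intros n u Hu. rewrite Cmod_mult. unfold e. rewrite Cmod_R.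
    destruct (HS n) as [[S0|S0] _].
    - rewrite Rabs_right by (left; now apply Rinv_0_lt_compat).
      apply Rle_trans with (/ S n * S n); [apply Rmult_le_compat_l; [left; now apply Rinv_0_lt_compat|exact Hu]|].
      rewrite Rinv_l; lra.
    - rewrite <- S0, Rinv_0, Rabs_R0. lra. }
  destruct (bounded_subsequence3 (fun n => e n * x n a)%C (fun n => e n * y n a)%C (fun n => e n * z n a)%C 1)
    as [psi [l1 [l2 [l3 [Hpsi [T1 [T2 T3]]]]]]].
  { intros n. apply He, HS. } { intros n. apply He, HS. } { intros n. apply He, HS. }
  exists psi, (fun n => e (psi n)). split; [exact Hpsi|]. split.
  { exists n0. intros n Hn. assert (X := extraction_ge psi Hpsi n). unfold e. apply RtoC_neq.
    apply Rinv_neq_0_compat. assert (Y := HS0 (psi n) ltac:(lia)). lra. }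
  intros x' y' z'. split; [now apply (cvg_system_scale_sub c p r0 phi F x y z psi (fun n => e (psi n)))|].
  assert (Cx : cauchy_seq (fun n => x' n a)) by (eapply tends_cauchy; exact T1).
  assert (Cy : cauchy_seq (fun n => y' n a)) by (eapply tends_cauchy; exact T2).
  assert (Cz : cauchy_seq (fun n => z' n a)) by (eapply tends_cauchy; exact T3).
  split; [now repeat split|].
  assert (E1 : lim_fun x' a = l1) by (apply (tends_unique (fun n => x' n a)); [now apply climit_spec|exact T1]).
  assert (E2 : lim_fun y' a = l2) by (apply (tends_unique (fun n => y' n a)); [now apply climit_spec|exact T2]).
  assert (E3 : lim_fun z' a = l3) by (apply (tends_unique (fun n => z' n a)); [now apply climit_spec|exact T3]).
  rewrite E1, E2, E3. intros Z.
  destruct (sq3_bound l1 l2 l3 0) as [Z1 [Z2 Z3]]; [lra|rewrite Z; lra|].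
  destruct (T1 (/ 4)) as [m1 M1]; [lra|]. destruct (T2 (/ 4)) as [m2 M2]; [lra|]. destruct (T3 (/ 4)) as [m3 M3]; [lra|].
  set (n := (n0 + m1 + m2 + m3)%nat).
  specialize (M1 n ltac:(lia)). specialize (M2 n ltac:(lia)). specialize (M3 n ltac:(lia)).
  assert (Q1 := Cmod_minus_ge (e (psi n) * x (psi n) a)%C l1).
  assert (Q2 := Cmod_minus_ge (e (psi n) * y (psi n) a)%C l2).
  assert (Q3 := Cmod_minus_ge (e (psi n) * z (psi n) a)%C l3).
  assert (X := extraction_ge psi Hpsi n). assert (Y := HS0 (psi n) ltac:(lia)).
  rewrite !Cmod_mult in *. unfold e in *. rewrite Cmod_R in *.
  assert (HI : 0 < / S (psi n)) by now apply Rinv_0_lt_compat.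
  rewrite Rabs_right in * by lra.
  assert (Sum : / S (psi n) * Cmod (x (psi n) a) + / S (psi n) * Cmod (y (psi n) a) + / S (psi n) * Cmod (z (psi n) a) = 1).
  { rewrite <- !Rmult_plus_distr_l. fold (S (psi n)). apply Rinv_l. lra. }
  lra.
Qed.

(** * Quotients of consecutive components *)

Lemma ucv_sub (A B : C -> Prop) f g : (forall w, A w -> B w) -> ucv B f g -> ucv A f g.
Proof. intros H K eps Heps. destruct (K eps Heps) as [n0 Hn]. exists n0. intros n Hn' w Hw. auto. Qed.

Lemma ucv_quot (w : C) (s : R) (num den : nat -> C -> C) (V U : C -> C) :
  0 < s -> ucv (fun v => Cmod (v - w) < s) num V -> ucv (fun v => Cmod (v - w) < s) den U ->
  ccont V w -> ccont U w -> U w <> RtoC 0 ->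
  exists s', 0 < s' /\ s' <= s /\
    (exists n0, forall n, (n0 <= n)%nat -> forall v, Cmod (v - w) < s' -> den n v <> RtoC 0) /\
    ucv (fun v => Cmod (v - w) < s') (fun n v => num n v / den n v)%C (fun v => V v / U v)%C.
Proof.
  intros Hs Hnum Hden HV HU HUw.
  assert (HU0 := proj1 (Cmod_gt_0 _) HUw). set (m := Cmod (U w) / 2).
  assert (Hm : 0 < m) by (unfold m; lra).
  destruct (HU m Hm) as [d1 [Hd1 K1]].
  destruct (bounded_near V w s Hs HV) as [d2 [B [Hd2 [Hds [HB K2]]]]].
  set (s' := Rmin d1 d2). assert (Hs' : 0 < s') by now apply Rmin_glb_lt.
  assert (A1 : s' <= d1) by apply Rmin_l. assert (A2 : s' <= d2) by apply Rmin_r.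
  exists s'. split; [exact Hs'|]. split; [lra|].
  assert (HUm : forall v, Cmod (v - w) < s' -> m <= Cmod (U v)).
  { intros v Hv. specialize (K1 v ltac:(lra)). assert (X := Cmod_minus_ge (U w) (U v)).
    rewrite Cmod_minus_sym in X. unfold m in *. lra. }
  destruct (Hden (m / 2)) as [n1 Hn1]; [lra|].
  assert (Hdm : forall n, (n1 <= n)%nat -> forall v, Cmod (v - w) < s' -> m / 2 <= Cmod (den n v)).
  { intros n Hn v Hv. specialize (Hn1 n Hn v ltac:(lra)). assert (X := Cmod_minus_ge (U v) (den n v)).
    rewrite Cmod_minus_sym in X. specialize (HUm v Hv). lra. }
  split.
  { exists n1. intros n Hn v Hv. apply Cmod_gt_0. specialize (Hdm n Hn v Hv). lra. }
  intros eps Heps.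
  set (e1 := eps * m / 4). assert (He1 : 0 < e1) by (unfold e1; nra).
  set (e2 := eps * (m * m) / (4 * B)).
  assert (He2 : 0 < e2) by (apply Rdiv_lt_0_compat; [repeat apply Rmult_lt_0_compat; lra|lra]).
  destruct (Hnum e1 He1) as [n2 Hn2]. destruct (Hden e2 He2) as [n3 Hn3].
  exists (n1 + n2 + n3)%nat. intros n Hn v Hv.
  specialize (Hdm n ltac:(lia) v Hv). specialize (HUm v Hv). specialize (K2 v ltac:(lra)).
  specialize (Hn2 n ltac:(lia) v ltac:(lra)). specialize (Hn3 n ltac:(lia) v ltac:(lra)).
  assert (N1 : den n v <> RtoC 0) by (apply Cmod_gt_0; lra).
  assert (N2 : U v <> RtoC 0) by (apply Cmod_gt_0; lra).
  replace (num n v / den n v - V v / U v)%C with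
    ((num n v - V v) / den n v - V v * (den n v - U v) / (den n v * U v))%C by (field; auto).
  eapply Rle_trans; [apply Cmod_minus_le|].
  rewrite !Cmod_div by (try apply Cmult_neq_0; assumption). rewrite !Cmod_mult.
  assert (Q1 : Cmod (num n v - V v) / Cmod (den n v) <= eps / 2).
  { apply Rle_div_l; [lra|]. eapply Rle_trans; [exact Hn2|]. unfold e1. nra. }
  assert (Q2 : Cmod (V v) * Cmod (den n v - U v) / (Cmod (den n v) * Cmod (U v)) <= eps / 2).
  { apply Rle_div_l; [nra|]. apply Rle_trans with (B * e2).
    - apply Rmult_le_compat; try apply Cmod_ge_0; assumption.
    - apply Rle_trans with (eps / 2 * (m / 2 * m)).
      + right. unfold e2. field. lra.
      + apply Rmult_le_compat_l; [lra|]. apply Rmult_le_compat; lra. }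
  lra.
Qed.

Lemma Cmod_sq_bound (z : C) (K : R) : Cmod z ^ 2 <= K -> Cmod z <= K + 1.
Proof. intros H. assert (A := Cmod_ge_0 z). nra. Qed.

(** Two ways to read the system: [y / x] from the full triple, or [z / y] with [x] set to zero, so
    that the normalisation sees only the pair. *)
Definition consecutive (c : C) (x y z X Y : nat -> C -> C) : Prop :=
  (c = RtoC 1 /\ X = x /\ Y = y) \/ (c = RtoC 0 /\ (forall n w, x n w = RtoC 0) /\ X = y /\ Y = z).

Lemma cd_zero_ball (P : C -> C) (l w : C) (s : R) :
  0 < s -> (forall v, Cmod (v - w) < s -> P v = RtoC 0) -> is_cd P w l -> l = RtoC 0.
Proof.
  intros Hs Z H. apply (is_cd_unique P w); [exact H|].
  apply (is_cd_ext_loc (fun _ => RtoC 0) _ w _ s Hs); [|apply is_cd_const].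
  intros v Hv. symmetry. now apply Z.
Qed.

(** Quotients converge wherever the limit [P] of the denominators is nonzero. On any disc where [P]
    vanished, all further components would vanish as its derivatives, against [companion_nonzero];
    with the growth bound, the zeros of [P] are therefore isolated, even at [p]. *)
Lemma quotient_limit (c p : C) (r0 M : R) phi F x y z (a : C) (X Y : nat -> C -> C) :
  Cmod c <= 1 -> 0 < r0 -> 0 <= M ->
  (forall w, punctured p r0 w -> Cmod (F w) * Cmod (w - p) <= M) ->
  (forall w, punctured p r0 w -> ccont F w) ->
  cvg_system c p r0 phi F x y z -> punctured p r0 a -> cauchy3 x y z a ->
  sq3 (lim_fun x a) (lim_fun y a) (lim_fun z a) <> 0 ->
  consecutive c x y z X Y ->
  forall z0, Cmod (z0 - p) < r0 / 2 -> exists r, 0 < r /\ exists L, forall w, punctured z0 r w ->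
    punctured p r0 w /\
    exists s, 0 < s /\ (exists n0, forall n, (n0 <= n)%nat -> forall v, Cmod (v - w) < s -> X n v <> RtoC 0) /\
      ucv (fun v => Cmod (v - w) < s) (fun n v => Y n v / X n v)%C L.
Proof.
  intros Hc Hr HM HF HFc Hsys Ha Ca Na Hsel z0 Hz0.
  set (U := lim_fun x) in *. set (V := lim_fun y) in *. set (W := lim_fun z) in *.
  assert (Hcomp : companion c F U V W (punctured p r0)) by (eapply limit_companion; eassumption).
  assert (Hnz := companion_nonzero c p r0 M F U V W a Hc HM HF Hcomp Ha Na).
  destruct (companion_growth c p r0 M F U V W Hc Hr HM HF Hcomp) as [L [B [HB Hgrow]]].
  assert (Hloc : forall w, punctured p r0 w -> exists s, 0 < s /\
    ucv (fun v => Cmod (v - w) < s) x U /\ ucv (fun v => Cmod (v - w) < s) y V /\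
    ucv (fun v => Cmod (v - w) < s) z W).
  { intros w Hw.
    destruct (locally_uniform_limit c p r0 M phi F x y z w Hc Hr HM HF Hsys Hw) as [s [Hs [_ H]]].
    - exact (cauchy3_everywhere c p r0 M phi F x y z a Hc Hr HM HF Hsys Ha Ca w Hw).
    - now exists s. }
  assert (Hcc : forall w, punctured p r0 w -> ccont U w /\ ccont V w /\ ccont W w).
  { intros w Hw. destruct (Hcomp w Hw) as [D1 [D2 D3]]. repeat split; eapply is_cd_ccont; eassumption. }
  assert (Hbranch : exists P Q,
    (forall w, punctured p r0 w -> exists s, 0 < s /\ ucv (fun v => Cmod (v - w) < s) X P /\ ucv (fun v => Cmod (v - w) < s) Y Q) /\
    (forall w, punctured p r0 w -> (exists l, is_cd P w l) /\ ccont P w /\ ccont Q w) /\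
    (forall w, Cmod (P w) ^ 2 <= sq3 (U w) (V w) (W w)) /\
    (forall w s, punctured p r0 w -> 0 < s -> exists v, Cmod (v - w) < s /\ P v <> RtoC 0)).
  (* If [U] and [V] vanish near [w], then so does [W w], the derivative of [V], contradicting
     [Hnz]. *)
  { assert (NW : forall w s, punctured p r0 w -> 0 < s ->
      (forall v, Cmod (v - w) < s -> punctured p r0 v -> U v = RtoC 0) ->
      (forall v, Cmod (v - w) < s -> punctured p r0 v -> V v = RtoC 0) -> False).
    { intros w s Hw Hs ZU ZV. destruct (punctured_open p w r0 Hw) as [t [Ht K]].
      assert (A1 := Rmin_l s t). assert (A2 := Rmin_r s t).
      assert (Hst : 0 < Rmin s t) by now apply Rmin_glb_lt.
      apply (Hnz w Hw). rewrite (ZU w), (ZV w); auto using Cmod_center.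
      assert (E : W w = RtoC 0).
      { apply (cd_zero_ball V (W w) w (Rmin s t) Hst); [|apply (Hcomp w Hw)].
        intros v Hv. apply ZV; [lra|]. apply K. lra. }
      rewrite E. unfold sq3. rewrite Cmod_0. ring. }
    destruct Hsel as [[-> [-> ->]]|[-> [Hx [-> ->]]]].
    - exists U, V. split; [|split; [|split]].
      + intros w Hw. destruct (Hloc w Hw) as [s [Hs [H1 [H2 _]]]]. now exists s.
      + intros w Hw. split; [eexists; apply (Hcomp w Hw)|]. split; apply (Hcc w Hw).
      + intros w. apply Cmod_le_sq3.
      + intros w s Hw Hs. apply NNPP. intros N.
        destruct (punctured_open p w r0 Hw) as [t [Ht K]].
        assert (A1 := Rmin_l s t). assert (A2 := Rmin_r s t).
        assert (ZU : forall v, Cmod (v - w) < s -> U v = RtoC 0).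
        { intros v Hv. apply NNPP. intros N'. apply N. now exists v. }
        apply (NW w (Rmin s t) Hw); [now apply Rmin_glb_lt| |].
        * intros v Hv _. apply ZU. lra.
        * intros v Hv Hv'.
          assert (E : (1 * V v)%C = RtoC 0).
          { apply (cd_zero_ball U _ v (s - Cmod (v - w))); [lra| |apply (Hcomp v Hv')].
            intros u Hu. apply ZU. assert (T := Cmod_dist_triangle u v w). lra. }
          rewrite Cmult_1_l in E. exact E.
    - assert (ZU : forall w, punctured p r0 w -> U w = RtoC 0).
      { intros w Hw. apply (tends_unique (fun n => x n w)).
        - destruct (Hloc w Hw) as [s [Hs [H1 _]]]. apply (ucv_tends _ _ _ w H1). now apply Cmod_center.
        - intros eps Heps. exists 0%nat. intros n _. rewrite Hx, Cmod_minus_diag. lra. }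
      exists V, W. split; [|split; [|split]].
      + intros w Hw. destruct (Hloc w Hw) as [s [Hs [_ H2]]]. now exists s.
      + intros w Hw. split; [eexists; apply (Hcomp w Hw)|]. split; apply (Hcc w Hw).
      + intros w. apply Cmod_le_sq3.
      + intros w s Hw Hs. apply NNPP. intros N.
        apply (NW w s Hw Hs).
        * intros v _ Hv. now apply ZU.
        * intros v Hv _. apply NNPP. intros N'. apply N. now exists v. }
  destruct Hbranch as [P [Q [B1 [B2 [B3 B4]]]]].
  assert (Hhalf : forall w, punctured p (r0 / 2) w -> punctured p r0 w).
  { intros w. apply punctured_mono. lra. }
  destruct (isolated_zeros P p (r0 / 2) (r0 ^ L * B + 1) L) with (z := z0) as [r [Hr' Hiso]].
  - lra.
  - intros w Hw. apply B2. now apply Hhalf.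
  (* The growth bound concerns the squared norm times [t ^ L] only. The second factor [t ^ L] in the
     square is estimated by [r0 ^ L]. *)
  - intros w Hw. apply Cmod_sq_bound. rewrite Cmod_mult, Cmod_pow, Rpow_mult_distr.
    assert (Hg := Hgrow w Hw). specialize (B3 w). destruct Hw as [_ Hw].
    set (t := Cmod (w - p)) in *. assert (Ht : 0 <= t) by apply Cmod_ge_0.
    assert (Htl : 0 <= t ^ L) by now apply pow_le.
    assert (Htr : t ^ L <= r0 ^ L) by (apply pow_incr; lra).
    apply Rle_trans with (t ^ L * (sq3 (U w) (V w) (W w) * t ^ L)).
    + replace ((t ^ L) ^ 2 * Cmod (P w) ^ 2) with (t ^ L * (Cmod (P w) ^ 2 * t ^ L)) by ring.
      apply Rmult_le_compat_l; [exact Htl|]. apply Rmult_le_compat_r; assumption.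
    + apply Rmult_le_compat; try assumption. apply Rmult_le_pos; [apply sq3_ge_0|exact Htl].
  - intros w s Hw Hs. apply B4; [now apply Hhalf|exact Hs].
  - exact Hz0.
  - exists r. split; [exact Hr'|]. exists (fun v => Q v / P v)%C. intros w Hw.
    destruct (Hiso w Hw) as [W1 W2]. apply Hhalf in W1. split; [exact W1|].
    destruct (B1 w W1) as [s [Hs [C1 C2]]]. destruct (B2 w W1) as [_ [D1 D2]].
    destruct (ucv_quot w s Y X Q P Hs C2 C1 D2 D1 W2) as [s' [Hs' [Hss [E1 E2]]]].
    exists s'. split; [exact Hs'|]. now split.
Qed.

(** The radius precedes the sequence [th], and [psi] precedes the point [z]: one extraction serves a
    whole disc, as the diagonal argument requires. Limits are finite off the centres [z], which is
    what later excludes convergence to [Inf]. *)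
Definition locally_normal (D : C -> Prop) (q : nat -> C -> sphere) : Prop :=
  forall z0, D z0 -> exists r, 0 < r /\ forall th, extraction th -> exists psi, extraction psi /\
    forall z, Cmod (z - z0) < r -> exists r' L, 0 < r' /\
      cv_loc_unif (punctured z r') (fun n => q (th (psi n))) (fun w => Fin (L w)).

Lemma cv_loc_unif_of_ucv (A : C -> Prop) (f : nat -> C -> sphere) (h : nat -> C -> C) (L : C -> C) :
  (forall w, A w -> exists s, 0 < s /\ ucv (fun v => Cmod (v - w) < s) h L /\
     exists n0, forall n, (n0 <= n)%nat -> forall v, Cmod (v - w) < s -> f n v = Fin (h n v)) ->
  cv_loc_unif A f (fun w => Fin (L w)).
Proof.
  intros H w Hw. destruct (H w Hw) as [s [Hs [Hu [n0 Hn0]]]]. exists s. split; [exact Hs|].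
  intros eps Heps. destruct (sph_dist_small eps Heps) as [d [Hd K]].
  destruct (Hu (d / 2)) as [n1 Hn1]; [lra|]. exists (n0 + n1)%nat. intros n Hn v _ Hv.
  rewrite Hn0 by (try lia; exact Hv). apply K. eapply Rle_lt_trans; [apply half_chord_le_Cmod|].
  specialize (Hn1 n ltac:(lia) v Hv). lra.
Qed.

(** The normalising scalars multiply numerator and denominator alike and cancel in the quotient;
    where the denominators are nonzero, [mquot] is the pointwise quotient. *)
Lemma local_subsequence (c p : C) (r0 M : R) phi F x y z (num den : nat -> C -> sphere) (a : C) :
  Cmod c <= 1 -> 0 < r0 -> 0 <= M ->
  (forall w, punctured p r0 w -> Cmod (F w) * Cmod (w - p) <= M) ->
  (forall w, punctured p r0 w -> ccont F w) ->
  cvg_system c p r0 phi F x y z -> punctured p r0 a ->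
  (exists n0, forall n, (n0 <= n)%nat -> sq3 (x n a) (y n a) (z n a) <> 0) ->
  consecutive c x y z (fun n w => fin (den n w)) (fun n w => fin (num n w)) ->
  forall th, extraction th -> exists psi, extraction psi /\
    forall z0, Cmod (z0 - p) < r0 / 2 -> exists r' L, 0 < r' /\
      cv_loc_unif (punctured z0 r') (fun n => mquot (num (th (psi n))) (den (th (psi n)))) (fun w => Fin (L w)).
Proof.
  intros Hc Hr HM HF HFc Hsys Ha [n0 Hn0] Hsel th Hth.
  assert (Hsys1 : cvg_system c p r0 (fun n => phi (th n)) F (fun n => x (th n)) (fun n => y (th n)) (fun n => z (th n))).
  { intros d eta Hd He. destruct (Hsys d eta Hd He) as [n1 Hn1]. exists n1. intros n Hn.
    apply Hn1. assert (X := extraction_ge th Hth n). lia. }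
  destruct (normalised_subsequence c p r0 _ F _ _ _ a Hsys1) as [psi [d [Hpsi [[n1 Hn1] [Hsys2 [Hca Hnz]]]]]].
  { exists n0. intros n Hn. apply Hn0. assert (X := extraction_ge th Hth n). lia. }
  exists psi. split; [exact Hpsi|]. intros z0 Hz0.
  set (X := fun n w => (d n * fin (den (th (psi n)) w))%C).
  set (Y := fun n w => (d n * fin (num (th (psi n)) w))%C).
  destruct (quotient_limit c p r0 M _ F _ _ _ a X Y Hc Hr HM HF HFc Hsys2 Ha Hca Hnz) with (z0 := z0)
    as [r [Hr' [L HL]]].
  - destruct Hsel as [[-> [Ex Ey]]|[-> [Hx [Ey Ez]]]]; [left|right].
    + split; [reflexivity|]. unfold X, Y.
      split; [rewrite <- Ex|rewrite <- Ey]; reflexivity.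
    + split; [reflexivity|]. split.
      * intros n w. cbv beta. rewrite Hx. ring.
      * unfold X, Y. split; [rewrite <- Ey|rewrite <- Ez]; reflexivity.
  - exact Hz0.
  - exists r, L. split; [exact Hr'|].
    apply (cv_loc_unif_of_ucv _ _ (fun n v => Y n v / X n v)%C). intros w Hw.
    destruct (HL w Hw) as [Hwp [s [Hs [[n2 Hn2] Hu]]]].
    destruct (ball_in_annulus p w r0 Hwp) as [s2 [Hs2 Hsub]].
    assert (A1 := Rmin_l s s2). assert (A2 := Rmin_r s s2).
    exists (Rmin s s2). split; [now apply Rmin_glb_lt|]. split.
    { eapply ucv_sub; [|exact Hu]. intros v Hv. cbv beta in *. lra. }
    assert (Hw0 := Cmod_minus_gt_0 _ _ (proj1 Hwp)).
    destruct (Hsys1 (Cmod (w - p) / 2) 1 ltac:(lra) Rlt_0_1) as [n3 Hn3].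
    exists (n1 + n2 + n3)%nat. intros n Hn v Hv.
    assert (Hps := extraction_ge psi Hpsi n).
    destruct (Hn3 (psi n) ltac:(lia)) as [Hcomp _].
    destruct (Hcomp v (Hsub v ltac:(lra))) as [D1 [D2 D3]].
    specialize (Hn2 n ltac:(lia) v ltac:(lra)). specialize (Hn1 n ltac:(lia)).
    assert (N : fin (den (th (psi n)) v) <> RtoC 0).
    { intros E. apply Hn2. unfold X. rewrite E. ring. }
    assert (DD : (exists l, is_cd (fun u => fin (den (th (psi n)) u)) v l) /\ (exists l, is_cd (fun u => fin (num (th (psi n)) u)) v l)).
    { destruct Hsel as [[_ [Ex Ey]]|[_ [_ [Ey Ez]]]].
      - rewrite <- Ex in D1. rewrite <- Ey in D2. split; eexists; eassumption.
      - rewrite <- Ey in D2. rewrite <- Ez in D3. split; eexists; eassumption. }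
    destruct DD as [[l1 L1] [l2 L2]].
    rewrite (mquot_regular _ _ v l2 l1 L2 L1 N). f_equal. unfold X, Y. field. split; assumption.
Qed.

(** * Diagonal extraction and quasi-normality *)

(** Stability of [P i] is asked for sequences whose late values occur in [th] at the same or a later
    position. A diagonal sequence has this relation to every stage, and locally uniform convergence
    is preserved by it. *)
Lemma diagonal_extraction (P : nat -> (nat -> nat) -> Prop) :
  (forall i th, extraction th -> exists psi, extraction psi /\ P i (fun n => th (psi n))) ->
  (forall i th th', P i th -> (exists n0, forall n, (n0 <= n)%nat -> exists m, (n <= m)%nat /\ th' n = th m) -> P i th') ->
  forall th, extraction th -> exists psi, extraction psi /\ forall i, P i (fun n => th (psi n)).
Proof.
  intros H1 H2 th Hth.
  assert (Hstep : forall i (s : {s | extraction s}), exists t, extraction t /\ P i (fun n => th (proj1_sig s (t n)))).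
  { intros i [s Hs]. simpl. destruct (H1 i (fun n => th (s n))) as [t [Ht HP]].
    - now apply extraction_comp.
    - exists t. split; assumption. }
  set (next := fun i (s : {s | extraction s}) =>
    let (t, H) := constructive_indefinite_description _ (Hstep i s) in
    exist extraction (fun n => proj1_sig s (t n)) (extraction_comp _ _ (proj1 H) (proj2_sig s))).
  assert (Hnext : forall i s, P i (fun n => th (proj1_sig (next i s) n)) /\
    exists t, extraction t /\ forall n, proj1_sig (next i s) n = proj1_sig s (t n)).
  { intros i s. unfold next. destruct (constructive_indefinite_description _ _) as [t [Ht HP]]. simpl.
    split; [exact HP|]. exists t. split; [exact Ht|reflexivity]. }
  assert (Hid : extraction (fun n => n)) by (intros i j Hij; exact Hij).
  set (S0 := fix S0 i := match i with O => exist extraction _ Hid | S j => next j (S0 j) end).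
  assert (HS : forall i k, exists t, extraction t /\ forall n, proj1_sig (S0 (i + k)%nat) n = proj1_sig (S0 i) (t n)).
  { intros i k. induction k as [|k [t [Ht E]]].
    - exists (fun n => n). rewrite Nat.add_0_r. split; [exact Hid|reflexivity].
    - rewrite Nat.add_succ_r. simpl. destruct (Hnext (i + k)%nat (S0 (i + k)%nat)) as [_ [u [Hu E']]].
      exists (fun n => t (u n)). split; [now apply extraction_comp|]. intros n. rewrite E', E. reflexivity. }
  (* The index [S n] puts all terms from [n = i] on inside [S0 (S i)], the stage that arranges
     [P i]. *)
  set (psi := fun n => proj1_sig (S0 (S n)) n).
  exists psi. split.
  - apply extraction_S. intros n. unfold psi.
    destruct (HS (S n) 1%nat) as [t [Ht E]]. replace (S n + 1)%nat with (S (S n)) in E by lia. rewrite E.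
    apply (proj2_sig (S0 (S n))). assert (X := extraction_ge t Ht (S n)). lia.
  - intros i. apply (H2 i (fun n => th (proj1_sig (S0 (S i)) n))).
    + apply Hnext.
    + exists i. intros n Hn. destruct (HS (S i) (n - i)%nat) as [t [Ht E]].
      replace (S i + (n - i))%nat with (S n) in E by lia. unfold psi. rewrite E.
      exists (t n). split; [now apply extraction_ge|reflexivity].
Qed.

Lemma IZR_INR_diff (k : Z) : IZR k = INR (Z.to_nat k) - INR (Z.to_nat (- k)).
Proof.
  destruct (Z_le_dec 0 k) as [H|H].
  - rewrite (INR_IZR_INZ (Z.to_nat k)), Z2Nat.id by exact H.
    replace (Z.to_nat (- k)) with 0%nat by lia. simpl. ring.
  - rewrite (INR_IZR_INZ (Z.to_nat (- k))), Z2Nat.id by lia.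
    replace (Z.to_nat k) with 0%nat by lia. rewrite opp_IZR. simpl. ring.
Qed.

(** Discs centred at grid points, with the reciprocal mesh a positive integer. An integer coordinate
    is coded as a difference of two naturals, and iterated Cantor pairing lists mesh and centre
    together. *)
Lemma countable_ball_basis : exists (ctr : nat -> C) (rad : nat -> R), forall z r, 0 < r ->
  exists i, Cmod (z - ctr i) < rad i /\ forall w, Cmod (w - ctr i) < rad i -> Cmod (w - z) < r.
Proof.
  set (code := fun i => let (k, j) := Cantor.of_nat i in let (j1, j2) := Cantor.of_nat j in
     let (a, b) := Cantor.of_nat j1 in let (c, d) := Cantor.of_nat j2 in (k, (a, b), (c, d))).
  assert (Hcode : forall k a b c d, exists i, code i = (k, (a, b), (c, d))).
  { intros k a b c d. exists (Cantor.to_nat (k, Cantor.to_nat (Cantor.to_nat (a, b), Cantor.to_nat (c, d)))).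
    unfold code. now rewrite !Cantor.cancel_of_to. }
  set (scale := fun i => INR (fst (fst (code i))) + 1).
  exists (fun i => ((INR (fst (snd (fst (code i)))) - INR (snd (snd (fst (code i))))) / scale i,
                (INR (fst (snd (code i))) - INR (snd (snd (code i)))) / scale i)).
  exists (fun i => 3 / scale i).
  (* With mesh [1 / s], rounding gives a grid point within [2 / s] of [z]; the disc of radius
     [3 / s] around it lies within [5 / s] of [z], and [6 / s <= r]. *)
  intros [x y] r Hr. destruct (INR_unbounded (6 / r)) as [k Hk].
  set (s := INR k + 1). assert (Hs : 0 < s) by (unfold s; assert (X := pos_INR k); lra).
  destruct (archimed (x * s)) as [X1 X2]. destruct (archimed (y * s)) as [Y1 Y2].
  set (u := up (x * s)) in *. set (v := up (y * s)) in *.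
  destruct (Hcode k (Z.to_nat u) (Z.to_nat (- u)) (Z.to_nat v) (Z.to_nat (- v))) as [i Hi].
  exists i. unfold scale. rewrite Hi. cbn [fst snd]. fold s. rewrite <- !IZR_INR_diff.
  set (c0 := (IZR u / s, IZR v / s) : C). set (z0 := (x, y) : C).
  assert (A : Cmod (z0 - c0) <= 2 / s).
  { eapply Rle_trans; [apply Cmod_le_fst_snd|]. simpl.
    assert (G : forall a n, IZR n > a * s -> IZR n - a * s <= 1 -> Rabs (a + - (IZR n / s)) <= 1 / s).
    { intros a n G1 G2. replace (a + - (IZR n / s)) with (- ((IZR n - a * s) / s)) by (field; lra).
      rewrite Rabs_Ropp, Rabs_right.
      - apply Rmult_le_compat_r; [|lra]. apply Rlt_le. now apply Rinv_0_lt_compat.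
      - apply Rle_ge. apply Rmult_le_pos; [lra|]. apply Rlt_le. now apply Rinv_0_lt_compat. }
    assert (G1 := G x u X1 X2). assert (G2 := G y v Y1 Y2).
    assert (G3 : 2 / s = 1 / s + 1 / s) by (field; lra). lra. }
  assert (I : 0 < / s) by now apply Rinv_0_lt_compat.
  split; [unfold Rdiv in *; lra|].
  intros w Hw. assert (T := Cmod_dist_triangle w c0 z0).
  rewrite (Cmod_minus_sym c0 z0) in T.
  assert (K : 6 / s <= r).
  { apply Rle_div_l; [lra|]. apply Rlt_div_l in Hk; [|lra]. unfold s. nra. }
  unfold Rdiv in *. lra.
Qed.

Lemma cv_loc_unif_tail (A : C -> Prop) (q : nat -> C -> sphere) (g : C -> sphere) (th th' : nat -> nat) :
  (exists n0, forall n, (n0 <= n)%nat -> exists m, (n <= m)%nat /\ th' n = th m) ->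
  cv_loc_unif A (fun n => q (th n)) g -> cv_loc_unif A (fun n => q (th' n)) g.
Proof.
  intros [n0 Hn0] H z Hz. destruct (H z Hz) as [r [Hr K]]. exists r. split; [exact Hr|].
  intros eps Heps. destruct (K eps Heps) as [n1 Hn1]. exists (n0 + n1)%nat. intros n Hn w Hw Hwz.
  destruct (Hn0 n ltac:(lia)) as [m [Hm ->]]. apply Hn1; auto. lia.
Qed.

(** Every point of [D] lies in a basis disc contained in a disc of local normality, and such a disc
    is [good]. The diagonal runs over all indices, those that are not good imposing no condition. *)
Lemma locally_normal_diagonal (D : C -> Prop) (q : nat -> C -> sphere) (th : nat -> nat) :
  locally_normal D q -> extraction th -> exists psi, extraction psi /\
    forall z, D z -> exists r L, 0 < r /\ cv_loc_unif (punctured z r) (fun n => q (th (psi n))) (fun w => Fin (L w)).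
Proof.
  intros Hln Hth. destruct countable_ball_basis as [ctr [rad Hball]].
  set (nice := fun i s => forall z, Cmod (z - ctr i) < rad i ->
    exists r L, 0 < r /\ cv_loc_unif (punctured z r) (fun n => q (s n)) (fun w => Fin (L w))).
  set (good := fun i => forall s, extraction s -> exists t, extraction t /\ nice i (fun n => s (t n))).
  destruct (diagonal_extraction (fun i s => good i -> nice i s)) with (th := th) as [psi [Hpsi HP]].
  - intros i s Hs. destruct (classic (good i)) as [G|G].
    + destruct (G s Hs) as [t [Ht K]]. exists t. split; auto.
    + exists (fun n => n). split; [intros a b Hab; exact Hab|]. intros G'. contradiction.
  - intros i s s' H Hss G z Hz. destruct (H G z Hz) as [r [L [Hr K]]]. exists r, L. split; [exact Hr|].
    eapply cv_loc_unif_tail; eassumption.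
  - exact Hth.
  - exists psi. split; [exact Hpsi|]. intros z Dz. destruct (Hln z Dz) as [r [Hr K]].
    destruct (Hball z r Hr) as [i [Hi1 Hi2]].
    apply (HP i); [|exact Hi1]. intros s Hs. destruct (K s Hs) as [t [Ht Kt]]. exists t. split; [exact Ht|].
    intros w Hw. destruct (Kt w (Hi2 w Hw)) as [r' [L [Hr' KL]]]. now exists r', L.
Qed.

(** * From local normality to quasi-normality *)

Definition sph_tends (u : nat -> sphere) (l : sphere) : Prop :=
  forall eps, 0 < eps -> exists n0, forall n, (n0 <= n)%nat -> sph_dist (u n) l < eps.

Lemma sph_tends_unique u l l' : sph_tends u l -> sph_tends u l' -> l = l'.
Proof.
  intros H1 H2. apply sph_points_separated. intros d Hd.
  destruct (half_chord_small d Hd) as [e [He K]].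
  destruct (H1 e He) as [n1 N1]. destruct (H2 e He) as [n2 N2].
  exists (u (n1 + n2)%nat). split; apply K; [apply N1|apply N2]; lia.
Qed.

Lemma cv_loc_unif_tends A f g w : cv_loc_unif A f g -> A w -> sph_tends (fun n => f n w) (g w).
Proof.
  intros H Hw eps Heps. destruct (H w Hw) as [r [Hr K]]. destruct (K eps Heps) as [n0 Hn].
  exists n0. intros n Hn'. apply Hn; auto. now apply Cmod_center.
Qed.

(** A subsequence tending to [Inf] has a further one with finite limits on some punctured disc.
    Exceptional points do not accumulate, so some point of that disc would carry both limits. *)
Lemma locally_normal_no_Inf (D : C -> Prop) (q : nat -> C -> sphere) :
  (exists z, D z) -> open D -> locally_normal D q -> no_subseq_to_Inf D q.
Proof.
  intros [z0 Dz0] HD Hln th Hth [E [[HE1 HE2] Hcv]].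
  destruct (Hln z0 Dz0) as [r [Hr K]]. destruct (K th Hth) as [psi [Hpsi Kp]].
  destruct (Kp z0 (Cmod_center z0 r Hr)) as [r' [L [Hr' Hc]]].
  assert (HE : exists s, 0 < s /\ forall w, punctured z0 s w -> ~ E w).
  { apply NNPP. intros N. apply (HE2 z0). split; [exact Dz0|]. intros s Hs.
    apply NNPP. intros N'. apply N. exists s. split; [exact Hs|]. intros w [W1 W2] Ew.
    apply N'. now exists w. }
  destruct HE as [s [Hs HEs]].
  specialize (HD z0 Dz0). apply locally_Cmod in HD. destruct HD as [t [Ht HDt]].
  destruct (punctured_point z0 (Rmin r' (Rmin s t))) as [w [W1 W2]]; [repeat apply Rmin_glb_lt; assumption|].
  assert (A1 := Rmin_l r' (Rmin s t)). assert (A2 := Rmin_r r' (Rmin s t)).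
  assert (A3 := Rmin_l s t). assert (A4 := Rmin_r s t).
  assert (T1 : sph_tends (fun n => q (th (psi n)) w) (Fin (L w))).
  { apply (cv_loc_unif_tends _ _ _ w Hc). split; [exact W1|lra]. }
  assert (T2 : sph_tends (fun n => q (th n) w) Inf).
  { apply (cv_loc_unif_tends _ _ (fun _ => Inf) w Hcv). split.
    - apply HDt. lra.
    - apply HEs. split; [exact W1|lra]. }
  assert (T3 : sph_tends (fun n => q (th (psi n)) w) Inf).
  { intros eps Heps. destruct (T2 eps Heps) as [n0 Hn]. exists n0. intros n Hn'. apply Hn.
    assert (X := extraction_ge psi Hpsi n). lia. }
  discriminate (sph_tends_unique _ _ _ T1 T3).
Qed.

(** Quasi-normality concerns sequences drawn from the set of members, which may repeat them or list
    them in any order. Either one index recurs infinitely often, or the indices tend to infinity. *)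
Lemma constant_or_increasing (k : nat -> nat) : exists th, extraction th /\
  ((exists k0, forall n, k (th n) = k0) \/ extraction (fun n => k (th n))).
Proof.
  destruct (classic (exists k0, forall N, exists n, (N <= n)%nat /\ k n = k0)) as [[k0 H]|H].
  - destruct (extraction_of_frequent (fun _ n => k n = k0)) as [th [Hth E]]; [intros _; exact H|].
    exists th. split; [exact Hth|]. left. now exists k0.
  - assert (Hinf : forall K, exists N, forall n, (N <= n)%nat -> (K < k n)%nat).
    { assert (Hne : forall k0, exists N, forall n, (N <= n)%nat -> k n <> k0).
      { intros k0. apply NNPP. intros N1. apply H. exists k0. intros N. apply NNPP. intros N2.
        apply N1. exists N. intros n Hn E. apply N2. now exists n. }
      induction K as [|K [N1 IH]].
      - destruct (Hne 0%nat) as [N HN]. exists N. intros n Hn. specialize (HN n Hn). lia.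
      - destruct (Hne (S K)) as [N HN]. exists (N + N1)%nat. intros n Hn.
        specialize (HN n ltac:(lia)). specialize (IH n ltac:(lia)). lia. }
    assert (Hnext : forall j, exists n, (j < n)%nat /\ (k j < k n)%nat).
    { intros j. destruct (Hinf (k j)) as [N HN]. exists (S j + N)%nat. split; [lia|]. apply HN. lia. }
    set (next := fun j => proj1_sig (constructive_indefinite_description _ (Hnext j))).
    assert (Hn : forall j, (j < next j)%nat /\ (k j < k (next j))%nat).
    { intros j. unfold next. now destruct (constructive_indefinite_description _ (Hnext j)). }
    set (th := fun n => Nat.iter n next 0%nat).
    exists th. split; [|right]; apply extraction_S; intros n; apply (Hn (th n)).
Qed.

Lemma locally_normal_quasi_normal (D : C -> Prop) (q : nat -> C -> sphere) :
  (forall n, meromorphic D (q n)) -> locally_normal D q -> quasi_normal_seq D q.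
Proof.
  intros Hm Hln. split; [intros f [n ->]; apply Hm|].
  intros f Hf.
  set (k := fun n => proj1_sig (constructive_indefinite_description _ (Hf n))).
  assert (Ek : forall n, f n = q (k n)).
  { intros n. unfold k. now destruct (constructive_indefinite_description _ (Hf n)). }
  destruct (constant_or_increasing k) as [th [Hth [[k0 E]|Hinc]]].
  - exists (fun _ => False), th, (q k0). split; [split|split].
    + intros z [].
    + intros z [_ H]. destruct (H 1 Rlt_0_1) as [w [[] _]].
    + exact Hth.
    + intros z Hz. exists 1. split; [lra|]. intros eps Heps. exists 0%nat. intros n _ w _ _.
      rewrite Ek, E, sph_dist_diag. exact Heps.
  - destruct (locally_normal_diagonal D q (fun n => k (th n)) Hln Hinc) as [psi [Hpsi Hloc]].
    set (s := fun n => q (k (th (psi n)))) in *.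
    (* Points without locally uniform convergence on any full disc. The punctured discs of
       convergence keep them from accumulating in [D]. *)
    set (E := fun z => D z /\ ~ exists r (L : C -> sphere), 0 < r /\ cv_loc_unif (fun w => Cmod (w - z) < r) s L).
    (* Choosing the pointwise limit glues the local limits, since they are unique. *)
    set (g := fun w => epsilon (inhabits Inf) (sph_tends (fun n => s n w))).
    exists E, (fun n => th (psi n)), g. split; [split|split].
    + intros z [Dz _]. exact Dz.
    + intros z [Dz Hacc]. destruct (Hloc z Dz) as [r [L [Hr Hcv]]].
      destruct (Hacc r Hr) as [w [[Dw Ew] [W1 W2]]]. apply Ew.
      destruct (punctured_open z w r (conj W1 W2)) as [t [Ht Hsub]].
      exists t, (fun v => Fin (L v)). split; [exact Ht|].
      intros v Hv. destruct (Hcv v (Hsub v Hv)) as [r1 [Hr1 K]]. exists r1. split; [exact Hr1|].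
      intros eps Heps. destruct (K eps Heps) as [n0 Hn]. exists n0. intros n Hn' u Hu Huv. apply Hn; auto.
    + now apply extraction_comp.
    + intros z [Dz Hz].
      assert (Hz' : exists r (L : C -> sphere), 0 < r /\ cv_loc_unif (fun w => Cmod (w - z) < r) s L).
      { apply NNPP. intros N. apply Hz. now split. }
      destruct Hz' as [r [L [Hr Hcv]]].
      assert (EL : forall w, Cmod (w - z) < r -> g w = L w).
      { intros w Hw. assert (T := cv_loc_unif_tends _ _ _ w Hcv Hw).
        apply (sph_tends_unique (fun n => s n w)); [|exact T].
        unfold g. apply epsilon_spec. now exists (L w). }
      destruct (Hcv z (Cmod_center z r Hr)) as [r1 [Hr1 K]].
      assert (A1 := Rmin_l r r1). assert (A2 := Rmin_r r r1).
      exists (Rmin r r1). split; [now apply Rmin_glb_lt|].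
      intros eps Heps. destruct (K eps Heps) as [n0 Hn]. exists n0. intros n Hn' w _ Hw.
      rewrite Ek, EL by lra. apply (Hn n Hn' w); lra.
Qed.

(** * Application to consecutive derivatives *)

Lemma mero_holomorphic (f : C -> sphere) (z : C) : mero_at f z -> f z <> Inf -> holomorphic_at f z.
Proof. intros [H|[H _]] N; [exact H|contradiction]. Qed.

(** Of the three consecutive derivatives [K], [H], [G], only [G] is controlled, through its
    logarithmic derivative. Where [F] is finite and bounded, that logarithmic derivative is finite
    for large [n], so [G] is holomorphic without zeros, and the linear system for the triple holds
    there. *)
Lemma quotients_locally_normal (D : C -> Prop) (N : nat) (K : nat -> C -> sphere) (F : C -> sphere) :
  planar_domain D -> (forall n z, D z -> mero_at (K n) z) ->
  (forall n, not_identically_zero D (mderiv (mderiv (K n)))) ->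
  (forall z, D z -> mero_at F z) ->
  cv_loc_unif D (fun n => logderiv (mderiv (mderiv (K n)))) F ->
  (forall n z k, D z -> zero_of_mult (mderiv (mderiv (K n))) z k -> (k <= N)%nat) ->
  locally_normal D (fun n => mquot (mderiv (K n)) (K n)) /\
  locally_normal D (fun n => mquot (mderiv (mderiv (K n))) (mderiv (K n))).
Proof.
  intros HD HK Hnz HF Hcv Hmult.
  set (H := fun n => mderiv (K n)). set (G := fun n => mderiv (H n)).
  assert (mH : forall n z, D z -> mero_at (H n) z) by (intros n z Dz; now apply mero_mderiv, HK).
  assert (mG : forall n z, D z -> mero_at (G n) z) by (intros n z Dz; now apply mero_mderiv, mH).
  assert (vG : forall n z, D z -> ~ vanishes_near (fun w => fin (G n w)) z).
  { intros n z Dz. apply (identity_theorem D (G n) HD); auto. apply Hnz. }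
  assert (Main : forall z0, D z0 -> exists r0 M, 0 < r0 /\ 0 <= M /\
    (forall w, punctured z0 r0 w -> Cmod (fin (F w)) * Cmod (w - z0) <= M) /\
    (forall w, punctured z0 r0 w -> ccont (fun v => fin (F v)) w) /\
    forall d eta, 0 < d -> 0 < eta -> exists n0, forall n, (n0 <= n)%nat ->
      forall w, annulus z0 d r0 w -> Cmod (fin (logderiv (G n) w) - fin (F w)) <= eta /\
        is_cd (fun v => fin (K n v)) w (fin (H n w)) /\ is_cd (fun v => fin (H n v)) w (fin (G n w)) /\
        is_cd (fun v => fin (G n v)) w (fin (logderiv (G n) w) * fin (G n w))%C /\ fin (G n w) <> RtoC 0).
  { intros z0 Dz0.
    destruct (Hcv z0 Dz0) as [r1 [Hr1 Hunif]].
    assert (HDo := proj1 (proj2 HD) z0 Dz0). apply locally_Cmod in HDo. destruct HDo as [r2 [Hr2 HDr]].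
    set (R0 := Rmin r1 r2). assert (HR0 : 0 < R0) by now apply Rmin_glb_lt.
    assert (A1 : R0 <= r1) by apply Rmin_l. assert (A2 : R0 <= r2) by apply Rmin_r.
    assert (HDR : forall w, Cmod (w - z0) < R0 -> D w) by (intros w Hw; apply HDr; lra).
    assert (Hucv : ucv_sph (fun w => Cmod (w - z0) < R0) (fun n => logderiv (G n)) F).
    { intros eps Heps. destruct (Hunif eps Heps) as [n0 Hn]. exists n0. intros n Hn' w Hw.
      apply Hn; auto. lra. }
    destruct (limit_simple_pole G F z0 R0 N HR0) as [r3 [M [Hr3 [Hr3R [HM HFM]]]]]; auto.
    { intros n z k Hz Hzm. apply (Hmult n z k); auto. }
    destruct (mero_at_regular F z0 (HF z0 Dz0)) as [r4 [Hr4 HFreg]].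
    assert (B1 := Rmin_l r3 r4). assert (B2 := Rmin_r r3 r4).
    exists (Rmin r3 r4), M. split; [now apply Rmin_glb_lt|]. split; [exact HM|]. split; [|split].
    - intros w Hw. apply HFM. eapply punctured_mono; eassumption.
    - intros w Hw. destruct (HFreg w (punctured_mono _ _ _ _ B2 Hw)) as [_ [l Hl]]. eapply is_cd_ccont, Hl.
    - intros d eta Hd He.
      destruct (ucv_sph_Fin _ _ _ (M / d) eta Hucv) as [n0 Hn0]; [|exact He|].
      { apply Rmult_le_pos; [exact HM|]. apply Rlt_le. now apply Rinv_0_lt_compat. }
      exists n0. intros n Hn w [W1 W2].
      assert (Hw : punctured z0 (Rmin r3 r4) w). { split; [|exact W2]. intros ->. rewrite Cmod_minus_diag in W1. lra. }
      destruct (HFM w (punctured_mono _ _ _ _ B1 Hw)) as [F1 F2].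
      assert (Dw : D w) by (apply HDR; lra).
      destruct (Hn0 n Hn w) as [Q1 Q2]; [lra|exact F1| |].
      { apply Rle_div_r; [exact Hd|]. eapply Rle_trans; [|exact F2]. apply Rmult_le_compat_l; [apply Cmod_ge_0|exact W1]. }
      split; [exact Q2|].
      destruct (logderiv_finite (G n) w (mG n w Dw) (vG n w Dw) Q1) as [G1 [G2 G3]].
      assert (GI : G n w <> Inf).
      { apply holomorphic_at_iff in G1. destruct G1 as [t [Ht G1]]. apply (G1 w (Cmod_center w t Ht)). }
      (* [mderiv] sends [Inf] to [Inf], so a pole of [H] or [K] at [w] would be a pole of [G]. *)
      assert (HI : H n w <> Inf) by now apply mderiv_neq_Inf.
      assert (KI : K n w <> Inf) by now apply mderiv_neq_Inf.
      split; [|split; [|split]]; auto.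
      + apply holomorphic_mderiv. apply mero_holomorphic; auto.
      + apply holomorphic_mderiv. apply mero_holomorphic; auto. }
  assert (Pt : forall p r, 0 < r -> punctured p r (circ p (r / 2) 0)).
  { intros p r Hr. assert (X : Cmod (circ p (r / 2) 0 - p) = r / 2) by (apply Cmod_circ; lra). split; [|lra].
    intros E. rewrite E, Cmod_minus_diag in X. lra. }
  assert (Nz : forall x y z, z <> RtoC 0 -> sq3 x y z <> 0).
  { intros x y z Hz E. apply Hz. destruct (sq3_bound x y z 0) as [_ [_ Z]]; [lra|rewrite E; lra|]. now apply Cmod_le_0. }
  assert (Ev : forall z0 r0, 0 < r0 -> (forall d eta, 0 < d -> 0 < eta -> exists n0, forall n, (n0 <= n)%nat ->
      forall w, annulus z0 d r0 w -> fin (G n w) <> RtoC 0) ->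
      exists n0, forall n, (n0 <= n)%nat -> fin (G n (circ z0 (r0 / 2) 0)) <> RtoC 0).
  { intros z0 r0 Hr0 X. destruct (X (r0 / 2) 1 ltac:(lra) Rlt_0_1) as [n0 Hn]. exists n0. intros n Hn'. apply Hn; [exact Hn'|].
    unfold annulus. rewrite Cmod_circ by lra. lra. }
  split; intros z0 Dz0; destruct (Main z0 Dz0) as [r0 [M [Hr0 [HM [HFM [HFc Hsys]]]]]];
  (destruct (Ev z0 r0 Hr0) as [n1 Hn1];
    [intros d eta Hd He; destruct (Hsys d eta Hd He) as [n0 Hn0]; exists n0; intros n Hn w Hw; apply (Hn0 n Hn w Hw)|]);
  exists (r0 / 2); (split; [lra|]).
  - apply (local_subsequence (RtoC 1) z0 r0 M (fun n w => fin (logderiv (G n) w)) (fun w => fin (F w))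
      (fun n w => fin (K n w)) (fun n w => fin (H n w)) (fun n w => fin (G n w)) H K (circ z0 (r0 / 2) 0)); auto.
    + rewrite Cmod_1. lra.
    + intros d eta Hd He. destruct (Hsys d eta Hd He) as [n0 Hn0]. exists n0. intros n Hn. split.
      * intros w Hw. destruct (Hn0 n Hn w Hw) as [_ [D1 [D2 [D3 _]]]]. rewrite Cmult_1_l. auto.
      * intros w Hw. apply (Hn0 n Hn w Hw).
    + exists n1. auto.
    + left. auto.
  (* For [G / H] the first component is replaced by zero, so that only the pair [(H, G)] is
     normalised. *)
  - apply (local_subsequence (RtoC 0) z0 r0 M (fun n w => fin (logderiv (G n) w)) (fun w => fin (F w))
      (fun n w => RtoC 0) (fun n w => fin (H n w)) (fun n w => fin (G n w)) G H (circ z0 (r0 / 2) 0)); auto.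
    + rewrite Cmod_0. lra.
    + intros d eta Hd He. destruct (Hsys d eta Hd He) as [n0 Hn0]. exists n0. intros n Hn. split.
      * intros w Hw. destruct (Hn0 n Hn w Hw) as [_ [_ [D2 [D3 _]]]]. rewrite Cmult_0_l.
        split; [apply is_cd_const|]. auto.
      * intros w Hw. apply (Hn0 n Hn w Hw).
    + exists n1. auto.
    + right. auto.
Qed.

Theorem corollary1p3 :
  forall (D : C -> Prop) (N m : nat) (f : nat -> C -> sphere)
         (Fm : C -> sphere),
    planar_domain D ->
    (1 <= N)%nat ->
    (2 <= m)%nat ->
    (forall n, meromorphic D (f n)) ->
    (forall n, not_identically_zero D (mderiv_n m (f n))) ->
    meromorphic D Fm ->
    cv_loc_unif D
      (fun n => mquot (mderiv_n (m + 1) (f n)) (mderiv_n m (f n))) Fm ->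
    (forall n z k, D z -> zero_of_mult (mderiv_n m (f n)) z k -> (k <= N)%nat) ->
    let q1 := fun n => mquot (mderiv_n m (f n)) (mderiv_n (m - 1) (f n)) in
    let q2 := fun n => mquot (mderiv_n (m - 1) (f n)) (mderiv_n (m - 2) (f n)) in
    quasi_normal_seq D q1 /\ no_subseq_to_Inf D q1 /\
    quasi_normal_seq D q2 /\ no_subseq_to_Inf D q2.
Proof.
  intros D N m f Fm HD _ Hm Hf Hnz HF Hcv Hmult q1 q2.
  destruct m as [|[|l]]; [lia|lia|].
  (* With [m = l + 2], [K n] is the derivative of order [m - 2], the lowest one occurring in the
     quotients. *)
  set (K := fun n => mderiv_n l (f n)).
  assert (E1 : q1 = fun n => mquot (mderiv (mderiv (K n))) (mderiv (K n))).
  { unfold q1. replace (S (S l) - 1)%nat with (S l) by lia. reflexivity. }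
  assert (E2 : q2 = fun n => mquot (mderiv (K n)) (K n)).
  { unfold q2. replace (S (S l) - 1)%nat with (S l) by lia. replace (S (S l) - 2)%nat with l by lia. reflexivity. }
  replace (S (S l) + 1)%nat with (S (S (S l))) in Hcv by lia.
  assert (HK : forall n z, D z -> mero_at (K n) z) by (intros n z Dz; apply mero_mderiv_n; now apply Hf).
  destruct (quotients_locally_normal D N K Fm HD HK Hnz HF Hcv Hmult) as [L2 L1].
  assert (vG : forall n z, D z -> ~ vanishes_near (fun w => fin (mderiv (mderiv (K n)) w)) z).
  { intros n z Dz. apply (identity_theorem D _ HD); auto using mero_mderiv. apply Hnz. }
  assert (vH : forall n z, D z -> ~ vanishes_near (fun w => fin (mderiv (K n) w)) z).
  { intros n z Dz V. apply (vG n z Dz). apply vanishes_near_mderiv; auto using mero_mderiv. }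
  assert (vK : forall n z, D z -> ~ vanishes_near (fun w => fin (K n w)) z).
  { intros n z Dz V. apply (vH n z Dz). apply vanishes_near_mderiv; auto. }
  destruct HD as [HD1 [HD2 HD3]]. rewrite E1, E2.
  split; [|split; [|split]].
  - apply locally_normal_quasi_normal; [|exact L1]. intros n z Dz. apply mquot_local; auto using mero_mderiv.
  - now apply locally_normal_no_Inf.
  - apply locally_normal_quasi_normal; [|exact L2]. intros n z Dz. apply mquot_local; auto using mero_mderiv.
  - now apply locally_normal_no_Inf.
Qed.
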